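(* For every $N \in \{1, 2, \ldots, +\infty\}$ there exists a closed (in the norm topology) shift invariant subspace $E_N \subset \mathcal{B}_0$ of the little Bloch space such that $\operatorname{ind}(E_N) = N$.
   Context: Let $\mathbb{D}=\{z\in\mathbb{C}: |z|<1\}$. The Bloch space $\mathcal{B}$ is the Banach space of functions $f$ analytic in $\mathbb{D}$ with $\sup_{|z|<1}(1-|z|^2)|f'(z)|<+\infty$, with norm $\|f\|_{\mathcal{B}} = |f(0)|+\sup_{|z|<1}(1-|z|^2)|f'(z)|$. The little Bloch space $\mathcal{B}_0$ is the closure of the analytic polynomials in $\mathcal{B}$; equivalently, $\mathcal{B}_0=\{f\in\mathcal{B}:\lim_{|z|\to1^-}(1-|z|^2)|f'(z)|=0\}$. The shift operator is $M_z:\mathcal{B}_0\to\mathcal{B}_0$, $(M_zf)(z)=zf(z)$; it is bounded and bounded below. A (closed) invariant subspace of $\mathcal{B}_0$ is a norm-closed linear subspace $E\subset\mathcal{B}_0$ with $zE:=M_zE\subset E$; then $zE$ is closed. The index of $E$ is $\operatorname{ind}(E)=\dim(E/zE)$; $\operatorname{ind}(E)=+\infty$ means that $E/zE$ is infinite-dimensional. *)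

(* Defs.v *)
(* Stdlib reals and Coquelicot's complex numbers. *)
From Stdlib Require Import Reals.
From Coquelicot Require Import Coquelicot.

Open Scope R_scope.

(* Functions on the open unit disk D are represented by total functions C -> C
   of which only the values on D matter.  Every set of functions used below
   (Bloch, little_bloch, closed subspaces, shift_image) is saturated for
   equality on D; for a closed subspace this holds because two functions that
   agree on D are at Bloch distance 0. *)

Definition unit_disk (z : C) : Prop := Cmod z < 1.

Definition analytic_on_disk (f : C -> C) : Prop :=
  forall z : C, unit_disk z ->
    ex_derive (K := C_AbsRing) (V := C_NormedModule) f z.

Definition fplus (f g : C -> C) : C -> C := fun z => (f z + g z)%C.
Definition fminus (f g : C -> C) : C -> C := fun z => (f z - g z)%C.
Definition fscal (c : C) (f : C -> C) : C -> C := fun z => (c * f z)%C.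

Definition bloch_seminorm (f : C -> C) : Rbar :=
  Lub_Rbar (fun r : R => exists z : C,
    unit_disk z /\ r = (1 - (Cmod z) ^ 2) * Cmod (C_derive f z)).

(* Valued in Rbar so that an infinite supremum is not truncated. *)
Definition bloch_norm (f : C -> C) : Rbar :=
  Rbar_plus (Finite (Cmod (f (RtoC 0)))) (bloch_seminorm f).

Definition Bloch (f : C -> C) : Prop :=
  analytic_on_disk f /\ Rbar_lt (bloch_seminorm f) p_infty.

Definition bloch_closure (A : (C -> C) -> Prop) (f : C -> C) : Prop :=
  Bloch f /\
  forall eps : R, 0 < eps ->
    exists g : C -> C, A g /\ Rbar_lt (bloch_norm (fminus f g)) (Finite eps).

Definition analytic_polynomial (p : C -> C) : Prop :=
  exists (n : nat) (a : nat -> C),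
    forall z : C,
      p z = sum_n (G := C_AbelianMonoid) (fun k => (a k * z ^ k)%C) n.

Definition little_bloch : (C -> C) -> Prop :=
  bloch_closure analytic_polynomial.

Definition linear_subspace (E : (C -> C) -> Prop) : Prop :=
  E (fun _ => RtoC 0) /\
  (forall f g, E f -> E g -> E (fplus f g)) /\
  (forall c f, E f -> E (fscal c f)).

(* Closed in Bloch is the same as closed in little_bloch for subsets of the
   latter, which is itself closed in Bloch. *)
Definition bloch_closed (E : (C -> C) -> Prop) : Prop :=
  forall f, bloch_closure E f -> E f.

Definition shift (f : C -> C) : C -> C := fun z => (z * f z)%C.

Definition closed_shift_invariant_subspace (E : (C -> C) -> Prop) : Prop :=
  (forall f, E f -> little_bloch f) /\
  linear_subspace E /\
  bloch_closed E /\
  (forall f, E f -> E (shift f)).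

Definition shift_image (E : (C -> C) -> Prop) (f : C -> C) : Prop :=
  exists g, E g /\ forall z, unit_disk z -> f z = shift g z.

Definition lin_comb (n : nat) (c : nat -> C) (b : nat -> C -> C) : C -> C :=
  fun z => sum_n_m (G := C_AbelianMonoid) (fun i => (c i * b i z)%C) 1 n.

(* The classes of b 1, ..., b n modulo F form a basis of E / F. *)
Definition quotient_basis (E F : (C -> C) -> Prop)
    (n : nat) (b : nat -> C -> C) : Prop :=
  (forall i : nat, (1 <= i <= n)%nat -> E (b i)) /\
  (forall f, E f -> exists c : nat -> C, F (fminus f (lin_comb n c b))) /\
  (forall c : nat -> C, F (lin_comb n c b) ->
     forall i : nat, (1 <= i <= n)%nat -> c i = RtoC 0).

(* dim (E / F) = d, where None stands for +oo. *)
Definition quotient_dim (E F : (C -> C) -> Prop) (d : option nat) : Prop :=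
  match d with
  | Some n => exists b : nat -> C -> C, quotient_basis E F n b
  | None => forall (n : nat) (b : nat -> C -> C), ~ quotient_basis E F n b
  end.

Definition has_index (E : (C -> C) -> Prop) (d : option nat) : Prop :=
  quotient_dim E (shift_image E) d.

(* Main.v *)
(* The functionals sum_j p_j f_j |-> p_i(0) are bounded on the algebraic span of
   generators f_0, f_1, ... of B_0, so the f_j stay independent modulo the shift of
   the closed span.  The generators are limits of polynomials.  For each i one keeps
   a polynomial g with E(p f_j conj g) = delta_ij p(0) - E(p conj V_j), where E is the
   mean over the circle and V_j is the defect.  To reduce V_a, add R T to f_a and
   V_a T / R to g, where T is an almost unimodular polynomial of huge frequencies
   and tiny Bloch norm: V_a shrinks by a fixed factor, the other defects grow only
   by O(1/R), the change of f_a is small in B_0, and the change of g costs at most a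
   multiple of the weighted defect w_a |V_a|.  A potential argument bounds the total
   cost while all defects tend to zero.  The polynomials T come from
   T <- T + eps z^m (1 - |T|^2): for m large the Bloch norms do not accumulate, while
   the mean square of T increases until |T| is nearly 1. *)

Require Import Defs.
From Stdlib Require Import Arith Reals Lra Lia Classical ClassicalEpsilon.
From Coquelicot Require Import Coquelicot.

Open Scope C_scope.

(** The difficulty is that infinitely many functionals share the same generators, so a change of f_a
    disturbs all of them at once. For this reason T is produced from a degree bound d and from eps
    alone, with estimates valid for every test polynomial W of degree at most d: one T then serves
    the defect V_a of each functional, while each functional keeps its own budget against the common
    weights w_j. The factor R is free of charge. The change R T has seminorm at most 3 R eps, which
    is set to 1/w_a, and pairing with V_a T / R costs 72 / (R eps) times the size of V_a. The
    product 3 * 72 = 216 no longer contains R, so R can be as large as the other generators require.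
    Bounded functionals give more than independence. For finite N the constant terms p_j(0) of
    approximants converge, and since the shift is bounded below the remainders still converge after
    division by z; hence the f_j also span the quotient. For infinite N independence and linear
    algebra suffice. All objects before the final limit are polynomials, so averages over roots of
    unity can play the role of integrals. *)

Fixpoint csum (n : nat) (F : nat -> C) : C :=
  match n with O => RtoC 0 | S k => csum k F + F k end.

Lemma csum_ext n F G : (forall k, (k < n)%nat -> F k = G k) -> csum n F = csum n G.
Proof.
  induction n as [|n IH]; intros H; simpl; [easy|].
  rewrite IH, (H n); auto.
Qed.

Lemma csum_plus n F G : csum n (fun k => F k + G k) = csum n F + csum n G.
Proof. induction n as [|n IH]; simpl; [ring | rewrite IH; ring]. Qed.

Lemma csum_scal n c F : csum n (fun k => c * F k) = c * csum n F.
Proof. induction n as [|n IH]; simpl; [ring | rewrite IH; ring]. Qed.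

Lemma csum_conj n F : Cconj (csum n F) = csum n (fun k => Cconj (F k)).
Proof.
  induction n as [|n IH]; simpl.
  - apply injective_projections; simpl; ring.
  - rewrite Cplus_conj, IH; easy.
Qed.

Lemma csum_0 n F : (forall k, (k < n)%nat -> F k = RtoC 0) -> csum n F = RtoC 0.
Proof.
  induction n as [|n IH]; intros H; simpl; [easy|].
  rewrite IH, (H n); auto; ring.
Qed.

Lemma csum_shift n F : csum (S n) F = F O + csum n (fun k => F (S k)).
Proof.
  induction n as [|n IH]; [simpl; ring|].
  change (csum (S (S n)) F) with (csum (S n) F + F (S n)). rewrite IH; simpl; ring.
Qed.

Lemma csum_swap n m (F : nat -> nat -> C) :
  csum n (fun i => csum m (F i)) = csum m (fun j => csum n (fun i => F i j)).
Proof.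
  induction n as [|n IH]; simpl.
  - symmetry; apply csum_0; easy.
  - rewrite IH, <- csum_plus; easy.
Qed.

Lemma Re_csum_nonneg n F : (forall k, (k < n)%nat -> 0 <= Re (F k))%R -> (0 <= Re (csum n F))%R.
Proof.
  induction n as [|n IH]; intros H; simpl; [lra|].
  specialize (IH ltac:(auto)). specialize (H n ltac:(auto)). unfold Re in *; simpl; lra.
Qed.

(** * Points of the unit circle *)

Definition cis (t : R) : C := (cos t, sin t).

Lemma Cmod_cis t : Cmod (cis t) = 1%R.
Proof.
  unfold cis, Cmod; simpl fst; simpl snd. rewrite <- sqrt_1; f_equal.
  rewrite <- (sin2_cos2 t); unfold Rsqr; ring.
Qed.

Lemma cis_add a b : cis (a + b) = cis a * cis b.
Proof. unfold cis; apply injective_projections; simpl; [rewrite cos_plus | rewrite sin_plus]; ring. Qed.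

Lemma cis_pow t n : cis t ^ n = cis (INR n * t).
Proof.
  induction n as [|n IH].
  - simpl; unfold cis; rewrite Rmult_0_l, cos_0, sin_0; easy.
  - rewrite S_INR, Cpow_S, IH, <- cis_add; f_equal; ring.
Qed.

Lemma cis_2PI n : cis (INR n * (2 * PI)) = RtoC 1.
Proof.
  rewrite <- cis_pow. unfold cis. rewrite cos_2PI, sin_2PI. apply Cpow_1_l.
Qed.

(** The half-angle formula turns cos t = 1 into sin (t/2) = 0, which is impossible for t/2 strictly
    between 0 and [PI]. *)
Lemma cis_neq_1 t : (0 < t < 2 * PI)%R -> cis t <> RtoC 1.
Proof.
  intros Ht H. apply (f_equal fst) in H; simpl in H.
  assert (Hs : (0 < sin (t / 2))%R) by (apply sin_gt_0; lra).
  replace t with (2 * (t / 2))%R in H by field.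
  rewrite cos_2a_sin in H. nra.
Qed.

Lemma geom_csum (w : C) n : (w - 1) * csum n (fun k => w ^ k) = w ^ n - 1.
Proof.
  induction n as [|n IH]; simpl; [ring|].
  rewrite Cmult_plus_distr_l, IH; ring.
Qed.

Lemma Cconj_unit z : Cmod z = 1%R -> z * Cconj z = 1.
Proof. intros H. rewrite <- Cmod2_conj, H. apply injective_projections; simpl; ring. Qed.

Lemma Cpow_conj_unit z n : Cmod z = 1%R -> z ^ n * Cconj z ^ n = 1.
Proof. intros H. rewrite <- Cpow_mult_l, Cconj_unit, Cpow_1_l; easy. Qed.

(** * Averages over roots of unity *)

Definition avg (N : nat) (F : C -> C) : C :=
  csum N (fun k => F (cis (INR k * (2 * PI / INR N)))) / INR N.

Lemma avg_ext N F G : (forall z, Cmod z = 1%R -> F z = G z) -> avg N F = avg N G.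
Proof.
  intros H. unfold avg. f_equal. apply csum_ext; intros k _. apply H, Cmod_cis.
Qed.

Lemma avg_plus N F G : avg N (fun z => F z + G z) = avg N F + avg N G.
Proof. unfold avg. rewrite csum_plus. unfold Cdiv; ring. Qed.

Lemma avg_scal N c F : avg N (fun z => c * F z) = c * avg N F.
Proof. unfold avg. rewrite csum_scal. unfold Cdiv; ring. Qed.

Lemma INR_C_neq_0 N : (0 < N)%nat -> RtoC (INR N) <> RtoC 0.
Proof. intros H K. apply (f_equal fst) in K; simpl in K. apply lt_0_INR in H; lra. Qed.

Lemma avg_conj N F : (0 < N)%nat -> avg N (fun z => Cconj (F z)) = Cconj (avg N F).
Proof.
  intros HN. unfold avg. rewrite Cdiv_conj, csum_conj by (apply INR_C_neq_0; easy).
  f_equal. apply injective_projections; simpl; ring.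
Qed.

Lemma avg_const N c : (0 < N)%nat -> avg N (fun _ => c) = c.
Proof.
  intros HN. unfold avg.
  assert (H : csum N (fun _ => c) = c * INR N).
  { clear HN; induction N as [|n IH]; [simpl; ring|].
    simpl csum. rewrite IH, S_INR, RtoC_plus; ring. }
  rewrite H. field. apply INR_C_neq_0; easy.
Qed.

(** The m-th powers of the sample points are the powers of a single N-th root of unity w, and w
    differs from 1 because 0 < m < N; so the geometric sum vanishes. *)
Lemma avg_pow N m : (0 < m < N)%nat -> avg N (fun z => z ^ m) = 0.
Proof.
  intros Hm. unfold avg.
  assert (HN : (0 < INR N)%R) by (apply lt_0_INR; lia).
  assert (Hm0 : (0 < INR m)%R) by (apply lt_0_INR; lia).
  assert (HmN : (INR m < INR N)%R) by (apply lt_INR; lia).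
  set (w := cis (INR m * (2 * PI / INR N))).
  rewrite (csum_ext _ _ (fun k => w ^ k)).
  2:{ intros k _. unfold w. rewrite !cis_pow. f_equal; ring. }
  assert (Hw : w <> 1).
  { apply cis_neq_1. pose proof PI_RGT_0. split.
    - apply Rmult_lt_0_compat; [easy|]. apply Rdiv_lt_0_compat; lra.
    - replace (2 * PI)%R with (INR N * (2 * PI / INR N))%R at 2 by (field; lra).
      apply Rmult_lt_compat_r; [apply Rdiv_lt_0_compat; lra | easy]. }
  assert (HwN : w ^ N = 1).
  { unfold w. rewrite cis_pow. rewrite <- (cis_2PI m). f_equal. field; lra. }
  pose proof (geom_csum w N) as G. rewrite HwN in G.
  assert (K : csum N (fun k => w ^ k) = 0).
  { replace (1 - 1) with (RtoC 0) in G by ring.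
    replace (csum N (fun k => w ^ k)) with (((w - 1) * csum N (fun k => w ^ k)) / (w - 1)).
    - rewrite G. unfold Cdiv; ring.
    - field. intros mean. apply Hw. replace w with (w - 1 + 1) by ring. rewrite mean; ring. }
  rewrite K. unfold Cdiv; ring.
Qed.

Lemma avg_nonneg N F : (0 < N)%nat -> (forall z, Cmod z = 1%R -> 0 <= Re (F z))%R -> (0 <= Re (avg N F))%R.
Proof.
  intros HN H. unfold avg.
  assert (K : (0 <= Re (csum N (fun k => F (cis (INR k * (2 * PI / INR N))))))%R).
  { apply Re_csum_nonneg; intros k _. apply H, Cmod_cis. }
  assert (HN' : (0 < INR N)%R) by (apply lt_0_INR; easy).
  unfold Cdiv. rewrite <- RtoC_inv by lra.
  unfold Re in *; simpl. rewrite Rmult_0_r, Rminus_0_r.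
  apply Rmult_le_pos; [easy|]. left; apply Rinv_0_lt_compat; easy.
Qed.

(** Eventual constancy replaces a limit: the averages of a trigonometric polynomial become exact, so
    identities and inequalities between finite averages pass to [mean] without any epsilon. *)
Definition stable (F : C -> C) (c : C) : Prop :=
  exists N0, forall N, (N0 <= N)%nat -> avg N F = c.

(* The mean over the circle: for a trigonometric polynomial the average over the
   N-th roots of unity does not depend on N once N exceeds the degree. *)
Definition mean (F : C -> C) : C := epsilon (inhabits (RtoC 0)) (stable F).

Lemma stable_unique F c d : stable F c -> stable F d -> c = d.
Proof.
  intros [N H] [M K]. rewrite <- (H (N + M)%nat), <- (K (N + M)%nat); [easy|lia|lia].
Qed.

Lemma mean_stable F c : stable F c -> mean F = c.
Proof.
  intros H. apply (stable_unique F); [|easy].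
  unfold mean. apply epsilon_spec. exists c; easy.
Qed.

Lemma mean_stable' F : (exists c, stable F c) -> stable F (mean F).
Proof. intros [c H]. rewrite (mean_stable F c H); easy. Qed.

Lemma stable_ext F G c : (forall z, Cmod z = 1%R -> F z = G z) -> stable F c -> stable G c.
Proof. intros H [N K]. exists N; intros M HM. rewrite <- (K M HM). symmetry; apply avg_ext; easy. Qed.

Lemma stable_plus F G c d : stable F c -> stable G d -> stable (fun z => F z + G z) (c + d).
Proof. intros [N H] [M K]. exists (N + M)%nat; intros L HL. rewrite avg_plus, H, K by lia; easy. Qed.

Lemma stable_scal F a c : stable F c -> stable (fun z => a * F z) (a * c).
Proof. intros [N H]. exists N; intros L HL. rewrite avg_scal, H by lia; easy. Qed.

Lemma stable_conj F c : stable F c -> stable (fun z => Cconj (F z)) (Cconj c).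
Proof. intros [N H]. exists (S N); intros L HL. rewrite avg_conj, H by lia; easy. Qed.

Lemma stable_const c : stable (fun _ => c) c.
Proof. exists 1%nat; intros N HN. apply avg_const; lia. Qed.

Lemma stable_pow m : (0 < m)%nat -> stable (fun z => z ^ m) 0.
Proof. intros Hm. exists (S m); intros N HN. apply avg_pow; lia. Qed.

(** * Polynomials and trigonometric polynomials *)

Inductive poly : nat -> (C -> C) -> Prop :=
| poly_const d P c : (forall z, P z = c) -> poly d P
| poly_step d P Q c : poly d Q -> (forall z, P z = c + z * Q z) -> poly (S d) P.

Lemma poly_ext d P Q : (forall z, P z = Q z) -> poly d P -> poly d Q.
Proof.
  intros H K. inversion K; subst.
  - apply poly_const with c. intros z; rewrite <- H; easy.
  - eapply poly_step; [eassumption|]. intros z; rewrite <- H; easy.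
Qed.

Lemma poly_mono d e P : poly d P -> (d <= e)%nat -> poly e P.
Proof.
  intros H; revert e; induction H; intros e He.
  - eapply poly_const; eassumption.
  - destruct e as [|e]; [lia|]. eapply poly_step; [apply IHpoly; lia | eassumption].
Qed.

Lemma poly_scal d c P : poly d P -> poly d (fun z => c * P z).
Proof.
  induction 1.
  - apply poly_const with (c * c0); intros z; rewrite H; easy.
  - eapply poly_step; [eassumption|]. intros z; rewrite H0.
    instantiate (1 := c * c0). ring.
Qed.

Lemma poly_plus d P Q : poly d P -> poly d Q -> poly d (fun z => P z + Q z).
Proof.
  intros H; revert Q; induction H; intros R HR.
  - inversion HR; subst.
    + apply poly_const with (c + c0). intros z; rewrite H, H0; easy.
    + eapply poly_step with (c := c + c0); [eassumption|]. intros z; rewrite H, H1; ring.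
  - inversion HR; subst.
    + eapply poly_step with (c := c + c0); [eassumption|]. intros z; rewrite H0, H1; ring.
    + eapply poly_step with (c := c + c0); [apply IHpoly; eassumption|].
      intros z; rewrite H0, H3; ring.
Qed.

Lemma poly_id_mult d P : poly d P -> poly (S d) (fun z => z * P z).
Proof. intros H. apply poly_step with (Q := P) (c := RtoC 0); [easy|]. intros z; ring. Qed.

Lemma poly_pow_mult d m P : poly d P -> poly (m + d) (fun z => z ^ m * P z).
Proof.
  intros H. induction m as [|m IH].
  - eapply poly_ext; [|exact H]. intros z; simpl; ring.
  - apply poly_id_mult in IH. eapply poly_ext; [|exact IH]. intros z; simpl; ring.
Qed.

Lemma poly_mult d e P Q : poly d P -> poly e Q -> poly (d + e) (fun z => P z * Q z).
Proof.
  induction 1; intros K.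
  - apply poly_mono with e; [|lia].
    eapply poly_ext; [|apply poly_scal with (c := c); exact K]. intros z; rewrite H; easy.
  - apply poly_ext with (fun z => c * Q z + z * (Q0 z * Q z)).
    + intros z; rewrite H0; ring.
    + apply poly_plus.
      * apply poly_mono with e; [apply poly_scal; easy|lia].
      * simpl. apply poly_id_mult; auto.
Qed.

Lemma poly_pow m : poly m (fun z => z ^ m).
Proof.
  replace m with (m + 0)%nat at 1 by lia.
  eapply poly_ext; [|apply poly_pow_mult, poly_const with (c := RtoC 1); easy].
  intros z; simpl; ring.
Qed.

Lemma poly_cst d c : poly d (fun _ => c).
Proof. apply poly_const with c; easy. Qed.

Lemma poly_csum d n (P : nat -> C -> C) :
  (forall k, (k < n)%nat -> poly d (P k)) -> poly d (fun z => csum n (fun k => P k z)).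
Proof.
  induction n as [|n IH]; intros H; simpl.
  - apply poly_cst.
  - apply poly_plus; auto.
Qed.

Lemma poly_coefs d P : poly d P -> exists a : nat -> C, forall z, P z = csum (S d) (fun k => a k * z ^ k).
Proof.
  induction 1.
  - exists (fun k => match k with O => c | _ => RtoC 0 end). intros z. rewrite csum_shift, H, csum_0.
    + simpl; ring.
    + intros; ring.
  - destruct IHpoly as [a Ha].
    exists (fun k => match k with O => c | S k => a k end). intros z.
    rewrite csum_shift, H0, Ha, <- csum_scal. simpl Cpow. f_equal; [ring|].
    apply csum_ext; intros; ring.
Qed.

(** On the circle the conjugate of z is its inverse, so conjugating P conjugates its coefficients
    and reverses their order. *)
Lemma poly_reverse d P : poly d P ->
  exists Q, poly d Q /\ forall z, Cmod z = 1%R -> Cconj (P z) = Cconj z ^ d * Q z.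
Proof.
  induction 1.
  - exists (fun z => z ^ d * Cconj c). split.
    + replace d with (d + 0)%nat at 1 by lia. apply poly_pow_mult, poly_cst.
    + intros z Hz. rewrite H.
      replace (Cconj z ^ d * (z ^ d * Cconj c)) with (z ^ d * Cconj z ^ d * Cconj c) by ring.
      rewrite Cpow_conj_unit by easy. ring.
  - destruct IHpoly as (R & HR & K).
    exists (fun z => z ^ S d * Cconj c + R z). split.
    + apply poly_plus.
      * replace (S d) with (S d + 0)%nat at 1 by lia. apply poly_pow_mult, poly_cst.
      * apply poly_mono with d; [easy|lia].
    + intros z Hz. rewrite H0, Cplus_conj, Cmult_conj, K by easy.
      rewrite Cmult_plus_distr_l.
      replace (Cconj z ^ S d * (z ^ S d * Cconj c)) with (z ^ S d * Cconj z ^ S d * Cconj c) by ring.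
      rewrite Cpow_conj_unit by easy. simpl; ring.
Qed.

Lemma poly_split d P n : poly d P ->
  exists L Q, poly n L /\ poly d Q /\ forall z, P z = L z + z ^ S n * Q z.
Proof.
  intros H; revert n; induction H; intros n.
  - exists P, (fun _ => RtoC 0). split; [apply poly_const with c; easy|split; [apply poly_cst|]].
    intros; ring.
  - destruct n as [|n].
    + exists (fun _ => c), Q. split; [apply poly_cst|split; [apply poly_mono with d; [easy|lia]|]].
      intros z; rewrite H0; simpl; ring.
    + destruct (IHpoly n) as (L & R & HL & HR & K).
      exists (fun z => c + z * L z), R. split; [eapply poly_step; [eassumption|easy]|].
      split; [apply poly_mono with d; [easy|lia]|].
      intros z; rewrite H0, K; simpl; ring.
Qed.

Lemma poly_bound d P : poly d P -> exists B, (0 <= B)%R /\ forall z, (Cmod z <= 1)%R -> (Cmod (P z) <= B)%R.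
Proof.
  induction 1.
  - exists (Cmod c); split; [apply Cmod_ge_0|]. intros z _; rewrite H; lra.
  - destruct IHpoly as (B & HB & K). exists (Cmod c + B)%R. split.
    + pose proof (Cmod_ge_0 c); lra.
    + intros z Hz. rewrite H0. eapply Rle_trans; [apply Cmod_triangle|].
      apply Rplus_le_compat_l. rewrite Cmod_mult. specialize (K z Hz).
      pose proof (Cmod_ge_0 z). pose proof (Cmod_ge_0 (Q z)). nra.
Qed.

(** These are the Laurent polynomials, seen only through their values on the circle; closure under
    conjugation comes from [poly_reverse]. *)
Definition trig (F : C -> C) : Prop :=
  exists d e P, poly e P /\ forall z, Cmod z = 1%R -> F z = Cconj z ^ d * P z.

Lemma trig_ext F G : (forall z, Cmod z = 1%R -> F z = G z) -> trig F -> trig G.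
Proof.
  intros H (d & e & P & HP & K). exists d, e, P; split; [easy|].
  intros z Hz. rewrite <- H by easy. auto.
Qed.

Lemma trig_poly d P : poly d P -> trig P.
Proof. intros H. exists O, d, P. split; [easy|]. intros; simpl; ring. Qed.

Lemma trig_const c : trig (fun _ => c).
Proof. apply (trig_poly O), poly_cst. Qed.

Lemma trig_pow m : trig (fun z => z ^ m).
Proof. apply (trig_poly m), poly_pow. Qed.

Lemma trig_mult F G : trig F -> trig G -> trig (fun z => F z * G z).
Proof.
  intros (d & e & P & HP & K) (d' & e' & P' & HP' & K').
  exists (d + d')%nat, (e + e')%nat, (fun z => P z * P' z). split; [apply poly_mult; easy|].
  intros z Hz. rewrite K, K', Cpow_add_r by easy. ring.
Qed.

Lemma trig_plus F G : trig F -> trig G -> trig (fun z => F z + G z).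
Proof.
  intros (d & e & P & HP & K) (d' & e' & P' & HP' & K').
  exists (d + d')%nat, (d + d' + e + e')%nat, (fun z => z ^ d' * P z + z ^ d * P' z). split.
  - apply poly_plus; eapply poly_mono; try (apply poly_pow_mult; eassumption); lia.
  - intros z Hz. rewrite K, K', Cpow_add_r by easy.
    transitivity (Cconj z ^ d * P z * (z ^ d' * Cconj z ^ d') + Cconj z ^ d' * P' z * (z ^ d * Cconj z ^ d)).
    + rewrite !Cpow_conj_unit by easy. ring.
    + ring.
Qed.

Lemma trig_conj F : trig F -> trig (fun z => Cconj (F z)).
Proof.
  intros (d & e & P & HP & K). destruct (poly_reverse _ _ HP) as (Q & HQ & L).
  exists e, (d + e)%nat, (fun z => z ^ d * Q z). split; [apply poly_pow_mult; easy|].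
  intros z Hz. rewrite K, Cmult_conj, L, Cpow_conj, Cconj_conj by easy. ring.
Qed.

Lemma trig_scal c F : trig F -> trig (fun z => c * F z).
Proof. intros H. apply trig_mult; [apply trig_const|easy]. Qed.

Lemma trig_minus F G : trig F -> trig G -> trig (fun z => F z - G z).
Proof.
  intros H K. apply trig_ext with (fun z => F z + (-(1)) * G z).
  - intros; ring.
  - apply trig_plus; [easy|apply trig_scal; easy].
Qed.

Lemma trig_stable F : trig F -> exists c, stable F c.
Proof.
  intros (d & e & P & HP & K).
  assert (H : exists c, stable (fun z => Cconj z ^ d * P z) c).
  { clear K. revert d. induction HP; intros n.
    - destruct n as [|n].
      + exists c. apply stable_ext with (fun _ => c); [intros; rewrite H; simpl; ring | apply stable_const].
      (* This number is zero; it is left in the form that [stable_conj] produces for a negative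
         power of z. *)
      + exists (c * Cconj 0). apply stable_ext with (fun z => c * Cconj (z ^ S n)).
        * intros z _. rewrite H, Cpow_conj. ring.
        * apply stable_scal, stable_conj, stable_pow; lia.
    - destruct n as [|n].
      + destruct (IHHP O) as [a Ha].
        exists c. destruct (poly_coefs _ _ HP) as [b Hb].
        assert (G : stable (fun z => z * csum (S d) (fun k => b k * z ^ k)) 0).
        { generalize (S d); induction n as [|n IH]; simpl csum.
          - apply stable_ext with (fun _ => RtoC 0); [intros; ring | apply stable_const].
          - apply stable_ext with (fun z => z * csum n (fun k => b k * z ^ k) + b n * z ^ S n).
            + intros z _; simpl; ring.
            + replace (RtoC 0) with (0 + b n * 0) by ring.
              apply stable_plus; [easy|]. apply stable_scal, stable_pow; lia. }
        replace c with (c + 0) by ring.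
        apply stable_ext with (fun z => c + z * csum (S d) (fun k => b k * z ^ k)).
        * intros z _. rewrite H, <- Hb. simpl; ring.
        * apply stable_plus; [apply stable_const | easy].
      + destruct (IHHP n) as [a Ha]. exists (c * Cconj 0 + a).
        apply stable_ext with (fun z => c * Cconj (z ^ S n) + Cconj z ^ n * Q z).
        * intros z Hz. rewrite H, Cpow_conj.
          transitivity (c * Cconj z ^ S n + Cconj z ^ n * Q z * (z * Cconj z)).
          -- rewrite Cconj_unit by easy; ring.
          -- simpl; ring.
        * apply stable_plus; [apply stable_scal, stable_conj, stable_pow; lia | easy]. }
  destruct H as [c Hc]. exists c. eapply stable_ext; [|exact Hc].
  intros z Hz. symmetry; auto.
Qed.

Lemma mean_ext F G : trig F -> (forall z, Cmod z = 1%R -> F z = G z) -> mean F = mean G.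
Proof.
  intros HF H. symmetry; apply mean_stable. apply stable_ext with F; [easy|].
  apply mean_stable', trig_stable; easy.
Qed.

Lemma mean_plus F G : trig F -> trig G -> mean (fun z => F z + G z) = mean F + mean G.
Proof. intros HF HG. apply mean_stable, stable_plus; apply mean_stable', trig_stable; easy. Qed.

Lemma mean_scal c F : trig F -> mean (fun z => c * F z) = c * mean F.
Proof. intros HF. apply mean_stable, stable_scal; apply mean_stable', trig_stable; easy. Qed.

Lemma mean_conj F : trig F -> mean (fun z => Cconj (F z)) = Cconj (mean F).
Proof. intros HF. apply mean_stable, stable_conj; apply mean_stable', trig_stable; easy. Qed.

Lemma mean_nonneg F : trig F -> (forall z, Cmod z = 1%R -> 0 <= Re (F z))%R -> (0 <= Re (mean F))%R.
Proof.
  intros HF H. apply trig_stable, mean_stable' in HF. destruct HF as [N HN].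
  rewrite <- (HN (S N)) by lia. apply avg_nonneg; [lia|easy].
Qed.

(** Positive powers average to zero. Through this fact the values p(0) can be represented by
    means. *)
Lemma mean_poly d P : poly d P -> mean P = P 0.
Proof.
  intros H. apply mean_stable. destruct (poly_coefs _ _ H) as [a Ha].
  rewrite Ha.
  assert (G : forall n, stable (fun z => csum n (fun k => a k * z ^ k)) (csum n (fun k => a k * 0 ^ k))).
  { induction n as [|n IH]; simpl csum.
    - apply stable_const.
    - apply stable_plus; [easy|]. destruct n as [|n].
      + apply stable_scal. simpl. apply stable_const.
      + replace (0 ^ S n) with (RtoC 0) by (simpl; ring). apply stable_scal, stable_pow; lia. }
  eapply stable_ext; [|apply G]. intros z _; symmetry; apply Ha.
Qed.

(** Once Q is reversed, all frequencies are at least m - e > 0, so the integrand is a polynomial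
    vanishing at 0. Orthogonality in the construction is always bought in this way, by a large power
    of z. *)
Lemma mean_high_freq d e P Q m : poly d P -> poly e Q -> (e < m)%nat ->
  mean (fun z => P z * z ^ m * Cconj (Q z)) = 0.
Proof.
  intros HP HQ Hm. destruct (poly_reverse _ _ HQ) as (R & HR & K).
  transitivity (mean (fun z => P z * z ^ (m - e) * R z)).
  - apply mean_ext.
    + repeat apply trig_mult; [eapply trig_poly; eassumption|apply trig_pow|].
      apply trig_conj; eapply trig_poly; eassumption.
    + intros z Hz. rewrite K by easy. replace m with (e + (m - e))%nat at 1 by lia.
      rewrite Cpow_add_r.
      transitivity (P z * z ^ (m - e) * R z * (z ^ e * Cconj z ^ e)); [ring|].
      rewrite Cpow_conj_unit by easy; ring.
  - rewrite (mean_poly (d + (m - e) + e)).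
    + destruct (m - e)%nat eqn:Hd; [lia|]. simpl; ring.
    + apply poly_mult; [apply poly_mult|]; [easy|apply poly_pow|easy].
Qed.

Lemma trig_csum n (F : nat -> C -> C) : (forall k, (k < n)%nat -> trig (F k)) ->
  trig (fun z => csum n (fun k => F k z))%C.
Proof.
  induction n as [|n IH]; intros H; simpl; [apply trig_const|apply trig_plus; auto].
Qed.

Lemma mean_csum n (F : nat -> C -> C) : (forall k, (k < n)%nat -> trig (F k)) ->
  mean (fun z => csum n (fun k => F k z))%C = csum n (fun k => mean (F k)).
Proof.
  induction n as [|n IH]; intros H; simpl.
  - apply mean_stable, stable_const.
  - rewrite mean_plus, IH; auto. apply trig_csum; auto.
Qed.

(** * The mean-square norm on the circle *)

Definition mean_sqr (F : C -> C) : R := Re (mean (fun z => F z * Cconj (F z))%C).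

Definition l2norm (F : C -> C) : R := sqrt (mean_sqr F).

Lemma Re_plus x y : Re (x + y) = (Re x + Re y)%R.
Proof. easy. Qed.

Lemma Re_Rscal r x : Re (RtoC r * x) = (r * Re x)%R.
Proof. unfold Re; simpl; ring. Qed.

Lemma Cmult_conj_sqr x : x * Cconj x = RtoC (Cmod x ^ 2)%R.
Proof. rewrite <- Cmod2_conj, RtoC_pow; easy. Qed.

Lemma trig_sqr F : trig F -> trig (fun z => F z * Cconj (F z))%C.
Proof. intros H; apply trig_mult; [|apply trig_conj]; easy. Qed.

Lemma mean_sqr_nonneg F : trig F -> (0 <= mean_sqr F)%R.
Proof.
  intros H. apply mean_nonneg; [apply trig_sqr; easy|].
  intros z _. rewrite Cmult_conj_sqr. simpl. pose proof (Cmod_ge_0 (F z)). nra.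
Qed.

Lemma mean_le F G : trig F -> trig G ->
  (forall z, Cmod z = 1%R -> Re (F z) <= Re (G z))%R -> (Re (mean F) <= Re (mean G))%R.
Proof.
  intros HF HG H.
  assert (K : (0 <= Re (mean (fun z => G z + RtoC (-1) * F z)%C))%R).
  { apply mean_nonneg; [apply trig_plus, trig_scal; easy|].
    intros z Hz. rewrite Re_plus, Re_Rscal. specialize (H z Hz); lra. }
  rewrite mean_plus, mean_scal, Re_plus, Re_Rscal in K; try apply trig_scal; trivial. lra.
Qed.

Lemma mean_sqr_ext F G : trig F -> (forall z, Cmod z = 1%R -> F z = G z) -> mean_sqr F = mean_sqr G.
Proof.
  intros HF H. unfold mean_sqr. f_equal. apply mean_ext; [apply trig_sqr; easy|].
  intros z Hz. rewrite H; easy.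
Qed.

Lemma mean_sqr_le c F G : trig F -> trig G -> (0 <= c)%R ->
  (forall z, Cmod z = 1%R -> Cmod (F z) <= c * Cmod (G z))%R -> (mean_sqr F <= c ^ 2 * mean_sqr G)%R.
Proof.
  intros HF HG Hc H. unfold mean_sqr. rewrite <- Re_Rscal, <- mean_scal by (apply trig_sqr; easy).
  apply mean_le; [apply trig_sqr; easy|apply trig_scal, trig_sqr; easy|].
  intros z Hz. rewrite Re_Rscal, !Cmult_conj_sqr. simpl Re.
  specialize (H z Hz). pose proof (Cmod_ge_0 (F z)). pose proof (Cmod_ge_0 (G z)).
  simpl. nra.
Qed.

Lemma mean_const c : mean (fun _ => c) = c.
Proof. apply mean_stable, stable_const. Qed.

Lemma mean_sqr_sup c F : trig F -> (0 <= c)%R ->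
  (forall z, Cmod z = 1%R -> Cmod (F z) <= c)%R -> (mean_sqr F <= c ^ 2)%R.
Proof.
  intros HF Hc H. eapply Rle_trans.
  - apply (mean_sqr_le c F (fun _ => RtoC 1)); [easy|apply trig_const|easy|].
    intros z Hz. rewrite Cmod_1, Rmult_1_r; auto.
  - unfold mean_sqr. rewrite mean_const. simpl. lra.
Qed.

Lemma mean_sqr_scal c F : trig F -> mean_sqr (fun z => c * F z)%C = (Cmod c ^ 2 * mean_sqr F)%R.
Proof.
  intros HF. unfold mean_sqr. rewrite <- Re_Rscal, <- mean_scal by (apply trig_sqr; easy). f_equal.
  apply mean_ext.
  - apply trig_sqr, trig_scal; easy.
  - intros z _. rewrite Cmult_conj, <- Cmult_conj_sqr. ring.
Qed.

Lemma mean_sqr_plus F G : trig F -> trig G ->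
  mean_sqr (fun z => F z + G z)%C = (mean_sqr F + mean_sqr G + 2 * Re (mean (fun z => F z * Cconj (G z))%C))%R.
Proof.
  intros HF HG. unfold mean_sqr.
  assert (T1 := trig_sqr _ HF). assert (T2 := trig_sqr _ HG).
  assert (T3 : trig (fun z => F z * Cconj (G z))%C) by (apply trig_mult, trig_conj; easy).
  assert (T4 := trig_conj _ T3).
  rewrite (mean_ext _ (fun z => (F z * Cconj (F z) + G z * Cconj (G z)) +
     (F z * Cconj (G z) + Cconj (F z * Cconj (G z))))%C).
  - rewrite !mean_plus, mean_conj, !Re_plus, re_conj by (try apply trig_plus; easy). ring.
  - apply trig_sqr, trig_plus; easy.
  - intros z _. rewrite Cplus_conj, Cmult_conj, Cconj_conj. ring.
Qed.

(** With e the mean of F conj G, the mean square of F - t e G is nonnegative for every real t; t = 1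
    / [mean_sqr G] gives the claim. *)
Lemma cauchy_schwarz F G : trig F -> trig G ->
  (Cmod (mean (fun z => F z * Cconj (G z))%C) ^ 2 <= mean_sqr F * mean_sqr G)%R.
Proof.
  intros HF HG. set (e := mean (fun z => F z * Cconj (G z))%C).
  assert (T3 : trig (fun z => F z * Cconj (G z))%C) by (apply trig_mult, trig_conj; easy).
  assert (H : forall t : R, (0 <= mean_sqr F - 2 * t * Cmod e ^ 2 + t ^ 2 * Cmod e ^ 2 * mean_sqr G)%R).
  { intros t. set (l := RtoC (- t) * e).
    assert (K : (0 <= mean_sqr (fun z => F z + l * G z)%C)%R) by (apply mean_sqr_nonneg, trig_plus, trig_scal; easy).
    rewrite mean_sqr_plus, mean_sqr_scal in K; try apply trig_scal; trivial.
    rewrite (mean_ext _ (fun z => Cconj l * (F z * Cconj (G z)))%C) in K.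
    - rewrite mean_scal in K by easy. fold e in K.
      replace (Re (Cconj l * e)) with (- t * Cmod e ^ 2)%R in K.
      + replace (Cmod l ^ 2)%R with (t ^ 2 * Cmod e ^ 2)%R in K; [lra|].
        unfold l. rewrite Cmod_mult, Cmod_R, Rpow_mult_distr, pow2_abs. ring.
      + unfold l. rewrite Cmult_conj.
        replace (Cconj (RtoC (- t)) * Cconj e * e) with (Cconj (RtoC (- t)) * (e * Cconj e)) by ring.
        rewrite Cmult_conj_sqr. unfold Re; simpl; ring.
    - apply trig_mult; [easy|]. apply trig_conj, trig_scal; easy.
    - intros z _. rewrite Cmult_conj. ring. }
  pose proof (mean_sqr_nonneg F HF) as HF0. pose proof (mean_sqr_nonneg G HG) as HG0.
  assert (He : (0 <= Cmod e ^ 2)%R) by (pose proof (Cmod_ge_0 e); nra).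
  set (x := (Cmod e ^ 2)%R) in *. clearbody x. clear -H HF0 HG0 He.
  destruct HG0 as [HG0|HG0].
  - specialize (H (/ mean_sqr G)%R).
    replace (mean_sqr F - 2 * / mean_sqr G * x + (/ mean_sqr G) ^ 2 * x * mean_sqr G)%R with ((mean_sqr F * mean_sqr G - x) / mean_sqr G)%R in H by (field; lra).
    apply (Rmult_le_compat_r (mean_sqr G)) in H; [|lra].
    replace ((mean_sqr F * mean_sqr G - x) / mean_sqr G * mean_sqr G)%R with (mean_sqr F * mean_sqr G - x)%R in H by (field; lra). lra.
  - rewrite <- HG0 in *. destruct (Rle_lt_dec x 0) as [|Hx]; [nra|].
    (* When G has mean square zero and e is not zero, this t would bring the mean square down to
       -1. *)
    specialize (H ((mean_sqr F + 1) / (2 * x))%R).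
    replace (mean_sqr F - 2 * ((mean_sqr F + 1) / (2 * x)) * x + ((mean_sqr F + 1) / (2 * x)) ^ 2 * x * 0)%R with (-1)%R in H by (field; lra).
    lra.
Qed.

Lemma l2norm_nonneg F : (0 <= l2norm F)%R.
Proof. apply sqrt_pos. Qed.

Lemma l2norm_sqr F : trig F -> (l2norm F ^ 2)%R = mean_sqr F.
Proof. intros H. unfold l2norm. simpl. rewrite Rmult_1_r. apply sqrt_sqrt, mean_sqr_nonneg; easy. Qed.

Lemma sqr_le_inv x y : (0 <= y)%R -> (x ^ 2 <= y ^ 2)%R -> (x <= y)%R.
Proof. intros; nra. Qed.

Lemma mean_nrm F G : trig F -> trig G -> (Cmod (mean (fun z => F z * Cconj (G z))%C) <= l2norm F * l2norm G)%R.
Proof.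
  intros HF HG. apply sqr_le_inv.
  - apply Rmult_le_pos; apply l2norm_nonneg.
  - rewrite Rpow_mult_distr, !l2norm_sqr by easy. apply cauchy_schwarz; easy.
Qed.

Lemma l2norm_le c F G : trig F -> trig G -> (0 <= c)%R ->
  (forall z, Cmod z = 1%R -> Cmod (F z) <= c * Cmod (G z))%R -> (l2norm F <= c * l2norm G)%R.
Proof.
  intros HF HG Hc H. apply sqr_le_inv.
  - apply Rmult_le_pos; [easy|apply l2norm_nonneg].
  - rewrite Rpow_mult_distr, !l2norm_sqr by easy. apply mean_sqr_le; easy.
Qed.

Lemma l2norm_sup c F : trig F -> (0 <= c)%R ->
  (forall z, Cmod z = 1%R -> Cmod (F z) <= c)%R -> (l2norm F <= c)%R.
Proof.
  intros HF Hc H. apply sqr_le_inv; [easy|]. rewrite l2norm_sqr by easy. apply mean_sqr_sup; easy.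
Qed.

Lemma l2norm_triangle F G : trig F -> trig G -> (l2norm (fun z => F z + G z)%C <= l2norm F + l2norm G)%R.
Proof.
  intros HF HG. pose proof (l2norm_nonneg F). pose proof (l2norm_nonneg G). apply sqr_le_inv; [lra|].
  rewrite l2norm_sqr, mean_sqr_plus, <- !l2norm_sqr by (try apply trig_plus; easy).
  pose proof (mean_nrm F G HF HG) as K. pose proof (re_le_Cmod (mean (fun z => F z * Cconj (G z))%C)) as L.
  pose proof (Rle_abs (Re (mean (fun z => F z * Cconj (G z))%C))). nra.
Qed.

Lemma l2norm_ext F G : trig F -> (forall z, Cmod z = 1%R -> F z = G z) -> l2norm F = l2norm G.
Proof. intros; unfold l2norm; f_equal; apply mean_sqr_ext; easy. Qed.

(** * Orthogonality of monomials and Parseval's identity *)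

Lemma mean_mono k j : mean (fun z => z ^ k * Cconj (z ^ j))%C = if Nat.eq_dec k j then RtoC 1 else RtoC 0.
Proof.
  destruct (Nat.eq_dec k j) as [->|Hkj].
  - rewrite <- (mean_const (RtoC 1)). apply mean_ext.
    + apply trig_sqr, trig_pow.
    + intros z Hz. rewrite Cpow_conj, Cpow_conj_unit; easy.
  - destruct (Nat.lt_ge_cases j k) as [H|H].
    + rewrite <- (mean_high_freq 0 j (fun _ => 1) (fun z => z ^ j)%C k); [|apply poly_cst|apply poly_pow|easy].
      apply mean_ext; [apply trig_mult, trig_conj; apply trig_pow|]. intros; ring.
    + rewrite <- (Cconj_conj (mean _)), <- mean_conj by (apply trig_mult, trig_conj; apply trig_pow).
      rewrite <- (mean_high_freq 0 k (fun _ => 1) (fun z => z ^ k)%C j); [|apply poly_cst|apply poly_pow|lia].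
      assert (Z : forall x : C, x = 0 -> Cconj x = x) by (intros x ->; apply injective_projections; simpl; ring).
      rewrite Z.
      * apply mean_ext; [apply trig_conj, trig_mult, trig_conj; apply trig_pow|].
        intros; rewrite Cmult_conj, Cconj_conj; ring.
      * rewrite <- (mean_high_freq 0 k (fun _ => 1) (fun z => z ^ k)%C j); [|apply poly_cst|apply poly_pow|lia].
        apply mean_ext; [apply trig_conj, trig_mult, trig_conj; apply trig_pow|].
        intros; rewrite Cmult_conj, Cconj_conj; ring.
Qed.

Definition psum (n : nat) (a : nat -> C) (z : C) : C := csum n (fun k => a k * z ^ k).

Lemma poly_psum n a : poly n (psum n a).
Proof.
  apply poly_csum. intros k Hk. apply poly_scal, poly_mono with k; [apply poly_pow|lia].
Qed.

Lemma trig_psum n a : trig (psum n a).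
Proof. apply (trig_poly n), poly_psum. Qed.

Lemma mean_psum_mono n a j : mean (fun z => psum n a z * Cconj (z ^ j))%C = if Nat.ltb j n then a j else RtoC 0.
Proof.
  rewrite (mean_ext _ (fun z => csum n (fun k => a k * (z ^ k * Cconj (z ^ j))))%C).
  - rewrite mean_csum.
    + induction n as [|n IH]; [easy|]. simpl csum. rewrite IH, mean_scal, mean_mono by (apply trig_mult, trig_conj; apply trig_pow).
      destruct (Nat.ltb_spec j n), (Nat.ltb_spec j (S n)), (Nat.eq_dec n j); subst; try lia; ring.
    + intros; apply trig_scal, trig_mult, trig_conj; apply trig_pow.
  - apply trig_mult, trig_conj, trig_pow. apply trig_psum.
  - intros z _. unfold psum. rewrite Cmult_comm, <- csum_scal. apply csum_ext; intros; ring.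
Qed.

Lemma mean_psum_psum n a b : mean (fun z => psum n a z * Cconj (psum n b z))%C = csum n (fun k => a k * Cconj (b k)).
Proof.
  rewrite (mean_ext _ (fun z => csum n (fun j => Cconj (b j) * (psum n a z * Cconj (z ^ j))))%C).
  - rewrite mean_csum.
    + apply csum_ext; intros k Hk. rewrite mean_scal, mean_psum_mono by (apply trig_mult, trig_conj, trig_pow; apply trig_psum).
      destruct (Nat.ltb_spec k n); [ring|lia].
    + intros; apply trig_scal, trig_mult, trig_conj, trig_pow; apply trig_psum.
  - apply trig_mult, trig_conj; apply trig_psum.
  - intros z _. unfold psum at 2. rewrite csum_conj, <- csum_scal. apply csum_ext; intros; rewrite Cmult_conj; ring.
Qed.

(** By Parseval the comparison can be made coefficient by coefficient; this controls the frequency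
    multipliers in the duality estimate. *)
Lemma mean_sqr_psum_le c n a b : (0 <= c)%R -> (forall k, (k < n)%nat -> Cmod (a k) <= c * Cmod (b k))%R ->
  (mean_sqr (psum n a) <= c ^ 2 * mean_sqr (psum n b))%R.
Proof.
  intros Hc H. unfold mean_sqr. rewrite !mean_psum_psum. induction n as [|n IH]; [simpl; lra|].
  simpl csum. rewrite !Re_plus, !Cmult_conj_sqr, Rmult_plus_distr_l. apply Rplus_le_compat; [auto|].
  simpl Re. specialize (H n ltac:(lia)). pose proof (Cmod_ge_0 (a n)). pose proof (Cmod_ge_0 (b n)). simpl; nra.
Qed.

Lemma coef_le_nrm n a k : (k < n)%nat -> (Cmod (a k) <= l2norm (psum n a))%R.
Proof.
  intros Hk. pose proof (mean_nrm (psum n a) (fun z => z ^ k)%C (trig_psum n a) (trig_pow k)) as H.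
  cbv beta in H. rewrite mean_psum_mono in H. destruct (Nat.ltb_spec k n); [|lia].
  eapply Rle_trans; [apply H|]. rewrite <- (Rmult_1_r (l2norm (psum n a))) at 2.
  apply Rmult_le_compat_l; [apply l2norm_nonneg|]. apply l2norm_sup; [apply trig_pow|lra|].
  intros z Hz. rewrite Cmod_pow, Hz, pow1; lra.
Qed.

(* Write P = L + z^n V with deg L < n: for every polynomial p the product
   p conj(conj z^n L) has positive frequencies only, hence mean zero. *)
Lemma analytic_projection n e P F : poly e P -> (forall z, Cmod z = 1%R -> F z = Cconj z ^ n * P z) ->
  exists V, poly e V /\ (l2norm V <= l2norm F)%R /\
  forall d p, poly d p -> mean (fun z => p z * Cconj (V z))%C = mean (fun z => p z * Cconj (F z))%C.
Proof.
  intros HP K.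
  assert (HF : trig F) by (exists n, e, P; easy).
  assert (S : exists L V, (n = O \/ poly (pred n) L) /\ (n = O -> forall z, L z = 0) /\ poly e V /\ (forall z, P z = L z + z ^ n * V z)).
  { destruct n as [|n].
    - exists (fun _ => RtoC 0), P. repeat split; auto. intros; simpl; ring.
    - destruct (poly_split _ _ n HP) as (L & V & HL & HV & KV). exists L, V. repeat split; auto. easy. }
  destruct S as (L & V & HL & HL0 & HV & KV).
  assert (TV : trig V) by (eapply trig_poly; eassumption).
  assert (TL : trig L).
  { destruct HL as [->|HL]; [|eapply trig_poly; eassumption].
    eapply trig_ext; [|apply (trig_const 0)]. intros z _; rewrite HL0; easy. }
  assert (TN : trig (fun z => Cconj z ^ n * L z)%C).
  { apply trig_mult; [|easy]. eapply trig_ext; [|apply trig_conj, (trig_pow n)]. intros; apply Cpow_conj. }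
  assert (FV : forall z, Cmod z = 1%R -> F z = V z + Cconj z ^ n * L z).
  { intros z Hz. rewrite K, KV by easy.
    transitivity (V z * (z ^ n * Cconj z ^ n) + Cconj z ^ n * L z); [|rewrite Cpow_conj_unit by easy]; ring. }
  assert (Z : forall d p, poly d p -> mean (fun z => p z * Cconj (Cconj z ^ n * L z))%C = 0).
  { intros d p Hp. destruct n as [|n].
    - rewrite <- (mean_const 0). apply mean_ext.
      + apply trig_mult; [eapply trig_poly; eassumption|apply trig_conj; easy].
      + intros z _. rewrite HL0, Cmult_0_r by easy. apply injective_projections; simpl; ring.
    - destruct HL as [|HL]; [easy|].
      rewrite <- (mean_high_freq _ _ p L (S n) Hp HL) by (simpl; lia).
      apply mean_ext.
      + apply trig_mult; [eapply trig_poly; eassumption|apply trig_conj; easy].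
      + intros z _. rewrite Cmult_conj, Cpow_conj, Cconj_conj. ring. }
  exists V. split; [easy|]. split.
  (* V is itself a polynomial, hence orthogonal to the discarded negative frequencies, and
     Pythagoras bounds its norm by that of F. *)
  - apply sqr_le_inv; [apply l2norm_nonneg|]. rewrite !l2norm_sqr by easy.
    rewrite (mean_sqr_ext F (fun z => V z + Cconj z ^ n * L z)%C) by easy.
    rewrite mean_sqr_plus, (Z _ _ HV) by easy. pose proof (mean_sqr_nonneg _ TN). simpl; lra.
  - intros d p Hp. assert (Tp : trig p) by (eapply trig_poly; eassumption).
    transitivity (mean (fun z => p z * Cconj (V z))%C + mean (fun z => p z * Cconj (Cconj z ^ n * L z))%C).
    + rewrite (Z _ _ Hp); ring.
    + rewrite <- mean_plus by (apply trig_mult, trig_conj; easy).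
      apply mean_ext.
      * apply trig_plus; apply trig_mult, trig_conj; easy.
      * intros z Hz. rewrite FV, Cplus_conj by easy. ring.
Qed.

(** * Complex derivatives and the Bloch seminorm *)

(** Complex differentiability as a relation in epsilon-delta form. Unlike the function [C_derive],
    it involves no default value where a derivative fails to exist; [cderiv_is_derive] links it to
    the notion of the statement. *)
Definition cderiv (f : C -> C) (z l : C) : Prop :=
  forall eps : R, (0 < eps)%R -> exists d : R, (0 < d)%R /\
    forall w : C, (Cmod (w - z) < d)%R -> (Cmod (f w - f z - l * (w - z)) <= eps * Cmod (w - z))%R.

Lemma cderiv_is_derive f z l : cderiv f z l <-> is_derive (K := C_AbsRing) (V := C_NormedModule) f z l.
Proof.
  split.
  - intros H. split; [apply is_linear_scal_l|].
    intros x Hx. apply (is_filter_lim_locally_unique (V := AbsRing_NormedModule C_AbsRing)) in Hx. subst x.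
    intros eps. destruct (H eps (cond_pos eps)) as (d & Hd & K).
    exists (mkposreal _ Hd). intros w Hw. specialize (K w Hw).
    change (Cmod (f w - f z - (w - z) * l) <= eps * Cmod (w - z))%R.
    rewrite (Cmult_comm (w - z)). exact K.
  - intros [_ H] eps Heps.
    specialize (H z (fun P HP => HP) (mkposreal eps Heps)).
    destruct H as [d Hd]. exists d. split; [apply cond_pos|]. intros w Hw.
    specialize (Hd w Hw).
    rewrite (Cmult_comm l). exact Hd.
Qed.

Lemma cderiv_unique f z l m : cderiv f z l -> cderiv f z m -> l = m.
Proof.
  intros H K. apply cderiv_is_derive, is_C_derive_unique in H.
  apply cderiv_is_derive, is_C_derive_unique in K. congruence.
Qed.

Lemma cderiv_const c z : cderiv (fun _ => c) z 0.
Proof.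
  intros eps Heps. exists 1%R. split; [lra|]. intros w _.
  replace (c - c - 0 * (w - z)) with (RtoC 0) by ring. rewrite Cmod_0.
  apply Rmult_le_pos; [lra|apply Cmod_ge_0].
Qed.

Lemma cderiv_plus f g z l m : cderiv f z l -> cderiv g z m -> cderiv (fun w => f w + g w)%C z (l + m).
Proof.
  intros H K. apply cderiv_is_derive. apply (is_derive_plus (K := C_AbsRing) (V := C_NormedModule) f g z l m);
  apply cderiv_is_derive; easy.
Qed.

Lemma cderiv_scal c f z l : cderiv f z l -> cderiv (fun w => c * f w)%C z (c * l).
Proof.
  intros H eps Heps. pose proof (Cmod_ge_0 c) as Hc.
  destruct (H (eps / (Cmod c + 1))%R) as (d & Hd & K); [apply Rdiv_lt_0_compat; lra|].
  exists d; split; [easy|]. intros w Hw. specialize (K w Hw).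
  replace (c * f w - c * f z - c * l * (w - z)) with (c * (f w - f z - l * (w - z))) by ring.
  rewrite Cmod_mult.
  apply Rle_trans with ((Cmod c + 1) * (eps / (Cmod c + 1) * Cmod (w - z)))%R.
  - apply Rmult_le_compat; try apply Cmod_ge_0; lra.
  - right; field; lra.
Qed.

Lemma cderiv_lip f z l : cderiv f z l -> exists d : R, (0 < d)%R /\
  forall w, (Cmod (w - z) < d)%R -> (Cmod (f w - f z) <= (Cmod l + 1) * Cmod (w - z))%R.
Proof.
  intros H. destruct (H 1%R ltac:(lra)) as (d & Hd & K). exists d; split; [easy|].
  intros w Hw. specialize (K w Hw).
  replace (f w - f z) with (f w - f z - l * (w - z) + l * (w - z)) by ring.
  eapply Rle_trans; [apply Cmod_triangle|]. rewrite Cmod_mult. lra.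
Qed.

Lemma cderiv_id_mult f z l : cderiv f z l -> cderiv (fun w => w * f w)%C z (f z + z * l).
Proof.
  intros H eps Heps. destruct (cderiv_lip _ _ _ H) as (d1 & Hd1 & K1).
  pose proof (Cmod_ge_0 z) as Hz. pose proof (Cmod_ge_0 l) as Hl.
  destruct (H (eps / (2 * (Cmod z + 1)))%R) as (d2 & Hd2 & K2); [apply Rdiv_lt_0_compat; lra|].
  set (d3 := (eps / (2 * (Cmod l + 1)))%R).
  assert (Hd3 : (0 < d3)%R) by (apply Rdiv_lt_0_compat; lra).
  exists (Rmin d1 (Rmin d2 d3)). split; [repeat apply Rmin_glb_lt; easy|]. intros w Hw.
  assert (W1 : (Cmod (w - z) < d1)%R) by (eapply Rlt_le_trans; [exact Hw|apply Rmin_l]).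
  assert (W2 : (Cmod (w - z) < d2)%R) by (eapply Rlt_le_trans; [exact Hw|eapply Rle_trans; [apply Rmin_r|apply Rmin_l]]).
  assert (W3 : (Cmod (w - z) < d3)%R) by (eapply Rlt_le_trans; [exact Hw|eapply Rle_trans; [apply Rmin_r|apply Rmin_r]]).
  specialize (K1 w W1). specialize (K2 w W2).
  replace (w * f w - z * f z - (f z + z * l) * (w - z)) with
    (z * (f w - f z - l * (w - z)) + (w - z) * (f w - f z)) by ring.
  eapply Rle_trans; [apply Cmod_triangle|]. rewrite !Cmod_mult.
  pose proof (Cmod_ge_0 (w - z)) as Hwz.
  assert (A : (Cmod z * Cmod (f w - f z - l * (w - z)) <= eps / 2 * Cmod (w - z))%R).
  { apply Rle_trans with ((Cmod z + 1) * (eps / (2 * (Cmod z + 1)) * Cmod (w - z)))%R.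
    - apply Rmult_le_compat; try apply Cmod_ge_0; lra.
    - right; field; lra. }
  assert (B : (Cmod (w - z) * Cmod (f w - f z) <= eps / 2 * Cmod (w - z))%R).
  { rewrite (Rmult_comm (eps / 2)). apply Rmult_le_compat_l; [easy|].
    eapply Rle_trans; [exact K1|].
    apply Rle_trans with ((Cmod l + 1) * d3)%R; [apply Rmult_le_compat_l; lra|].
    right; unfold d3; field; lra. }
  lra.
Qed.

Lemma cderiv_ext f g z l : (forall w, f w = g w) -> cderiv f z l -> cderiv g z l.
Proof.
  intros H K eps Heps. destruct (K eps Heps) as (d & Hd & L). exists d; split; [easy|].
  intros w Hw. rewrite <- !H; auto.
Qed.

Lemma poly_cderiv d P : poly d P -> exists P', poly d P' /\ forall z, cderiv P z (P' z).
Proof.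
  induction 1.
  - exists (fun _ => RtoC 0). split; [apply poly_cst|]. intros z.
    eapply cderiv_ext; [|apply (cderiv_const c)]. intros; symmetry; auto.
  - destruct IHpoly as (Q' & HQ' & K). exists (fun z => 0 + (Q z + z * Q' z))%C. split.
    + apply poly_plus; [apply poly_cst|]. apply poly_plus; [apply poly_mono with d; [easy|lia]|].
      apply poly_id_mult; easy.
    + intros z. apply cderiv_ext with (fun w => c + w * Q w)%C; [intros; symmetry; auto|].
      apply cderiv_plus; [apply cderiv_const|]. apply cderiv_id_mult; auto.
Qed.

Lemma cderiv_pow_mult m f z l : cderiv f z l ->
  cderiv (fun w => w ^ S m * f w)%C z (INR (S m) * z ^ m * f z + z ^ S m * l).
Proof.
  intros H. induction m as [|m IH].
  - apply cderiv_ext with (fun w => w * f w)%C; [intros; simpl; ring|].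
    replace (INR 1 * z ^ 0 * f z + z ^ 1 * l) with (f z + z * l) by (simpl; ring).
    apply cderiv_id_mult; easy.
  - apply cderiv_ext with (fun w => w * (w ^ S m * f w))%C; [intros; simpl; ring|].
    replace (INR (S (S m)) * z ^ S m * f z + z ^ S (S m) * l) with
      (z ^ S m * f z + z * (INR (S m) * z ^ m * f z + z ^ S m * l)).
    + apply (cderiv_id_mult (fun w => w ^ S m * f w)%C); easy.
    + rewrite (S_INR (S m)), RtoC_plus. simpl Cpow. ring.
Qed.

(** Only derivatives that exist are constrained, so this bound is meaningful together with [poly] or
    [analytic]. *)
Definition seminorm_le (f : C -> C) (b : R) : Prop :=
  forall z l, (Cmod z < 1)%R -> cderiv f z l -> ((1 - Cmod z ^ 2) * Cmod l <= b)%R.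

Lemma poly_lip d P : poly d P -> exists B, (0 <= B)%R /\
  forall z w, (Cmod z <= 1)%R -> (Cmod w <= 1)%R -> (Cmod (P z - P w) <= B * Cmod (z - w))%R.
Proof.
  induction 1.
  - exists 0%R. split; [lra|]. intros z w _ _. rewrite !H.
    replace (c - c) with (RtoC 0) by ring. rewrite Cmod_0; lra.
  - destruct IHpoly as (B & HB & K). destruct (poly_bound _ _ H) as (M & HM & L).
    exists (M + B)%R. split; [lra|]. intros z w Hz Hw. rewrite !H0.
    replace (c + z * Q z - (c + w * Q w)) with ((z - w) * Q z + w * (Q z - Q w)) by ring.
    eapply Rle_trans; [apply Cmod_triangle|]. rewrite !Cmod_mult.
    specialize (K z w Hz Hw). specialize (L z Hz).
    pose proof (Cmod_ge_0 (z - w)). pose proof (Cmod_ge_0 w). pose proof (Cmod_ge_0 (Q z - Q w)).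
    pose proof (Cmod_ge_0 (Q z)). nra.
Qed.

(** The right side is 1 - r times a sum of n + 1 powers of r, each at least r^n. The consequence is
    that all monomials have comparable Bloch seminorms, whatever their degree. *)
Lemma pow_peak (r : R) n : (0 <= r <= 1)%R -> (INR (S n) * (1 - r) * r ^ n <= 1 - r ^ S n)%R.
Proof.
  intros Hr. induction n as [|n IH].
  - simpl; lra.
  - rewrite S_INR. assert (A : (0 <= r ^ S n <= 1)%R).
    { split; [apply pow_le; lra|]. rewrite <- (pow1 (S n)). apply pow_incr; lra. }
    replace ((INR (S n) + 1) * (1 - r) * r ^ S n)%R with (r * (INR (S n) * (1 - r) * r ^ n) + (1 - r) * r ^ S n)%R by (simpl; ring).
    change (r ^ S (S n))%R with (r * r ^ S n)%R. nra.
Qed.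

Lemma pow_peak_1 (r : R) n : (0 <= r <= 1)%R -> (INR (S n) * (1 - r) * r ^ n <= 1)%R.
Proof.
  intros Hr. eapply Rle_trans; [apply pow_peak; easy|].
  pose proof (pow_le r (S n) (proj1 Hr)). lra.
Qed.

(** Since r <= 1 - s <= y^2 with y = 1 - s/2, one factor y^n absorbs the linear factor by
    [pow_peak_1], and the other makes the product small. *)
Lemma pow_decay (s B c : R) : (0 < s <= 1)%R -> (0 <= B)%R -> (0 < c)%R -> exists n0, forall n r,
  (n0 <= n)%nat -> (0 <= r <= 1 - s)%R -> (INR (S n) * r ^ n * B + r ^ S n * B <= c)%R.
Proof.
  intros Hs HB Hc. set (y := (1 - s / 2)%R).
  destruct (pow_lt_1_zero y) with (y := (c / ((2 / s + 1) * (B + 1)))%R) as [n0 Hn0].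
  - rewrite Rabs_pos_eq; unfold y; lra.
  - apply Rdiv_lt_0_compat; [easy|]. apply Rmult_lt_0_compat; [|lra].
    assert (0 < 2 / s)%R by (apply Rdiv_lt_0_compat; lra). lra.
  - exists n0. intros n r Hn Hr. specialize (Hn0 n Hn).
    assert (Hy : (0 < y < 1)%R) by (unfold y; lra).
    rewrite Rabs_pos_eq in Hn0 by (apply pow_le; lra).
    assert (Y : (r ^ n <= y ^ n * y ^ n)%R).
    { rewrite <- Rpow_mult_distr. apply pow_incr. unfold y; nra. }
    assert (Yn : (0 < y ^ n)%R) by (apply pow_lt; lra).
    assert (Yn1 : (y ^ n <= 1)%R) by (rewrite <- (pow1 n); apply pow_incr; lra).
    pose proof (pow_peak_1 y n ltac:(lra)) as Pk.
    assert (Pk2 : (INR (S n) * y ^ n <= 2 / s)%R).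
    { apply Rmult_le_reg_r with (s / 2)%R; [lra|].
      replace (2 / s * (s / 2))%R with 1%R by (field; lra). unfold y in Pk at 1. lra. }
    pose proof (pos_INR (S n)) as Pn.
    assert (r0 : (0 <= r ^ n)%R) by (apply pow_le; lra).
    assert (A : (INR (S n) * r ^ n <= 2 / s * y ^ n)%R) by nra.
    assert (A2 : (r ^ S n <= y ^ n)%R) by (simpl; nra).
    assert (P0 : (0 < (2 / s + 1) * (B + 1))%R).
    { apply Rmult_lt_0_compat; [|lra]. assert (0 < 2 / s)%R by (apply Rdiv_lt_0_compat; lra). lra. }
    apply (Rmult_lt_compat_r _ _ _ P0) in Hn0.
    replace (c / ((2 / s + 1) * (B + 1)) * ((2 / s + 1) * (B + 1)))%R with c in Hn0 by (field; split; [|assert (0 < 2 / s)%R by (apply Rdiv_lt_0_compat; lra)]; lra).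
    assert (A3 : ((INR (S n) * r ^ n + r ^ S n) * B <= ((2 / s + 1) * y ^ n) * B)%R) by (apply Rmult_le_compat_r; lra).
    assert (0 < 2 / s)%R by (apply Rdiv_lt_0_compat; lra).
    assert (A4 : (0 <= (2 / s + 1) * y ^ n)%R) by (apply Rmult_le_pos; lra).
    nra.
Qed.

Lemma Cmod_div_self (z : C) : z <> 0 -> (Cmod (z / Cmod z) = 1)%R /\ (Cmod (z - z / Cmod z) = Rabs (1 - Cmod z))%R.
Proof.
  intros Hz. apply Cmod_gt_0 in Hz.
  assert (N : RtoC (Cmod z) <> 0) by (intros K; apply (f_equal fst) in K; simpl in K; lra).
  assert (A : (Cmod (z / Cmod z) = 1)%R).
  { rewrite Cmod_div, Cmod_R, Rabs_pos_eq by (easy || lra). field; lra. }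
  split; [easy|].
  replace (z - z / Cmod z) with (- (RtoC (1 - Cmod z) * (z / Cmod z))).
  - rewrite Cmod_opp, Cmod_mult, A, Cmod_R; ring.
  - rewrite RtoC_minus. field. easy.
Qed.

(* The two summands have their derivatives concentrated at different distances
   from the circle, so the seminorm of the sum is essentially the larger one. *)
Lemma bloch_gluing d e T Q b eps c : poly d T -> poly e Q ->
  (forall z, Cmod z = 1 -> Cmod (Q z) <= 1)%R -> seminorm_le T b -> (0 < eps)%R -> (0 < c)%R ->
  (2 * eps <= b)%R ->
  exists n0, forall n, (n0 <= n)%nat -> seminorm_le (fun z => T z + eps * (z ^ n * Q z))%C (b + c).
Proof.
  intros HT HQ Q1 HTb Heps Hc Hb.
  destruct (poly_cderiv _ _ HT) as (T' & HT' & DT). destruct (poly_cderiv _ _ HQ) as (Q' & HQ' & DQ).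
  destruct (poly_bound _ _ HT') as (B1 & HB1 & KT'). destruct (poly_bound _ _ HQ') as (B2 & HB2 & KQ').
  destruct (poly_bound _ _ HQ) as (B0 & HB0 & KQ). destruct (poly_lip _ _ HQ) as (B3 & HB3 & LQ).
  (* Near the circle three errors are of order s: the derivative of T, the derivative of Q, and the
     deviation of Q from its boundary values. Their total is at most s D, and s is chosen with s D
     <= c. *)
  set (D := (2 * B1 + 2 * eps * B2 + 2 * eps * B3 + 1)%R).
  assert (HD : (1 <= D)%R) by (unfold D; nra).
  set (s := Rmin (1/2) (c / D)).
  assert (Hs : (0 < s)%R) by (apply Rmin_glb_lt; [lra|apply Rdiv_lt_0_compat; lra]).
  assert (Hs1 : (s <= 1/2)%R) by apply Rmin_l.
  assert (HsD : (s * D <= c)%R).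
  { apply Rle_trans with (c / D * D)%R; [apply Rmult_le_compat_r; [lra|apply Rmin_r]|right; field; lra]. }
  destruct (pow_decay s (B0 + B2) (c / eps)) as [n0 Hn0]; [lra|lra|apply Rdiv_lt_0_compat; lra|].
  exists (S n0). intros [|n] Hn; [lia|]. intros z l Hz Hl.
  rewrite (cderiv_unique _ _ _ (T' z + eps * (INR (S n) * z ^ n * Q z + z ^ S n * Q' z)) Hl)
    by (apply cderiv_plus; [apply DT|apply cderiv_scal, cderiv_pow_mult, DQ]).
  set (r := Cmod z) in *. assert (Hr : (0 <= r)%R) by apply Cmod_ge_0.
  assert (HM : (Cmod (T' z + eps * (INR (S n) * z ^ n * Q z + z ^ S n * Q' z)) <=
     Cmod (T' z) + eps * (INR (S n) * r ^ n * Cmod (Q z) + r ^ S n * B2))%R).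
  { eapply Rle_trans; [apply Cmod_triangle|]. apply Rplus_le_compat_l.
    rewrite Cmod_mult, Cmod_R, Rabs_pos_eq by lra. apply Rmult_le_compat_l; [lra|].
    eapply Rle_trans; [apply Cmod_triangle|].
    rewrite !Cmod_mult, !Cmod_pow, Cmod_R, Rabs_pos_eq by apply pos_INR. fold r.
    apply Rplus_le_compat_l. apply Rmult_le_compat_l; [apply pow_le; easy|]. apply KQ'; fold r; lra. }
  assert (H1 : (0 <= 1 - r ^ 2 <= 1)%R) by (simpl; nra).
  eapply Rle_trans; [apply Rmult_le_compat_l; [lra|exact HM]|]. clear HM.
  rewrite Rmult_plus_distr_l.
  pose proof (pos_INR (S n)) as Pn. assert (rn : (0 <= r ^ n)%R) by (apply pow_le; easy).
  assert (rSn : (0 <= r ^ S n <= 1)%R).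
  { split; [apply pow_le; easy|]. rewrite <- (pow1 (S n)); apply pow_incr; lra. }
  (* Away from the circle T contributes at most b and the new term at most c. Near the circle T
     contributes O(s) and the new term at most 2 eps + O(s), which is where 2 eps <= b enters. *)
  destruct (Rle_lt_dec r (1 - s)) as [Hrs|Hrs].
  - specialize (HTb z (T' z) Hz (DT z)). fold r in HTb.
    specialize (Hn0 n r ltac:(lia) ltac:(lra)).
    assert (KQz := KQ z ltac:(fold r; lra)).
    assert (X : (INR (S n) * r ^ n * Cmod (Q z) + r ^ S n * B2 <= c / eps)%R).
    { eapply Rle_trans; [|exact Hn0]. apply Rplus_le_compat.
      - apply Rmult_le_compat_l; [apply Rmult_le_pos; easy|lra].
      - apply Rmult_le_compat_l; [easy|lra]. }
    assert (X0 : (0 <= INR (S n) * r ^ n * Cmod (Q z) + r ^ S n * B2)%R).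
    { apply Rplus_le_le_0_compat; apply Rmult_le_pos; try easy; [apply Rmult_le_pos; easy|apply Cmod_ge_0]. }
    set (X1 := (INR (S n) * r ^ n * Cmod (Q z) + r ^ S n * B2)%R) in *.
    assert (eps * X1 <= c)%R.
    { replace c with (eps * (c / eps))%R by (field; lra). apply Rmult_le_compat_l; lra. }
    assert (0 <= eps * X1)%R by nra. nra.
  - assert (Hz0 : z <> 0) by (apply Cmod_gt_0; fold r; lra).
    destruct (Cmod_div_self z Hz0) as [U1 U2]. fold r in U2. rewrite Rabs_pos_eq in U2 by lra.
    assert (KQz : (Cmod (Q z) <= 1 + B3 * s)%R).
    { replace (Q z) with (Q (z / r) + (Q z - Q (z / r))) by ring.
      eapply Rle_trans; [apply Cmod_triangle|]. apply Rplus_le_compat; [apply Q1; exact U1|].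
      eapply Rle_trans; [apply LQ; [fold r; lra|unfold r; rewrite U1; lra]|]. 
      unfold r at 1. fold r. rewrite U2. apply Rmult_le_compat_l; lra. }
    assert (KT := KT' z ltac:(fold r; lra)).
    pose proof (pow_peak_1 r n ltac:(lra)) as Pk.
    assert (G1 : ((1 - r ^ 2) * Cmod (T' z) <= 2 * s * B1)%R).
    { apply Rmult_le_compat; [lra|apply Cmod_ge_0|simpl; nra|easy]. }
    assert (G2 : ((1 - r ^ 2) * (INR (S n) * r ^ n * Cmod (Q z)) <= 2 * (1 + B3 * s))%R).
    { replace ((1 - r ^ 2) * (INR (S n) * r ^ n * Cmod (Q z)))%R with
        ((1 + r) * (INR (S n) * (1 - r) * r ^ n) * Cmod (Q z))%R by (simpl; ring).
      apply Rmult_le_compat; [|apply Cmod_ge_0| |easy].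
      - apply Rmult_le_pos; [lra|]. apply Rmult_le_pos; [apply Rmult_le_pos; lra|easy].
      - assert (0 <= INR (S n) * (1 - r) * r ^ n)%R by (apply Rmult_le_pos; [apply Rmult_le_pos; lra|easy]). nra. }
    assert (G3 : ((1 - r ^ 2) * (r ^ S n * B2) <= 2 * s * B2)%R).
    { apply Rmult_le_compat; [lra|apply Rmult_le_pos; lra|simpl; nra|nra]. }
    unfold D in HsD. nra.
Qed.

(** * Coefficients of Bloch polynomials and their pairing with high frequencies *)

Lemma Re_RtoC x : Re (RtoC x) = x.
Proof. easy. Qed.

Lemma bernoulli_minus (t : R) n : (0 <= t <= 1)%R -> (1 - INR n * t <= (1 - t) ^ n)%R.
Proof.
  intros Ht. induction n as [|n IH]; [simpl; lra|]. rewrite S_INR. simpl.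
  pose proof (pos_INR n). assert (0 <= (1 - t) ^ n)%R by (apply pow_le; lra). nra.
Qed.

Lemma cderiv_psum n a z : cderiv (psum n a) z (csum n (fun k => INR k * a k * z ^ pred k)).
Proof.
  induction n as [|n IH].
  - apply cderiv_const.
  - assert (H : cderiv (fun w => w ^ n)%C z (INR n * z ^ pred n)).
    { destruct n as [|n].
      - replace (INR 0 * z ^ pred 0) with (RtoC 0) by (simpl; ring). apply (cderiv_const 1).
      - replace (INR (S n) * z ^ pred (S n)) with (INR (S n) * z ^ n * 1 + z ^ S n * 0) by (simpl pred; ring).
        apply cderiv_ext with (fun w => w ^ S n * 1)%C; [intros; ring|].
        apply cderiv_pow_mult, cderiv_const. }
    apply (cderiv_scal (a n)), (cderiv_plus _ _ _ _ _ IH) in H.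
    replace (csum (S n) (fun k => INR k * a k * z ^ pred k)) with
      (csum n (fun k => INR k * a k * z ^ pred k) + a n * (INR n * z ^ pred n)) by (simpl csum; ring).
    exact H.
Qed.

Lemma seminorm_le_nonneg d P b : poly d P -> seminorm_le P b -> (0 <= b)%R.
Proof.
  intros HP H. destruct (poly_cderiv _ _ HP) as (P' & _ & D).
  specialize (H 0 (P' 0) ltac:(rewrite Cmod_0; lra) (D 0)). rewrite Cmod_0 in H.
  pose proof (Cmod_ge_0 (P' 0)). lra.
Qed.

Lemma seminorm_le_ext f g b : (forall z, f z = g z) -> seminorm_le f b -> seminorm_le g b.
Proof.
  intros H K z l Hz Hl. apply K; [easy|]. eapply cderiv_ext; [|exact Hl]. intros; symmetry; auto.
Qed.

Lemma bloch_coefs_nrm n a b r : seminorm_le (psum n a) b -> (0 <= r < 1)%R ->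
  (l2norm (psum n (fun k => RtoC (INR k * r ^ k) * a k)%C) <= b / (1 - r ^ 2))%R.
Proof.
  intros H Hr. assert (H1 : (0 < 1 - r ^ 2)%R) by (simpl; nra).
  assert (Hb := seminorm_le_nonneg _ _ _ (poly_psum n a) H).
  apply l2norm_sup; [apply trig_psum| |].
  - apply Rdiv_le_0_compat; lra.
  - intros z Hz. set (l := csum n (fun k => INR k * a k * (r * z) ^ pred k)).
    assert (Hl : cderiv (psum n a) (r * z) l) by apply cderiv_psum.
    assert (K : r * z * l = csum n (fun k => INR k * a k * (r * z) ^ k)).
    { unfold l. rewrite <- csum_scal. apply csum_ext. intros [|k] _; simpl; ring. }
    assert (M : Cmod (r * z) = r) by (rewrite Cmod_mult, Hz, Cmod_R, Rabs_pos_eq; lra).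
    specialize (H _ _ ltac:(rewrite M; lra) Hl). rewrite M in H.
    replace (psum n (fun k => RtoC (INR k * r ^ k) * a k)%C z) with (r * z * l).
    + rewrite Cmod_mult, M. apply Rmult_le_reg_l with (1 - r ^ 2)%R; [easy|].
      replace ((1 - r ^ 2) * (b / (1 - r ^ 2)))%R with b by (field; lra).
      assert (0 <= (1 - r ^ 2) * Cmod l)%R by (apply Rmult_le_pos; [lra|apply Cmod_ge_0]). nra.
    + rewrite K. apply csum_ext; intros k _. rewrite Cpow_mult_l, RtoC_mult, RtoC_pow. ring.
Qed.

Lemma poly_as_psum d P N : poly d P -> (d < N)%nat -> exists a, forall z, P z = psum N a z.
Proof.
  intros H HN. destruct N as [|N]; [lia|].
  apply poly_coefs. apply poly_mono with d; [easy|lia].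
Qed.

(* Parseval on the circle of radius 1 - 1/(4n), where the weights k r^k coming from
   z h'(z) are at least n/2 for all frequencies k of z^n Q. *)
Lemma bloch_duality d h b e Q n : poly d h -> seminorm_le h b -> poly e Q -> (e <= n)%nat -> (1 <= n)%nat ->
  (Cmod (mean (fun z => h z * Cconj (z ^ n * Q z))%C) <= 8 * b * l2norm Q)%R.
Proof.
  intros Hh Hb HQ He Hn.
  assert (TQ : trig Q) by (eapply trig_poly; eassumption).
  assert (PG := poly_pow_mult _ n _ HQ).
  set (N := (d + n + e + 1)%nat).
  destruct (poly_as_psum _ _ N Hh) as [a Ha]; [unfold N; lia|].
  destruct (poly_as_psum _ _ N PG) as [g Hg]; [unfold N; lia|]. cbv beta in Hg.
  assert (Hb' : seminorm_le (psum N a) b) by (eapply seminorm_le_ext; [exact Ha|easy]).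
  assert (b0 := seminorm_le_nonneg _ _ _ Hh Hb).
  assert (Hlow : forall k, (k < n)%nat -> g k = 0).
  { intros k Hk. transitivity (if Nat.ltb k N then g k else 0).
    - destruct (Nat.ltb_spec k N); [easy|unfold N in *; lia].
    - rewrite <- mean_psum_mono, <- (mean_high_freq e k Q (fun z => z ^ k)%C n HQ (poly_pow k) Hk).
      apply mean_ext; [apply trig_mult, trig_conj, trig_pow; apply trig_psum|].
      intros z _. rewrite <- Hg. ring. }
  assert (Hhigh : forall k, (n + e < k)%nat -> (k < N)%nat -> g k = 0).
  { intros k Hk HN. assert (Z : Cconj (g k) = 0).
    { replace (g k) with (mean (fun z => psum N g z * Cconj (z ^ k))%C).
      - rewrite <- mean_conj by (apply trig_mult, trig_conj, trig_pow; apply trig_psum).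
        rewrite <- (mean_high_freq 0 (n + e) (fun _ => 1) (fun z => z ^ n * Q z)%C k (poly_cst _ _) PG Hk).
        apply mean_ext; [apply trig_conj, trig_mult, trig_conj, trig_pow; apply trig_psum|].
        intros z _. rewrite <- Hg, !Cmult_conj, Cconj_conj. ring.
      - rewrite mean_psum_mono. destruct (Nat.ltb_spec k N); [easy|lia]. }
    rewrite <- (Cconj_conj (g k)), Z. apply injective_projections; simpl; ring. }
  assert (Pn : (1 <= INR n)%R) by (change 1%R with (INR 1); apply le_INR; easy).
  (* Bernoulli's inequality gives r^k >= 1/2 for k <= 2 n, and 1 - r^2 >= 1/(4 n). Hence x has norm
     at most 4 n b and y at most 2/n times the norm of Q, which explains the constant 8. *)
  set (r := (1 - 1 / (4 * INR n))%R).
  assert (It : (0 < 1 / (4 * INR n) <= 1 / 4)%R).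
  { split; [apply Rdiv_lt_0_compat; lra|]. apply Rmult_le_reg_r with (4 * INR n)%R; [lra|].
    replace (1 / (4 * INR n) * (4 * INR n))%R with 1%R by (field; lra). lra. }
  assert (Hr : (3 / 4 <= r < 1)%R) by (unfold r; lra).
  assert (Rp : forall k, (k <= n + e)%nat -> (1 / 2 <= r ^ k)%R).
  { intros k Hk. eapply Rle_trans; [|apply bernoulli_minus; lra].
    assert (INR k <= 2 * INR n)%R.
    { change 2%R with (INR 2). rewrite <- mult_INR. apply le_INR. lia. }
    assert (INR k * (1 / (4 * INR n)) <= 2 * INR n * (1 / (4 * INR n)))%R by (apply Rmult_le_compat_r; lra).
    replace (2 * INR n * (1 / (4 * INR n)))%R with (1/2)%R in * by (field; lra). lra. }
  (* The weight k r^k is moved from one factor to the other. It vanishes at k = 0, but there the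
     coefficient of z^n Q is zero because n >= 1. *)
  set (x := fun k => RtoC (INR k * r ^ k) * a k). set (y := fun k => RtoC (/ (INR k * r ^ k)) * g k).
  assert (EQ : mean (fun z => h z * Cconj (z ^ n * Q z))%C = mean (fun z => psum N x z * Cconj (psum N y z))%C).
  { rewrite mean_psum_psum. transitivity (mean (fun z => psum N a z * Cconj (psum N g z))%C).
    - apply mean_ext; [apply trig_mult; [eapply trig_poly; eassumption|apply trig_conj, (trig_poly _ _ PG)]|].
      intros z _; rewrite Ha, Hg; easy.
    - rewrite mean_psum_psum. apply csum_ext; intros k Hk. unfold x, y.
      destruct (Nat.lt_ge_cases k n) as [Hkn|Hkn].
      + rewrite Hlow by easy. rewrite !Cmult_conj. replace (Cconj 0) with (RtoC 0) by (apply injective_projections; simpl; ring). ring.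
      + assert (K0 : (0 < INR k)%R) by (apply lt_0_INR; lia).
        assert (K1 : (0 < r ^ k)%R) by (apply pow_lt; lra).
        assert (K2 : (INR k * r ^ k <> 0)%R) by (apply Rgt_not_eq, Rmult_lt_0_compat; easy).
        rewrite Cmult_conj. replace (Cconj (RtoC (/ (INR k * r ^ k)))) with (RtoC (/ (INR k * r ^ k))) by (apply injective_projections; simpl; ring).
        transitivity (RtoC (INR k * r ^ k * / (INR k * r ^ k)) * (a k * Cconj (g k))).
        * rewrite Rinv_r by easy. ring.
        * rewrite RtoC_mult. ring. }
  rewrite EQ. eapply Rle_trans; [apply mean_nrm; apply trig_psum|].
  assert (X : (l2norm (psum N x) <= 4 * INR n * b)%R).
  { eapply Rle_trans; [apply bloch_coefs_nrm; [exact Hb'|lra]|].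
    assert (D : (1 / (4 * INR n) <= 1 - r ^ 2)%R) by (unfold r; simpl; nra).
    apply Rmult_le_reg_r with (1 - r ^ 2)%R; [lra|].
    replace (b / (1 - r ^ 2) * (1 - r ^ 2))%R with b by (field; lra).
    replace b with (4 * INR n * b * (1 / (4 * INR n)))%R at 1 by (field; lra).
    apply Rmult_le_compat_l; [|easy]. nra. }
  assert (Y : (l2norm (psum N y) <= 2 / INR n * l2norm Q)%R).
  { assert (G : l2norm (psum N g) = l2norm (fun z => z ^ n * Q z)%C).
    { apply l2norm_ext; [apply trig_psum|]. intros; rewrite Hg; easy. }
    assert (G1 : (l2norm (fun z => z ^ n * Q z)%C <= 1 * l2norm Q)%R).
    { apply l2norm_le; [apply (trig_poly _ _ PG)|easy|lra|].
      intros z Hz. rewrite Cmod_mult, Cmod_pow, Hz, pow1; lra. }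
    assert (P2 : (0 < 2 / INR n)%R) by (apply Rdiv_lt_0_compat; lra).
    apply Rle_trans with (2 / INR n * l2norm (psum N g))%R; [|apply Rmult_le_compat_l; lra].
    apply sqr_le_inv; [apply Rmult_le_pos; [lra|apply l2norm_nonneg]|].
    rewrite Rpow_mult_distr, !l2norm_sqr by apply trig_psum. apply mean_sqr_psum_le; [lra|].
    intros k Hk. unfold y. rewrite Cmod_mult, Cmod_R.
    destruct (Nat.lt_ge_cases k n) as [Hkn|Hkn]; [rewrite Hlow, Cmod_0 by easy; lra|].
    destruct (Nat.lt_ge_cases (n + e) k) as [Hke|Hke]; [rewrite Hhigh, Cmod_0 by easy; lra|].
    apply Rmult_le_compat_r; [apply Cmod_ge_0|].
    assert (K0 : (INR n <= INR k)%R) by (apply le_INR; easy). specialize (Rp k Hke).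
    assert (K1 : (INR n / 2 <= INR k * r ^ k)%R) by nra.
    rewrite Rabs_pos_eq by (left; apply Rinv_0_lt_compat; lra).
    replace (2 / INR n)%R with (/ (INR n / 2))%R by (field; lra).
    apply Rinv_le_contravar; lra. }
  apply Rle_trans with ((4 * INR n * b) * (2 / INR n * l2norm Q))%R.
  - apply Rmult_le_compat; try apply l2norm_nonneg; easy.
  - right; field; lra.
Qed.

(** * Nearly unimodular polynomials of small Bloch norm *)

(* [T] after [l] steps. The first bound on test polynomials [W] says that the mean of
   |W|^2 (1 - |T|^2) decays like 1 / (1 + eps^2 l); the second one collects the costs
   of the [l] steps by the Cauchy-Schwarz inequality. *)
Definition flat_stage (eps : R) (d : nat) (b : R) (l : nat) (T : C -> C) : Prop :=
  (exists D P, poly D P /\ forall z, T z = z ^ S d * P z) /\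
  (forall z, Cmod z = 1 -> Cmod (T z) <= 1)%R /\
  seminorm_le T b /\
  forall W, poly d W ->
    ((mean_sqr W - mean_sqr (fun z => W z * T z)%C) * (1 + eps ^ 2 * INR l) <= mean_sqr W)%R /\
    forall k h b', poly k h -> seminorm_le h b' ->
      (Cmod (mean (fun z => h z * Cconj (W z * T z))%C) <= 8 * b' * sqrt (INR l * mean_sqr (fun z => W z * T z)%C))%R.

Lemma mean_sqr_mod F G : trig F -> (forall z, Cmod z = 1%R -> Cmod (F z) = Cmod (G z)) -> mean_sqr F = mean_sqr G.
Proof.
  intros HF H. unfold mean_sqr. f_equal. apply mean_ext; [apply trig_sqr; easy|].
  intros z Hz. rewrite !Cmult_conj_sqr, H; easy.
Qed.

(** This is Cauchy-Schwarz for the vectors (sqrt l, 1) and (sqrt T, x). Iterated, it bounds a sum of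
    l costs by sqrt l times the root of the sum of their squares. *)
Lemma sum_sqrt_step (l T x : R) : (0 <= l)%R -> (0 <= T)%R -> (0 <= x)%R ->
  (sqrt (l * T) + x <= sqrt ((l + 1) * (T + x ^ 2)))%R.
Proof.
  intros Hl HT Hx. assert (L0 : (0 <= l * T)%R) by nra.
  assert (x2 : (0 <= x ^ 2)%R) by (simpl; nra).
  apply sqr_le_inv; [apply sqrt_pos|].
  set (u := sqrt (l * T)). assert (U0 : (0 <= u)%R) by apply sqrt_pos.
  assert (U : (u ^ 2 = l * T)%R) by (simpl; rewrite Rmult_1_r; apply sqrt_sqrt; easy).
  replace (sqrt ((l + 1) * (T + x ^ 2)) ^ 2)%R with ((l + 1) * (T + x ^ 2))%R.
  2:{ simpl. rewrite !Rmult_1_r. symmetry. apply sqrt_sqrt. apply Rmult_le_pos; [lra|]. simpl in x2; lra. }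
  assert (A : (2 * u * x <= T + l * x ^ 2)%R).
  { apply sqr_le_inv; [nra|].
    replace ((2 * u * x) ^ 2)%R with (4 * (l * T) * x ^ 2)%R by (rewrite <- U; ring).
    assert (0 <= (T - l * x ^ 2) ^ 2)%R by apply pow2_ge_0. nra. }
  nra.
Qed.

(** Let w, y, a be the means of |W|^2 times 1, 1 - |T|^2 and its square. The new term is orthogonal
    to W T, so y drops by eps^2 a, and y^2 <= w a by Cauchy-Schwarz. Thus y becomes at most y -
    eps^2 y^2 / w, a recursion whose solutions decay like w / (1 + eps^2 l). *)
Lemma flat_stage_step eps d b l T c : (0 < eps <= 1/2)%R -> (0 < c)%R -> (2 * eps <= b)%R ->
  flat_stage eps d b l T -> exists T', flat_stage eps d (b + c) (S l) T'.
Proof.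
  intros Heps Hc Hb ((D & P & HP & KT) & T1 & TB & HW).
  assert (PT : poly (S d + D) T).
  { eapply poly_ext; [intros; symmetry; apply KT|]. apply poly_pow_mult; easy. }
  assert (TT : trig T) by (eapply trig_poly; eassumption).
  set (A := fun z => 1 - T z * Cconj (T z)).
  assert (TA : trig A) by (apply trig_minus; [apply trig_const|apply trig_sqr; easy]).
  assert (RA : forall z, A z = RtoC (1 - Cmod (T z) ^ 2)%R).
  { intros z. unfold A. rewrite Cmult_conj_sqr, RtoC_minus; easy. }
  assert (MA : forall z, Cmod z = 1%R -> Cmod (A z) = (1 - Cmod (T z) ^ 2)%R).
  { intros z Hz. rewrite RA, Cmod_R. apply Rabs_pos_eq.
    specialize (T1 z Hz). pose proof (Cmod_ge_0 (T z)). simpl; nra. }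
  (* On the circle Q equals z^k (1 - |T|^2): an analytic polynomial with the modulus of 1 -
     |T|^2. *)
  destruct TA as (k & e & Q & HQ & KQ).
  assert (TA : trig A) by (exists k, e, Q; easy).
  assert (MQ : forall z, Cmod z = 1%R -> Cmod (Q z) = Cmod (A z)).
  { intros z Hz. rewrite KQ, Cmod_mult, Cmod_pow, Cmod_conj, Hz, pow1 by easy. ring. }
  assert (Q1 : forall z, (Cmod z = 1 -> Cmod (Q z) <= 1)%R).
  { intros z Hz. rewrite MQ, MA by easy. pose proof (pow2_ge_0 (Cmod (T z))). lra. }
  destruct (bloch_gluing _ _ T Q b eps c PT HQ Q1 TB) as [n0 Hn0]; [lra|lra|lra|].
  (* Large enough for the gluing, for z^n W Q to be orthogonal to W T, for the duality estimate
     applied to W Q, and for the factor z^(d+1) to persist. *)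
  set (n := (n0 + d + d + d + D + e + 2)%nat).
  specialize (Hn0 n ltac:(unfold n; lia)).
  assert (HzQ := poly_pow_mult _ n _ HQ).
  assert (TzQ : trig (fun z => z ^ n * Q z)%C) by apply (trig_poly _ _ HzQ).
  exists (fun z => T z + eps * (z ^ n * Q z))%C. split; [|split; [|split]].
  - exists (D + (n + e))%nat, (fun z => P z + eps * (z ^ (n - S d) * Q z))%C. split.
    + apply poly_plus; [apply poly_mono with D; [easy|lia]|].
      apply poly_scal. apply poly_mono with (n - S d + e)%nat; [apply poly_pow_mult; easy|lia].
    + intros z. rewrite KT. replace n with (S d + (n - S d))%nat at 1 by (unfold n; lia).
      rewrite Cpow_add_r. ring.
  - intros z Hz. eapply Rle_trans; [apply Cmod_triangle|].
    rewrite !Cmod_mult, Cmod_pow, Hz, pow1, MQ, MA, Cmod_R, Rabs_pos_eq by (easy || lra).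
    specialize (T1 z Hz). pose proof (Cmod_ge_0 (T z)). set (t := Cmod (T z)) in *.
    (* With t = |T|, the bound t + eps (1 - t^2) <= 1 is the nonnegativity of this product; it holds
       since eps <= 1/2 and t <= 1. *)
    assert (0 <= (1 - t) * (1 - eps * (1 + t)))%R by (apply Rmult_le_pos; nra). simpl; nra.
  - exact Hn0.
  - intros W PW. destruct (HW W PW) as [HW1 HW2].
    assert (TW : trig W) by (eapply trig_poly; eassumption).
    assert (TWT : trig (fun z => W z * T z)%C) by (apply trig_mult; easy).
    assert (TWA : trig (fun z => W z * A z)%C) by (apply trig_mult; easy).
    assert (TWQ : trig (fun z => W z * Q z)%C) by (apply trig_mult; [easy|eapply trig_poly; eassumption]).
    assert (PWT := poly_mult _ _ _ _ PW PT). assert (PWQ := poly_mult _ _ _ _ PW HQ).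
    assert (TWzQ : trig (fun z => z ^ n * (W z * Q z))%C) by (apply trig_mult; [apply trig_pow|easy]).
    assert (N2WQ : mean_sqr (fun z => z ^ n * (W z * Q z))%C = mean_sqr (fun z => W z * A z)%C).
    { apply mean_sqr_mod; [easy|]. intros z Hz. rewrite !Cmod_mult, Cmod_pow, Hz, pow1, MQ by easy. ring. }
    assert (N2' : mean_sqr (fun z => W z * (T z + eps * (z ^ n * Q z)))%C =
      (mean_sqr (fun z => W z * T z)%C + eps ^ 2 * mean_sqr (fun z => W z * A z)%C)%R).
    { rewrite <- N2WQ.
      rewrite (mean_sqr_ext _ (fun z => eps * (z ^ n * (W z * Q z)) + W z * T z)%C).
      - rewrite mean_sqr_plus, mean_sqr_scal, Cmod_R, pow2_abs by (try apply trig_scal; easy).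
        replace (mean (fun z => eps * (z ^ n * (W z * Q z)) * Cconj (W z * T z))%C) with (RtoC 0).
        + simpl Re. ring.
        + rewrite <- (mean_high_freq _ _ _ _ n (poly_scal _ eps _ PWQ) PWT) by (unfold n; lia).
          apply mean_ext; [apply trig_mult; [apply trig_mult; [apply (trig_poly _ _ (poly_scal _ eps _ PWQ))|apply trig_pow]|apply trig_conj; easy]|].
          intros; ring.
      - apply trig_mult; [easy|]. apply trig_plus, trig_scal; easy.
      - intros; ring. }
    set (w := mean_sqr W) in *. set (t := mean_sqr (fun z => W z * T z)%C) in *.
    set (a := mean_sqr (fun z => W z * A z)%C) in *.
    assert (w0 : (0 <= w)%R) by (apply mean_sqr_nonneg; easy).
    assert (t0 : (0 <= t)%R) by (apply mean_sqr_nonneg; easy).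
    assert (a0 : (0 <= a)%R) by (apply mean_sqr_nonneg; easy).
    split.
    + rewrite N2'. rewrite S_INR.
      assert (Y : Re (mean (fun z => W z * Cconj (W z * A z))%C) = (w - t)%R).
      { unfold w, t, mean_sqr.
        rewrite (mean_ext _ (fun z => W z * Cconj (W z) + RtoC (-1) * (W z * T z * Cconj (W z * T z)))%C).
        - rewrite mean_plus, mean_scal, Re_plus, Re_Rscal by (try apply trig_scal; apply trig_sqr; easy). ring.
        - apply trig_mult, trig_conj; easy.
        - intros z _. unfold A. rewrite !Cmult_conj, Cminus_conj, Cmult_conj, Cconj_conj.
          replace (Cconj 1) with (RtoC 1) by (apply injective_projections; simpl; ring). ring. }
      assert (CS : ((w - t) ^ 2 <= w * a)%R).
      { rewrite <- Y. eapply Rle_trans; [|apply cauchy_schwarz; easy].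
        set (v := mean _). pose proof (re_le_Cmod v). rewrite <- (pow2_abs (Re v)).
        apply pow_incr. split; [apply Rabs_pos|easy]. }
      set (y := (w - t)%R) in *. assert (y <= w)%R by (unfold y; lra).
      replace (w - (t + eps ^ 2 * a))%R with (y - eps ^ 2 * a)%R by (unfold y; ring).
      pose proof (pos_INR l) as Pl. set (L := INR l) in *.
      set (e2 := (eps ^ 2)%R) in *. assert (He2 : (0 < e2 <= 1/4)%R) by (unfold e2; simpl; nra).
      clearbody y a w L e2. clear - HW1 CS w0 a0 H Pl He2.
      assert (S1 : (1 <= 1 + e2 * L)%R) by nra. set (s := (1 + e2 * L)%R) in *.
      replace (1 + e2 * (L + 1))%R with (s + e2)%R by (unfold s; ring). clearbody s.
      destruct w0 as [w0|<-].
      * apply Rmult_le_reg_l with w; [easy|].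
        assert (G0 : (0 <= e2 * (s + e2) * (w * a - y ^ 2))%R).
        { apply Rmult_le_pos; [apply Rmult_le_pos; lra|lra]. }
        assert (U0 : (0 <= w - y * s)%R) by lra.
        assert (Us : (e2 * y <= w)%R) by nra.
        assert (G1 : (0 <= (w - e2 * y) * (w - y * s))%R) by (apply Rmult_le_pos; lra).
        pose proof (pow2_ge_0 (e2 * y)) as G2.
        (* The identity subtracts from w^2 three nonnegative terms: Cauchy-Schwarz, a multiple of
           the induction hypothesis, and a square. *)
        replace (w * ((y - e2 * a) * (s + e2)))%R with
          (w * w - e2 * (s + e2) * (w * a - y ^ 2) - (w - e2 * y) * (w - y * s) - (e2 * y) ^ 2)%R by ring.
        lra.
      * assert (Y2 : (y * y <= 0)%R) by (simpl in CS; lra).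
        assert (Y0 : y = 0%R) by nra. rewrite Y0.
        assert (0 <= e2 * a * (s + e2))%R by (apply Rmult_le_pos; [apply Rmult_le_pos; lra|lra]). lra.
    + intros j h b' Hh Bh. specialize (HW2 _ _ _ Hh Bh).
      assert (b0 := seminorm_le_nonneg _ _ _ Hh Bh). assert (Th : trig h) by (eapply trig_poly; eassumption).
      rewrite N2', S_INR.
      rewrite (mean_ext _ (fun z => h z * Cconj (W z * T z) + eps * (h z * Cconj (z ^ n * (W z * Q z))))%C).
      * rewrite mean_plus, mean_scal by (try apply trig_scal; apply trig_mult, trig_conj; easy).
        eapply Rle_trans; [apply Cmod_triangle|]. rewrite Cmod_mult, Cmod_R, Rabs_pos_eq by lra.
        pose proof (bloch_duality _ _ _ _ _ n Hh Bh PWQ ltac:(unfold n; lia) ltac:(unfold n; lia)) as BD.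
        assert (NQ : l2norm (fun z => W z * Q z)%C = sqrt a).
        { unfold l2norm. f_equal. apply mean_sqr_mod; [easy|]. intros z Hz. rewrite !Cmod_mult, MQ; easy. }
        rewrite NQ in BD.
        pose proof (sum_sqrt_step (INR l) t (eps * sqrt a) (pos_INR l) t0 ltac:(apply Rmult_le_pos; [lra|apply sqrt_pos])) as SS.
        replace ((eps * sqrt a) ^ 2)%R with (eps ^ 2 * a)%R in SS.
        2:{ rewrite Rpow_mult_distr. f_equal. simpl. rewrite Rmult_1_r, sqrt_sqrt; easy. }
        apply Rle_trans with (8 * b' * (sqrt (INR l * t) + eps * sqrt a))%R.
        -- rewrite Rmult_plus_distr_l. apply Rplus_le_compat; [exact HW2|].
           apply Rle_trans with (eps * (8 * b' * sqrt a))%R; [apply Rmult_le_compat_l; [lra|exact BD]|right; ring].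
        -- apply Rmult_le_compat_l; [lra|exact SS].
      * apply trig_mult; [easy|]. apply trig_conj, trig_mult; [easy|]. apply trig_plus, trig_scal; easy.
      * intros z _. rewrite !Cmult_conj, Cplus_conj, !Cmult_conj.
        replace (Cconj (RtoC eps)) with (RtoC eps) by (apply injective_projections; simpl; ring). ring.
Qed.

(** Take L steps with eps^2 L between 64 and 81. The decay yields 1/64 for mean squares, hence 1/8
    for norms, and the cost 8 sqrt L becomes 72 / eps. Allowing a gluing error eps / L per step, the
    seminorm stays below 2 eps + eps. *)
Lemma flat_polynomial eps d : (0 < eps <= 1/2)%R -> exists D T,
  poly D T /\ (exists k P, poly k P /\ forall z, T z = z ^ S d * P z) /\
  (forall z, Cmod z = 1 -> Cmod (T z) <= 1)%R /\ seminorm_le T (3 * eps) /\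
  forall W, poly d W ->
    (l2norm (fun z => W z * (1 - T z * Cconj (T z)))%C <= 1 / 8 * l2norm W)%R /\
    forall k h b, poly k h -> seminorm_le h b ->
      (Cmod (mean (fun z => h z * Cconj (W z * T z))%C) <= 72 / eps * b * l2norm W)%R.
Proof.
  intros Heps. assert (e2 : (0 < eps ^ 2)%R) by (apply pow_lt; lra).
  destruct (nfloor_ex (64 / eps ^ 2)) as (L0 & HL1 & HL2).
  { apply Rdiv_le_0_compat; lra. }
  set (L := S L0).
  assert (PL : (64 / eps ^ 2 < INR L <= 81 / eps ^ 2)%R).
  { unfold L; rewrite S_INR. split; [easy|]. apply Rle_trans with (64 / eps ^ 2 + 1)%R; [lra|].
    apply Rmult_le_reg_r with (eps ^ 2)%R; [easy|].
    replace (81 / eps ^ 2 * eps ^ 2)%R with 81%R by (field; lra).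
    replace ((64 / eps ^ 2 + 1) * eps ^ 2)%R with (64 + eps ^ 2)%R by (field; lra). simpl; nra. }
  assert (PL0 : (0 < INR L)%R) by (unfold L; apply lt_0_INR; lia).
  assert (HS : forall l, exists T, flat_stage eps d (2 * eps + INR l * (eps / INR L)) l T).
  { induction l as [|l [T HT]].
    - exists (fun _ => RtoC 0). split; [|split; [|split]].
      + exists O, (fun _ => RtoC 0). split; [apply poly_cst|intros; ring].
      + intros; rewrite Cmod_0; lra.
      + intros z w _ Hw. rewrite (cderiv_unique _ _ _ _ Hw (cderiv_const 0 z)), Cmod_0. simpl; lra.
      + intros W PW. assert (TW : trig W) by (eapply trig_poly; eassumption). split.
        * pose proof (mean_sqr_nonneg (fun z => W z * 0)%C (trig_mult _ _ TW (trig_const 0))). simpl INR. lra.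
        * intros k h b Hh Bh. assert (b0 := seminorm_le_nonneg _ _ _ Hh Bh).
          rewrite (mean_ext _ (fun _ => RtoC 0)).
          -- rewrite mean_const, Cmod_0. apply Rmult_le_pos; [lra|apply sqrt_pos].
          -- apply trig_mult; [eapply trig_poly; eassumption|]. apply trig_conj, trig_mult; [easy|apply trig_const].
          -- intros z _. rewrite Cmult_0_r. replace (Cconj 0) with (RtoC 0) by (apply injective_projections; simpl; ring). ring.
    - destruct (flat_stage_step eps d (2 * eps + INR l * (eps / INR L)) l T (eps / INR L)) as [T' HT']; [easy|apply Rdiv_lt_0_compat; lra| |easy|].
      + assert (0 <= INR l * (eps / INR L))%R; [|lra].
        apply Rmult_le_pos; [apply pos_INR|]. left; apply Rdiv_lt_0_compat; lra.
      + exists T'. rewrite S_INR.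
        replace (2 * eps + (INR l + 1) * (eps / INR L))%R with (2 * eps + INR l * (eps / INR L) + eps / INR L)%R by ring. easy. }
  destruct (HS L) as (T & (D & P & HP & KT) & T1 & TB & HW).
  assert (PT : poly (S d + D) T).
  { eapply poly_ext; [intros; symmetry; apply KT|]. apply poly_pow_mult; easy. }
  assert (TT : trig T) by (eapply trig_poly; eassumption).
  exists (S d + D)%nat, T. split; [easy|]. split; [exists D, P; easy|]. split; [easy|]. split.
  { replace (3 * eps)%R with (2 * eps + INR L * (eps / INR L))%R by (field; lra). easy. }
  intros W PW. destruct (HW W PW) as [HW1 HW2].
  assert (TW : trig W) by (eapply trig_poly; eassumption).
  assert (TWT : trig (fun z => W z * T z)%C) by (apply trig_mult; easy).
  assert (T2 : trig (fun z => 1 - T z * Cconj (T z))%C) by (apply trig_minus; [apply trig_const|apply trig_sqr; easy]).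
  assert (TWA : trig (fun z => W z * (1 - T z * Cconj (T z)))%C) by (apply trig_mult; easy).
  split.
  - apply sqr_le_inv; [apply Rmult_le_pos; [lra|apply l2norm_nonneg]|].
    rewrite Rpow_mult_distr, !l2norm_sqr by easy.
    (* Pointwise (1 - s)^2 <= 1 - s for s = |T|^2 in [0, 1], so the quantity of [flat_stage]
       dominates. *)
    apply Rle_trans with (mean_sqr W - mean_sqr (fun z => W z * T z)%C)%R.
    + unfold mean_sqr.
      replace (Re (mean (fun z => W z * Cconj (W z))%C) - Re (mean (fun z => W z * T z * Cconj (W z * T z))%C))%R with
        (Re (mean (fun z => W z * Cconj (W z) + RtoC (-1) * (W z * T z * Cconj (W z * T z)))%C)).
      2:{ rewrite mean_plus, mean_scal, Re_plus, Re_Rscal by (try apply trig_scal; apply trig_sqr; easy). ring. }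
      apply mean_le; [apply trig_sqr; easy|apply trig_plus, trig_scal; apply trig_sqr; easy|].
      intros z Hz. rewrite !Cmult_conj_sqr, Re_plus, Re_Rscal, !Re_RtoC.
      rewrite !Cmod_mult, <- RtoC_minus, Cmod_R.
      specialize (T1 z Hz). pose proof (Cmod_ge_0 (T z)). pose proof (Cmod_ge_0 (W z)).
      rewrite Rabs_pos_eq by (simpl; nra).
      rewrite !Rpow_mult_distr. set (s := (Cmod (T z) ^ 2)%R).
      assert (0 <= s <= 1)%R by (unfold s; simpl; nra).
      assert (0 <= Cmod (W z) ^ 2 * (s * (1 - s)))%R.
      { apply Rmult_le_pos; [apply pow2_ge_0|apply Rmult_le_pos; lra]. }
      replace (Cmod (W z) ^ 2 * (1 - s) ^ 2)%R with
        (Cmod (W z) ^ 2 + -1 * (Cmod (W z) ^ 2 * s) - Cmod (W z) ^ 2 * (s * (1 - s)))%R by ring. lra.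
    + assert (w0 := mean_sqr_nonneg _ TW).
      assert (G : (64 <= eps ^ 2 * INR L)%R).
      { apply Rle_trans with (eps ^ 2 * (64 / eps ^ 2))%R; [right; field; lra|]. apply Rmult_le_compat_l; lra. }
      set (y := (mean_sqr W - mean_sqr (fun z => W z * T z)%C)%R) in *. replace ((1 / 8) ^ 2)%R with (1 / 64)%R by field.
      destruct (Rle_lt_dec y 0); [lra|].
      assert (y * 64 <= y * (eps ^ 2 * INR L))%R by (apply Rmult_le_compat_l; lra). lra.
  - intros k h b Hh Bh. specialize (HW2 _ _ _ Hh Bh).
    assert (b0 := seminorm_le_nonneg _ _ _ Hh Bh).
    eapply Rle_trans; [exact HW2|].
    assert (K : (mean_sqr (fun z => W z * T z)%C <= 1 ^ 2 * mean_sqr W)%R).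
    { apply mean_sqr_le; [easy|easy|lra|]. intros z Hz. rewrite Cmod_mult. specialize (T1 z Hz).
      pose proof (Cmod_ge_0 (W z)). nra. }
    assert (S : (sqrt (INR L * mean_sqr (fun z => W z * T z)%C) <= 9 / eps * l2norm W)%R).
    { apply sqr_le_inv; [apply Rmult_le_pos; [left; apply Rdiv_lt_0_compat; lra|apply l2norm_nonneg]|].
      rewrite Rpow_mult_distr, l2norm_sqr by easy. rewrite pow2_sqrt.
      - replace ((9 / eps) ^ 2)%R with (81 / eps ^ 2)%R by (field; lra).
        apply Rmult_le_compat; [lra|apply mean_sqr_nonneg; easy|lra|lra].
      - apply Rmult_le_pos; [lra|apply mean_sqr_nonneg; easy]. }
    apply Rle_trans with (8 * b * (9 / eps * l2norm W))%R; [apply Rmult_le_compat_l; lra|right; field; lra].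
Qed.

(** * Finite real sums, choice and the Kronecker symbol *)

Fixpoint rsum (n : nat) (F : nat -> R) : R :=
  match n with O => 0%R | S k => (rsum k F + F k)%R end.

Lemma rsum_le n F G : (forall k, (k < n)%nat -> F k <= G k)%R -> (rsum n F <= rsum n G)%R.
Proof.
  induction n as [|n IH]; intros H; simpl; [lra|].
  specialize (IH ltac:(auto)). specialize (H n ltac:(auto)). lra.
Qed.

Lemma rsum_plus n F G : rsum n (fun k => F k + G k)%R = (rsum n F + rsum n G)%R.
Proof. induction n as [|n IH]; simpl; [ring|rewrite IH; ring]. Qed.

Lemma rsum_scal n c F : rsum n (fun k => c * F k)%R = (c * rsum n F)%R.
Proof. induction n as [|n IH]; simpl; [ring|rewrite IH; ring]. Qed.

Lemma rsum_mono m n F : (forall k, 0 <= F k)%R -> (m <= n)%nat -> (rsum m F <= rsum n F)%R.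
Proof. intros H; induction 1; simpl; [lra|]. specialize (H m0); lra. Qed.

Lemma rsum_delta n a c : rsum n (fun k => if Nat.eq_dec k a then c else 0%R) = if lt_dec a n then c else 0%R.
Proof.
  induction n as [|n IH]; simpl rsum.
  - destruct (lt_dec a 0); [lia|easy].
  - rewrite IH. destruct (lt_dec a n), (lt_dec a (S n)), (Nat.eq_dec n a); try lia; ring.
Qed.

Lemma rsum_support J n F : (forall k, 0 <= F k)%R -> (forall k, (J <= k)%nat -> F k = 0%R) -> (rsum n F <= rsum J F)%R.
Proof.
  intros H K. destruct (Nat.le_ge_cases n J) as [Hn|Hn]; [apply rsum_mono; easy|].
  induction Hn; simpl; [lra|]. rewrite (K m) by easy. lra.
Qed.

Lemma Cmod_csum n F : (Cmod (csum n F) <= rsum n (fun k => Cmod (F k)))%R.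
Proof.
  induction n as [|n IH]; simpl; [rewrite Cmod_0; lra|].
  eapply Rle_trans; [apply Cmod_triangle|]. lra.
Qed.

Lemma choice_fun (A B : Type) (P : A -> B -> Prop) : (forall x, exists y, P x y) -> exists f, forall x, P x (f x).
Proof.
  intros H. exists (fun x => proj1_sig (constructive_indefinite_description _ (H x))).
  intros x. apply proj2_sig.
Qed.

Definition delta (i j : nat) : R := if Nat.eq_dec j i then 1%R else 0%R.

(** * The inductive construction *)

(* The polynomial [g] represents an approximation of the functional sending
   sum_j p_j f_j to p_i(0); its defect on p f_j is the pairing of p with V_j.
   In the potential bound, a step on f_a raises kappa by 216 w_a v_a and lowers the
   weighted sum of the defects by at least w_a v_a / 2. *)
Definition almost_dual (f : nat -> C -> C) (w : nat -> R) (d i : nat) : Prop :=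
  exists (g : C -> C) (V : nat -> C -> C) (v : nat -> R) (kappa : R),
    poly d g /\ (forall j, poly d (V j)) /\ (forall j, l2norm (V j) <= v j)%R /\ (0 <= kappa)%R /\
    (forall j e p, poly e p ->
       mean (fun z => p z * f j z * Cconj (g z))%C = delta i j * p 0 - mean (fun z => p z * Cconj (V j z))%C) /\
    (forall e h b, poly e h -> seminorm_le h b -> (Cmod (mean (fun z => h z * Cconj (g z))%C) <= kappa * b)%R) /\
    (forall M, kappa / 432 + rsum M (fun j => w j * v j) <= 1)%R.

(** The finite support makes the total of w_j sup |f_j| finite, and the degree bound shared by all
    f_j, g and V_j lets one T act for every i. *)
Definition stage (f : nat -> C -> C) (w : nat -> R) : Prop :=
  exists d J, (forall j, poly d (f j)) /\ (forall j, (J <= j)%nat -> forall z, f j z = 0) /\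
    (forall j, 1 <= w j)%R /\ forall i, almost_dual f w d i.

Lemma almost_dual_nonneg (V : nat -> C -> C) v : (forall j : nat, l2norm (V j) <= v j)%R -> forall j, (0 <= v j)%R.
Proof. intros H j. eapply Rle_trans; [apply l2norm_nonneg|apply H]. Qed.

Lemma l2norm_const c : l2norm (fun _ => c) = Cmod c.
Proof.
  unfold l2norm, mean_sqr. rewrite mean_const, Cmult_conj_sqr, Re_RtoC. apply sqrt_pow2, Cmod_ge_0.
Qed.

(** With all f_j and g equal to zero, the whole of delta_ij p(0) is defect: V_j is the constant
    delta_ij, and the potential starts at its maximal value 1. *)
Lemma stage_init : stage (fun _ _ => RtoC 0) (fun _ => 1%R).
Proof.
  exists O, O. split; [intros; apply poly_cst|]. split; [easy|]. split; [intros; lra|].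
  intros i. exists (fun _ => RtoC 0), (fun j _ => RtoC (delta i j)), (fun j => delta i j), 0%R.
  split; [apply poly_cst|]. split; [intros; apply poly_cst|].
  assert (D0 : forall j, (0 <= delta i j)%R) by (intros j; unfold delta; destruct (Nat.eq_dec j i); lra).
  assert (Z : Cconj 0 = 0) by (apply injective_projections; simpl; ring).
  split; [|split; [lra|split; [|split]]].
  - intros j. rewrite l2norm_const, Cmod_R, Rabs_pos_eq by easy. lra.
  - intros j e p Hp.
    assert (Tp : trig p) by (eapply trig_poly; eassumption).
    rewrite (mean_ext (fun z => p z * 0 * Cconj 0)%C (fun _ => RtoC 0)).
    + rewrite mean_const.
      rewrite (mean_ext (fun z => p z * Cconj (RtoC (delta i j)))%C (fun z => RtoC (delta i j) * p z)%C).
      * rewrite mean_scal, (mean_poly _ _ Hp) by easy. ring.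
      * apply trig_mult; [easy|apply trig_const].
      * intros z _. replace (Cconj (RtoC (delta i j))) with (RtoC (delta i j)) by (apply injective_projections; simpl; ring). ring.
    + apply trig_mult; [apply trig_mult; [easy|apply trig_const]|apply trig_const].
    + intros; ring.
  - intros e h b Hh _. rewrite (mean_ext _ (fun _ => RtoC 0)).
    + rewrite mean_const, Cmod_0. lra.
    + apply trig_mult; [eapply trig_poly; eassumption|apply trig_const].
    + intros; rewrite Z; ring.
  - intros M. replace (0 / 432)%R with 0%R by field.
    apply Rle_trans with (rsum M (fun j => if Nat.eq_dec j i then 1%R else 0%R)).
    + rewrite Rplus_0_l. apply rsum_le. intros; unfold delta; destruct (Nat.eq_dec k i); lra.
    + rewrite rsum_delta. destruct (lt_dec i M); lra.
Qed.

Definition upd {A : Type} (u : nat -> A) (a : nat) (x : A) (j : nat) : A :=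
  if Nat.eq_dec j a then x else u j.

(** In the product of f_a + R T with the conjugate of g + V_a T / R, the main new term is |T|^2 conj
    V_a, which nearly cancels the old defect. The term with R T and g vanishes because z^(d+1)
    divides T, and what remains is f_j against V_a T / R, of order 1/R. *)
Lemma stage_step f w a : stage f w -> exists phi,
  stage (upd f a (fun z => f a z + phi z)%C) (upd w a (2 * w a)%R) /\
  phi 0 = 0 /\ seminorm_le phi (/ w a) /\ exists d, poly d phi.
Proof.
  intros (d & J & Pf & Sf & W1 & AD).
  destruct (choice_fun nat R (fun j B => (0 <= B)%R /\ ((J <= j)%nat -> B = 0%R) /\
     forall z, (Cmod z = 1 -> Cmod (f j z) <= B)%R)) as [F HF].
  { intros j. destruct (Nat.le_gt_cases J j) as [Hj|Hj].
    - exists 0%R. split; [lra|]. split; [easy|]. intros z _. rewrite Sf, Cmod_0 by easy. lra.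
    - destruct (poly_bound _ _ (Pf j)) as (B & HB & K). exists B. split; [easy|]. split; [lia|].
      intros z Hz; apply K; lra. }
  set (B := rsum J (fun j => w j * F j)%R).
  assert (HB : forall M, (rsum M (fun j => w j * F j) <= B)%R).
  { intros M. apply rsum_support.
    - intros k. specialize (W1 k). destruct (HF k) as [H _]. apply Rmult_le_pos; lra.
    - intros k Hk. destruct (HF k) as (_ & H & _). rewrite H by easy; ring. }
  assert (B0 : (0 <= B)%R) by apply (HB O).
  (* This is the factor R. As [B] bounds every partial sum of w_j sup |f_j|, the weighted new errors
     add up to at most v_a / 8 before the weight of index a is doubled. *)
  set (R0 := (1 + 8 * B)%R). assert (HR : (1 <= R0)%R) by (unfold R0; lra).
  assert (HBR : (B / R0 <= 1 / 8)%R).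
  { apply Rmult_le_reg_r with R0; [lra|]. replace (B / R0 * R0)%R with B by (field; lra). unfold R0; lra. }
  assert (Wa := W1 a).
  (* The seminorm of R T, at most 3 eps [R0], becomes 1/w_a, and the cost 72 / eps divided by [R0]
     becomes 216 w_a. *)
  set (eps := (/ (3 * R0 * w a))%R).
  assert (WR : (1 <= R0 * w a)%R) by nra.
  assert (He : (0 < eps <= 1/2)%R).
  { unfold eps. split; [apply Rinv_0_lt_compat; lra|].
    apply Rle_trans with (/ 2)%R; [apply Rinv_le_contravar; lra|lra]. }
  destruct (flat_polynomial eps d He) as (D & T & PT & (k0 & P0 & HP0 & KT0) & T1 & TB & HT).
  assert (TT : trig T) by (eapply trig_poly; eassumption).
  destruct (poly_reverse _ _ PT) as (Ts & PTs & KTs).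
  assert (Prev : forall j, exists fs, poly d fs /\ forall z, Cmod z = 1%R -> Cconj (f j z) = Cconj z ^ d * fs z).
  { intros j; apply poly_reverse; easy. }
  apply choice_fun in Prev. destruct Prev as [fs Hfs].
  exists (fun z => R0 * T z)%C. split; [|split; [|split]].
  2:{ rewrite KT0. simpl; ring. }
  3:{ exists D. apply poly_scal; easy. }
  2:{ intros z l Hz Hl. destruct (poly_cderiv _ _ PT) as (T' & _ & DT).
      rewrite (cderiv_unique _ _ _ _ Hl (cderiv_scal R0 _ _ _ (DT z))).
      specialize (TB z (T' z) Hz (DT z)). rewrite Cmod_mult, Cmod_R, Rabs_pos_eq by lra.
      apply Rle_trans with (R0 * (3 * eps))%R.
      - apply Rle_trans with (R0 * ((1 - Cmod z ^ 2) * Cmod (T' z)))%R; [right; ring|].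
        apply Rmult_le_compat_l; lra.
      - right. unfold eps. field; lra. }
  (* No frequency below -n occurs in the functions to be projected; [d'] is a crude bound for all
     new degrees. *)
  set (n := (d + D)%nat). set (d' := (6 * n)%nat).
  exists d', (S (J + a)). split; [|split; [|split]].
  { intros j. unfold upd. destruct (Nat.eq_dec j a).
    - apply poly_plus; [apply poly_mono with d; [easy|unfold d', n; lia]|].
      apply poly_scal, poly_mono with D; [easy|unfold d', n; lia].
    - apply poly_mono with d; [easy|unfold d', n; lia]. }
  { intros j Hj z. unfold upd. destruct (Nat.eq_dec j a); [lia|]. apply Sf; lia. }
  { intros j. unfold upd. destruct (Nat.eq_dec j a); [lra|apply W1]. }
  intros i. destruct (AD i) as (g & V & v & kappa & Pg & PV & NV & K0 & DUAL & COST & POT).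
  assert (v0 := almost_dual_nonneg V v NV).
  assert (Tg : trig g) by (eapply trig_poly; eassumption).
  assert (TV : forall j, trig (V j)) by (intros j; eapply trig_poly; apply PV).
  assert (Tf : forall j, trig (f j)) by (intros j; eapply trig_poly; apply Pf).
  destruct (HT (V a) (PV a)) as [HT1 HT2].
  set (r := (/ R0)%R). assert (r0 : (0 < r <= 1)%R).
  { unfold r. split; [apply Rinv_0_lt_compat; lra|]. rewrite <- Rinv_1. apply Rinv_le_contravar; lra. }
  assert (Rr : R0 * r = 1) by (unfold r; rewrite <- RtoC_mult, Rinv_r by lra; easy).
  assert (Cr : Cconj r = r) by (apply injective_projections; simpl; ring).
  (* The new defect is [A j] - [U j]. It contains conjugates of T and f_j, so it is replaced by its
     analytic projection, which pairs in the same way with polynomials. *)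
  set (A := fun j z => if Nat.eq_dec j a then V j z * (1 - T z * Cconj (T z)) else V j z).
  set (U := fun j z => r * (Cconj (f j z) * (V a z * T z))).
  assert (T1m : trig (fun z => 1 - T z * Cconj (T z))%C) by (apply trig_minus; [apply trig_const|apply trig_sqr; easy]).
  assert (TA : forall j, trig (A j)).
  { intros j. unfold A. destruct (Nat.eq_dec j a); [apply trig_mult; easy|apply TV]. }
  assert (TVT : trig (fun z => V a z * T z)%C) by (apply trig_mult; easy).
  assert (TU : forall j, trig (U j)).
  { intros j. apply trig_scal, trig_mult; [apply trig_conj; easy|easy]. }
  set (v' := fun j => ((if Nat.eq_dec j a then 1 / 8 * v j else v j) + r * F j * v a)%R).
  assert (PROJ : forall j, exists V', poly d' V' /\ (l2norm V' <= v' j)%R /\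
     forall e p, poly e p -> mean (fun z => p z * Cconj (V' z))%C = mean (fun z => p z * Cconj (A j z))%C - mean (fun z => p z * Cconj (U j z))%C).
  { intros j. destruct (Hfs j) as [Pfs Kfs].
    destruct (analytic_projection n d' (fun z => (if Nat.eq_dec j a then V j z * (z ^ n * 1 + (-(1)) * (z ^ d * (T z * Ts z))) else z ^ n * V j z)
         + (- r) * (z ^ D * (fs j z * (V a z * T z))))%C (fun z => A j z - U j z)%C) as (V' & PV' & NV' & KV').
    - apply poly_plus.
      + destruct (Nat.eq_dec j a).
        * apply poly_mono with (d + (n + n))%nat; [|unfold d', n; lia]. apply poly_mult; [apply PV|].
          apply poly_plus; [apply poly_pow_mult, poly_cst|]. apply poly_scal.
          apply poly_mono with (d + (D + D))%nat; [|unfold n; lia]. apply poly_pow_mult, poly_mult; easy.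
        * apply poly_mono with (n + d)%nat; [|unfold d', n; lia]. apply poly_pow_mult, PV.
      + apply poly_scal. apply poly_mono with (D + (d + (d + D)))%nat; [|unfold d', n; lia].
        apply poly_pow_mult, poly_mult; [easy|]. apply poly_mult; easy.
    - intros z Hz. unfold A, U. rewrite Kfs by easy.
      pose proof (Cpow_conj_unit z n Hz) as E1. pose proof (Cpow_conj_unit z d Hz) as E2.
      pose proof (Cpow_conj_unit z D Hz) as E3.
      assert (En : Cconj z ^ n = Cconj z ^ d * Cconj z ^ D) by (unfold n; apply Cpow_add_r).
      rewrite Cmult_plus_distr_l. unfold Cminus at 1. f_equal.
      + destruct (Nat.eq_dec j a).
        * rewrite KTs by easy.
          transitivity (V j z * (z ^ n * Cconj z ^ n) - V j z * T z * (z ^ d * Cconj z ^ d) * (Cconj z ^ D * Ts z)).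
          -- rewrite E1, E2; ring.
          -- rewrite En. ring.
        * transitivity (z ^ n * Cconj z ^ n * V j z); [rewrite E1; ring|ring].
      + rewrite En.
        transitivity (- r * (z ^ D * Cconj z ^ D) * (Cconj z ^ d * fs j z * (V a z * T z))); [rewrite E3|]; ring.
    - exists V'. split; [easy|]. split.
      + eapply Rle_trans; [exact NV'|].
        rewrite (l2norm_ext _ (fun z => A j z + RtoC (-1) * U j z)%C); [|apply trig_minus; easy|intros; ring].
        eapply Rle_trans; [apply l2norm_triangle; [easy|apply trig_scal; easy]|].
        unfold v'. apply Rplus_le_compat.
        * unfold A. destruct (Nat.eq_dec j a) as [->|Hja].
          -- eapply Rle_trans; [exact HT1|]. apply Rmult_le_compat_l; [lra|apply NV].
          -- apply NV.
        * destruct (HF j) as (F0 & _ & F1).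
          apply Rle_trans with (r * F j * l2norm (V a))%R; [|apply Rmult_le_compat_l; [apply Rmult_le_pos; lra|apply NV]].
          apply l2norm_le; [apply trig_scal; easy|easy|apply Rmult_le_pos; lra|].
          intros z Hz. unfold U. rewrite !Cmod_mult, !Cmod_R, Cmod_conj, (Rabs_pos_eq r) by lra.
          replace (Rabs (-1)) with 1%R by (rewrite Rabs_left; lra).
          specialize (F1 z Hz). specialize (T1 z Hz).
          pose proof (Cmod_ge_0 (f j z)). pose proof (Cmod_ge_0 (T z)). pose proof (Cmod_ge_0 (V a z)).
          rewrite Rmult_1_l, Rmult_assoc. apply Rmult_le_compat_l; [lra|].
          apply Rmult_le_compat; try easy; [apply Rmult_le_pos; easy|]. nra.
      + intros e p Hp. rewrite (KV' e p Hp).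
        assert (Tp : trig p) by (eapply trig_poly; eassumption).
        rewrite (mean_ext _ (fun z => p z * Cconj (A j z) + RtoC (-1) * (p z * Cconj (U j z)))%C).
        * rewrite mean_plus, mean_scal by (try apply trig_scal; apply trig_mult, trig_conj; easy). ring.
        * apply trig_mult, trig_conj, trig_minus; easy.
        * intros z _. rewrite Cminus_conj. ring. }
  apply choice_fun in PROJ. destruct PROJ as [V' HV'].
  exists (fun z => g z + r * (V a z * T z))%C, V', v', (kappa + 216 * (w a * v a))%R.
  split; [|split; [intros j; apply HV'|split; [intros j; apply HV'|split; [|split; [|split]]]]].
  - apply poly_plus; [apply poly_mono with d; [easy|unfold d', n; lia]|].
    apply poly_scal. apply poly_mono with (d + D)%nat; [apply poly_mult; easy|unfold d', n; lia].
  - assert (0 <= w a * v a)%R by (apply Rmult_le_pos; [lra|apply v0]). lra.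
  - intros j e p Hp. assert (Tp : trig p) by (eapply trig_poly; eassumption).
    destruct (HV' j) as (_ & _ & KV'). rewrite (KV' e p Hp).
    assert (TpU : trig (fun z => p z * Cconj (U j z))%C) by (apply trig_mult, trig_conj; easy).
    assert (Tpfg : trig (fun z => p z * f j z * Cconj (g z))%C) by (apply trig_mult; [apply trig_mult; easy|apply trig_conj; easy]).
    assert (TpV : trig (fun z => p z * Cconj (V j z))%C) by (apply trig_mult, trig_conj; easy).
    assert (TpA : trig (fun z => p z * Cconj (A j z))%C) by (apply trig_mult, trig_conj; easy).
    unfold upd. destruct (Nat.eq_dec j a) as [->|Hja] eqn:Ej.
    + assert (TpTg : trig (fun z => p z * T z * Cconj (g z))%C) by (apply trig_mult; [apply trig_mult; easy|apply trig_conj; easy]).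
      assert (Z : mean (fun z => p z * T z * Cconj (g z))%C = 0).
      { rewrite <- (mean_high_freq _ _ _ _ (S d) (poly_mult _ _ _ _ Hp HP0) Pg) by lia.
        apply mean_ext; [easy|]. intros z _. rewrite KT0. ring. }
      (* Expansion of p (f_a + R T) conj (g + r V_a T) with R r = 1, the term p |T|^2 conj V_a being
         written as p conj V_a - p conj A_a. *)
      rewrite (mean_ext _ (fun z => (p z * f a z * Cconj (g z) + p z * Cconj (U a z)) +
         (R0 * (p z * T z * Cconj (g z)) + (p z * Cconj (V a z) + RtoC (-1) * (p z * Cconj (A a z)))))%C).
      * rewrite !mean_plus, !mean_scal, Z, (DUAL a e p Hp) by (repeat first [easy|apply trig_plus|apply trig_scal]). ring.
      * apply trig_mult; [apply trig_mult; [easy|apply trig_plus, trig_scal; easy]|].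
        apply trig_conj, trig_plus, trig_scal; easy.
      * intros z _. unfold U, A. rewrite Ej.
        rewrite !Cplus_conj, !Cmult_conj, Cminus_conj, Cmult_conj, !Cconj_conj, Cr.
        replace (Cconj 1) with (RtoC 1) by (apply injective_projections; simpl; ring).
        transitivity (p z * f a z * Cconj (g z) + r * (p z * f a z * (Cconj (V a z) * Cconj (T z))) + R0 * (p z * T z * Cconj (g z)) +
          R0 * r * (p z * T z * Cconj (T z) * Cconj (V a z))); [ring|]. rewrite Rr. ring.
    + rewrite (mean_ext _ (fun z => p z * f j z * Cconj (g z) + p z * Cconj (U j z))%C).
      * rewrite mean_plus, (DUAL j e p Hp) by easy.
        replace (mean (fun z => p z * Cconj (A j z))%C) with (mean (fun z => p z * Cconj (V j z))%C); [ring|].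
        apply mean_ext; [easy|]. intros z _. unfold A. rewrite Ej. easy.
      * apply trig_mult; [apply trig_mult; easy|]. apply trig_conj, trig_plus, trig_scal; easy.
      * intros z _. unfold U. rewrite Cplus_conj, !Cmult_conj, Cconj_conj, Cr. ring.
  - intros e h b Hh Hb. assert (Th : trig h) by (eapply trig_poly; eassumption).
    assert (b0 := seminorm_le_nonneg _ _ _ Hh Hb).
    rewrite (mean_ext _ (fun z => h z * Cconj (g z) + r * (h z * Cconj (V a z * T z)))%C).
    + rewrite mean_plus, mean_scal by (try apply trig_scal; apply trig_mult, trig_conj; easy).
      eapply Rle_trans; [apply Cmod_triangle|]. rewrite Rmult_plus_distr_r.
      apply Rplus_le_compat; [apply (COST e); easy|].
      rewrite Cmod_mult, Cmod_R, Rabs_pos_eq by lra.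
      specialize (HT2 _ _ _ Hh Hb).
      apply Rle_trans with (r * (72 / eps * b * v a))%R.
      * apply Rmult_le_compat_l; [lra|]. eapply Rle_trans; [exact HT2|].
        apply Rmult_le_compat_l; [|apply NV]. apply Rmult_le_pos; [left; apply Rdiv_lt_0_compat; lra|easy].
      * right. unfold r, eps. field. lra.
    + apply trig_mult; [easy|]. apply trig_conj, trig_plus, trig_scal; easy.
    + intros z _. rewrite Cplus_conj, (Cmult_conj r), Cr. ring.
  - intros M0.
    assert (w'v' : forall j, (0 <= upd w a (2 * w a) j * v' j)%R).
    { intros j. apply Rmult_le_pos.
      - unfold upd. specialize (W1 j). destruct (Nat.eq_dec j a); lra.
      - unfold v'. destruct (HF j) as [F0 _]. specialize (v0 j) as vj. specialize (v0 a) as va.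
        assert (0 <= r * F j * v a)%R by (apply Rmult_le_pos; [apply Rmult_le_pos; lra|easy]).
        destruct (Nat.eq_dec j a); lra. }
    (* Lengthening the sum can only increase it, and ensures that the gain at index a is counted. *)
    set (M := (M0 + S a)%nat).
    apply Rle_trans with ((kappa + 216 * (w a * v a)) / 432 + rsum M (fun j => upd w a (2 * w a) j * v' j))%R.
    { apply Rplus_le_compat_l. apply rsum_mono; [easy|unfold M; lia]. }
    assert (va := v0 a). assert (wv : (v a <= w a * v a)%R) by nra.
    (* At a the weight doubles and the old defect shrinks to an eighth, so w_a v_a becomes w_a v_a /
       4 plus the new error. Elsewhere only the error appears; the factor 2 allows for the doubled
       weight. *)
    assert (SUM : (rsum M (fun j => upd w a (2 * w a) j * v' j) <=
       rsum M (fun j => w j * v j) + rsum M (fun j => if Nat.eq_dec j a then - (3/4 * (w a * v a)) else 0)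
       + (2 * r * v a) * rsum M (fun j => w j * F j))%R).
    { rewrite <- rsum_scal, <- !rsum_plus. apply rsum_le. intros j _. unfold upd, v'.
      destruct (HF j) as [F0 _]. specialize (v0 j) as vj. specialize (W1 j) as wj.
      destruct (Nat.eq_dec j a) as [->|]; [right; field|].
      assert (0 <= r * F j * v a)%R by (apply Rmult_le_pos; [apply Rmult_le_pos; lra|easy]). nra. }
    rewrite rsum_delta in SUM. destruct (lt_dec a M) as [_|Ha]; [|unfold M in Ha; lia].
    specialize (HB M). specialize (POT M).
    assert (L : (2 * r * v a * rsum M (fun j => w j * F j) <= 1 / 4 * (w a * v a))%R).
    { apply Rle_trans with (2 * r * v a * B)%R.
      - apply Rmult_le_compat_l; [|easy]. apply Rmult_le_pos; lra.
      - replace (2 * r * v a * B)%R with (2 * v a * (B / R0))%R by (unfold r; field; lra).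
        apply Rle_trans with (2 * v a * (1 / 8))%R; [apply Rmult_le_compat_l; lra|lra]. }
    lra.
Qed.

(** Pair the sum with the g of index i: the pairing costs at most kappa b, and each defect at most
    the norm of p_j times v_j. The potential bound contains both kappa <= 432 and v_j <= 1/w_j. *)
Lemma stage_functional f w (p : nat -> C -> C) m i b : stage f w -> (i < m)%nat ->
  (forall j, exists e, poly e (p j)) -> seminorm_le (fun z => csum m (fun j => p j z * f j z))%C b ->
  (Cmod (p i 0) <= 432 * b + rsum m (fun j => l2norm (p j) * / w j))%R.
Proof.
  intros (d & J & Pf & _ & W1 & AD) Hi Pp Hb.
  destruct (AD i) as (g & V & v & kappa & Pg & PV & NV & K0 & DUAL & COST & POT).
  assert (v0 := almost_dual_nonneg V v NV).
  assert (Tg : trig g) by (eapply trig_poly; eassumption).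
  assert (TV : forall j, trig (V j)) by (intros j; eapply trig_poly; apply PV).
  assert (Tf : forall j, trig (f j)) by (intros j; eapply trig_poly; apply Pf).
  assert (Tp : forall j, trig (p j)) by (intros j; destruct (Pp j) as [e He]; eapply trig_poly; apply He).
  set (h := fun z => csum m (fun j => p j z * f j z)).
  assert (Ph : exists e, poly e h).
  { clear - Pp Pf. unfold h. induction m as [|m [e IH]]; simpl.
    - exists O; apply poly_cst.
    - destruct (Pp m) as [e' He']. exists (e + (e' + d))%nat. apply poly_plus.
      + apply poly_mono with e; [easy|lia].
      + apply poly_mono with (e' + d)%nat; [apply poly_mult; easy|lia]. }
  destruct Ph as [e Ph]. assert (b0 := seminorm_le_nonneg _ _ _ Ph Hb).
  specialize (COST e h b Ph Hb).
  assert (EH : mean (fun z => h z * Cconj (g z))%C = p i 0 - csum m (fun j => mean (fun z => p j z * Cconj (V j z))%C)).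
  { rewrite (mean_ext _ (fun z => csum m (fun j => p j z * f j z * Cconj (g z)))%C).
    - rewrite mean_csum.
      + rewrite (csum_ext m _ (fun j => delta i j * p j 0 + (-(1)) * mean (fun z => p j z * Cconj (V j z))%C)).
        * rewrite csum_plus, csum_scal.
          replace (csum m (fun k => delta i k * p k 0)) with (p i 0); [ring|].
          assert (G : forall n, csum n (fun k => delta i k * p k 0) = if lt_dec i n then p i 0 else 0).
          { induction n as [|n IH]; simpl csum.
            - destruct (lt_dec i 0); [lia|easy].
            - rewrite IH. unfold delta. destruct (lt_dec i n), (lt_dec i (S n)), (Nat.eq_dec n i); subst; try lia; ring. }
          rewrite G. destruct (lt_dec i m); [easy|lia].
        * intros j Hj. destruct (Pp j) as [e' He']. rewrite (DUAL j e' _ He'). ring.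
      + intros j _. apply trig_mult; [apply trig_mult; easy|apply trig_conj; easy].
    - apply trig_mult; [eapply trig_poly; eassumption|apply trig_conj; easy].
    - intros z _. unfold h. rewrite Cmult_comm, <- csum_scal. apply csum_ext; intros; ring. }
  replace (p i 0) with (mean (fun z => h z * Cconj (g z))%C + csum m (fun j => mean (fun z => p j z * Cconj (V j z))%C)) by (rewrite EH; ring).
  eapply Rle_trans; [apply Cmod_triangle|]. apply Rplus_le_compat.
  - eapply Rle_trans; [exact COST|]. apply Rmult_le_compat_r; [easy|].
    specialize (POT O). simpl in POT. lra.
  - eapply Rle_trans; [apply Cmod_csum|]. apply rsum_le. intros j _.
    eapply Rle_trans; [apply mean_nrm; easy|]. apply Rmult_le_compat_l; [apply l2norm_nonneg|].
    eapply Rle_trans; [apply NV|]. specialize (POT (S j)). simpl in POT.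
    assert (0 <= rsum j (fun j => w j * v j))%R.
    { apply (rsum_mono O j); [|lia]. intros k. specialize (W1 k). specialize (v0 k). apply Rmult_le_pos; lra. }
    specialize (W1 j). assert (w j * v j <= 1)%R by lra.
    apply Rmult_le_reg_l with (w j); [lra|]. rewrite Rinv_r by lra. easy.
Qed.

(** * The Bloch space *)

Definition analytic (f : C -> C) : Prop := forall z, (Cmod z < 1)%R -> exists l, cderiv f z l.

(** A real upper bound for the Bloch norm with analyticity included. It avoids suprema in [Rbar];
    the translation is made by [Bloch_iff], [norm_le_bloch_norm] and [bloch_norm_bn]. *)
Definition norm_le (f : C -> C) (x : R) : Prop :=
  analytic f /\ exists b, seminorm_le f b /\ (Cmod (f 0) + b <= x)%R.

Lemma analytic_C_derive f z : analytic f -> (Cmod z < 1)%R -> cderiv f z (C_derive f z).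
Proof.
  intros H Hz. destruct (H z Hz) as [l Hl].
  assert (K := proj1 (cderiv_is_derive _ _ _) Hl). apply is_C_derive_unique in K. rewrite K; easy.
Qed.

Lemma analytic_iff f : analytic f <-> analytic_on_disk f.
Proof.
  split; intros H z Hz; destruct (H z Hz) as [l Hl]; exists l; apply cderiv_is_derive; easy.
Qed.

Lemma analytic_poly d P : poly d P -> analytic P.
Proof. intros H z _. destruct (poly_cderiv _ _ H) as (P' & _ & D). exists (P' z); auto. Qed.

Lemma analytic_plus f g : analytic f -> analytic g -> analytic (fun z => f z + g z)%C.
Proof. intros H K z Hz. destruct (H z Hz), (K z Hz). eexists; apply cderiv_plus; eassumption. Qed.

Lemma analytic_scal c f : analytic f -> analytic (fun z => c * f z)%C.
Proof. intros H z Hz. destruct (H z Hz). eexists; apply cderiv_scal; eassumption. Qed.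

Lemma analytic_id_mult f : analytic f -> analytic (fun z => z * f z)%C.
Proof. intros H z Hz. destruct (H z Hz). eexists; apply cderiv_id_mult; eassumption. Qed.

Lemma analytic_ext f g : (forall z, f z = g z) -> analytic f -> analytic g.
Proof. intros H K z Hz. destruct (K z Hz) as [l Hl]. exists l. eapply cderiv_ext; eassumption. Qed.

Lemma weight_pos z : (Cmod z < 1)%R -> (0 < 1 - Cmod z ^ 2 <= 1)%R.
Proof. intros H. pose proof (Cmod_ge_0 z). simpl; nra. Qed.

Lemma seminorm_le_ge_0 f b : analytic f -> seminorm_le f b -> (0 <= b)%R.
Proof.
  intros H K. destruct (H 0) as [l Hl]; [rewrite Cmod_0; lra|].
  specialize (K 0 l ltac:(rewrite Cmod_0; lra) Hl). rewrite Cmod_0 in K. pose proof (Cmod_ge_0 l). lra.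
Qed.

Lemma seminorm_le_plus f g a b : analytic f -> analytic g -> seminorm_le f a -> seminorm_le g b -> seminorm_le (fun z => f z + g z)%C (a + b).
Proof.
  intros Af Ag H K z l Hz Hl. destruct (Af z Hz) as [m Hm], (Ag z Hz) as [n Hn].
  rewrite (cderiv_unique _ _ _ _ Hl (cderiv_plus _ _ _ _ _ Hm Hn)).
  specialize (H z m Hz Hm). specialize (K z n Hz Hn). pose proof (weight_pos z Hz).
  eapply Rle_trans; [apply Rmult_le_compat_l; [lra|apply Cmod_triangle]|]. lra.
Qed.

Lemma seminorm_le_scal c f a : analytic f -> seminorm_le f a -> seminorm_le (fun z => c * f z)%C (Cmod c * a).
Proof.
  intros Af H z l Hz Hl. destruct (Af z Hz) as [m Hm].
  rewrite (cderiv_unique _ _ _ _ Hl (cderiv_scal c _ _ _ Hm)), Cmod_mult.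
  specialize (H z m Hz Hm).
  replace ((1 - Cmod z ^ 2) * (Cmod c * Cmod m))%R with (Cmod c * ((1 - Cmod z ^ 2) * Cmod m))%R by ring.
  apply Rmult_le_compat_l; [apply Cmod_ge_0|easy].
Qed.

Lemma seminorm_le_mono f a b : seminorm_le f a -> (a <= b)%R -> seminorm_le f b.
Proof. intros H Hab z l Hz Hl. eapply Rle_trans; [apply H|]; easy. Qed.

Lemma norm_le_mono f x y : norm_le f x -> (x <= y)%R -> norm_le f y.
Proof. intros (A & b & B & K) H. split; [easy|]. exists b; split; [easy|lra]. Qed.

Lemma norm_le_ext f g x : (forall z, f z = g z) -> norm_le f x -> norm_le g x.
Proof.
  intros H (A & b & B & K). split; [eapply analytic_ext; eassumption|].
  exists b. split; [eapply seminorm_le_ext; eassumption|]. rewrite <- H; easy.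
Qed.

Lemma norm_le_plus f g x y : norm_le f x -> norm_le g y -> norm_le (fun z => f z + g z)%C (x + y).
Proof.
  intros (A & b & B & K) (A' & b' & B' & K'). split; [apply analytic_plus; easy|].
  exists (b + b')%R. split; [apply seminorm_le_plus; easy|].
  pose proof (Cmod_triangle (f 0) (g 0)). lra.
Qed.

Lemma norm_le_scal c f x : norm_le f x -> norm_le (fun z => c * f z)%C (Cmod c * x).
Proof.
  intros (A & b & B & K). split; [apply analytic_scal; easy|].
  exists (Cmod c * b)%R. split; [apply seminorm_le_scal; easy|].
  rewrite Cmod_mult, <- Rmult_plus_distr_l. apply Rmult_le_compat_l; [apply Cmod_ge_0|easy].
Qed.

Lemma norm_le_opp f x : norm_le f x -> norm_le (fun z => - f z)%C x.
Proof.
  intros H. apply (norm_le_scal (-(1))) in H. rewrite Cmod_m1, Rmult_1_l in H.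
  eapply norm_le_ext; [|exact H]. intros z; cbv beta; ring.
Qed.

Lemma norm_le_minus f g x y : norm_le f x -> norm_le g y -> norm_le (fun z => f z - g z)%C (x + y).
Proof. intros H K. apply (norm_le_plus _ _ _ _ H (norm_le_opp _ _ K)). Qed.

Lemma norm_le_nonneg f x : norm_le f x -> (0 <= x)%R.
Proof.
  intros (A & b & B & K). pose proof (seminorm_le_ge_0 _ _ A B). pose proof (Cmod_ge_0 (f 0)). lra.
Qed.

Lemma norm_le_zero : norm_le (fun _ => RtoC 0) 0.
Proof.
  split; [apply (analytic_poly O), poly_cst|]. exists 0%R. split; [|rewrite Cmod_0; lra].
  intros z l _ Hl. rewrite (cderiv_unique _ _ _ _ Hl (cderiv_const 0 z)), Cmod_0. lra.
Qed.

Lemma norm_le_poly d P : poly d P -> exists x, norm_le P x.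
Proof.
  intros H. destruct (poly_cderiv _ _ H) as (P' & HP' & D). destruct (poly_bound _ _ HP') as (B & HB & K).
  exists (Cmod (P 0) + B)%R. split; [eapply analytic_poly; eassumption|].
  exists B. split; [|lra]. intros z l Hz Hl. rewrite (cderiv_unique _ _ _ _ Hl (D z)).
  specialize (K z ltac:(lra)). pose proof (weight_pos z Hz). pose proof (Cmod_ge_0 (P' z)). nra.
Qed.

Lemma bloch_seminorm_le f b : analytic f -> seminorm_le f b -> Rbar_le (bloch_seminorm f) b.
Proof.
  intros A H. unfold bloch_seminorm. apply (proj2 (Lub_Rbar_correct _)).
  intros r (z & Hz & ->). apply H; [exact Hz|]. apply analytic_C_derive; easy.
Qed.

Lemma bloch_seminorm_ge f b : Rbar_le (bloch_seminorm f) (Finite b) -> seminorm_le f b.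
Proof.
  intros H z l Hz Hl.
  assert (K : Rbar_le ((1 - Cmod z ^ 2) * Cmod l)%R (bloch_seminorm f)).
  { apply (proj1 (Lub_Rbar_correct _)). exists z. split; [exact Hz|]. f_equal. f_equal.
    symmetry; apply is_C_derive_unique, cderiv_is_derive; easy. }
  exact (Rbar_le_trans _ _ _ K H).
Qed.

(** The set of values is nonempty, as 0 lies in the disk. So a seminorm that is not [p_infty] is a
    real number. *)
Lemma bloch_seminorm_not_m f : bloch_seminorm f <> m_infty.
Proof.
  intros H. destruct (Lub_Rbar_correct (fun r : R => exists z : C,
    unit_disk z /\ r = ((1 - (Cmod z) ^ 2) * Cmod (C_derive f z))%R)) as [U _].
  unfold bloch_seminorm in H. rewrite H in U.
  refine (U _ _). exists 0. split; [unfold unit_disk; rewrite Cmod_0; lra|reflexivity].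
Qed.

Lemma norm_le_bloch_norm f x eps : norm_le f x -> (x < eps)%R -> Rbar_lt (bloch_norm f) (Finite eps).
Proof.
  intros (A & b & B & K) H. apply bloch_seminorm_le in B; [|easy]. unfold bloch_norm.
  pose proof (bloch_seminorm_not_m f) as N.
  destruct (bloch_seminorm f) as [s| |]; simpl in *; try easy. lra.
Qed.

Lemma bloch_norm_bn f eps : analytic f -> Rbar_lt (bloch_norm f) (Finite eps) -> norm_le f eps.
Proof.
  intros A H. split; [easy|]. unfold bloch_norm in H.
  pose proof (bloch_seminorm_not_m f) as N.
  destruct (bloch_seminorm f) as [s| |] eqn:Hs; simpl in H; try easy.
  exists s. split; [|lra]. apply bloch_seminorm_ge. rewrite Hs. apply Rbar_le_refl.
Qed.

Lemma Bloch_iff f : Bloch f <-> exists x, norm_le f x.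
Proof.
  split.
  - intros [A H]. apply analytic_iff in A. pose proof (bloch_seminorm_not_m f) as N.
    destruct (bloch_seminorm f) as [s| |] eqn:Hs; try easy.
    exists (Cmod (f 0) + s)%R. split; [easy|]. exists s. split; [|lra].
    apply bloch_seminorm_ge. rewrite Hs. apply Rbar_le_refl.
  - intros (x & A & b & B & K). split; [apply analytic_iff; easy|].
    apply bloch_seminorm_le in B; [|easy].
    eapply Rbar_le_lt_trans; [exact B|easy].
Qed.

Lemma closure_iff (A : (C -> C) -> Prop) f : (forall g, A g -> analytic g) ->
  bloch_closure A f <-> (exists x, norm_le f x) /\ forall eps, (0 < eps)%R -> exists g, A g /\ norm_le (fun z => f z - g z)%C eps.
Proof.
  intros HA. split.
  - intros [H K]. apply Bloch_iff in H. split; [easy|]. intros eps Heps.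
    destruct (K eps Heps) as (g & Ag & Hg). exists g. split; [easy|].
    apply bloch_norm_bn in Hg; [exact Hg|]. destruct H as [x [H _]].
    apply (analytic_ext (fun z => f z + (-(1)) * g z)%C); [intros; unfold fminus; ring|].
    apply analytic_plus, analytic_scal; auto.
  - intros [H K]. split; [apply Bloch_iff; easy|]. intros eps Heps.
    (* Halving compensates for [norm_le] being non-strict while the closure asks for a strict
       inequality. *)
    destruct (K (eps / 2)%R) as (g & Ag & Hg); [lra|]. exists g. split; [easy|].
    eapply norm_le_bloch_norm; [exact Hg|lra].
Qed.

(** * Growth, completeness and division by the variable *)

(** The mean value theorem needs a real function of a real variable; u selects the direction in
    which the complex increment is measured. *)
Lemma cderiv_segment f z w t l u : cderiv f (z + RtoC t * (w - z)) l ->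
  is_derive (fun s : R => Re (u * f (z + RtoC s * (w - z)))) t (Re (u * (l * (w - z)))).
Proof.
  intros H. apply is_derive_Reals. intros eps Heps.
  pose proof (Cmod_ge_0 (w - z)) as W0. pose proof (Cmod_ge_0 u) as U0.
  assert (P : (0 < (Cmod u + 1) * (Cmod (w - z) + 1))%R) by (apply Rmult_lt_0_compat; lra).
  destruct (H (eps / 2 / ((Cmod u + 1) * (Cmod (w - z) + 1)))%R) as (d & Hd & K).
  { apply Rdiv_lt_0_compat; lra. }
  assert (D0 : (0 < d / (Cmod (w - z) + 1))%R) by (apply Rdiv_lt_0_compat; lra).
  exists (mkposreal _ D0). intros h Hh0 Hh. simpl in Hh.
  set (p := z + RtoC t * (w - z)) in *. 
  assert (EP : z + RtoC (t + h) * (w - z) = p + RtoC h * (w - z)) by (unfold p; rewrite RtoC_plus; ring).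
  rewrite EP. specialize (K (p + RtoC h * (w - z))).
  replace (p + RtoC h * (w - z) - p) with (RtoC h * (w - z)) in K by ring.
  rewrite Cmod_mult, Cmod_R in K.
  assert (Hd1 : (Rabs h * Cmod (w - z) < d)%R).
  { pose proof (Rabs_pos h). apply Rle_lt_trans with (Rabs h * (Cmod (w - z) + 1))%R; [nra|].
    apply Rmult_lt_reg_r with (/ (Cmod (w - z) + 1))%R; [apply Rinv_0_lt_compat; lra|].
    rewrite Rmult_assoc, Rinv_r by lra. unfold Rdiv in Hh. lra. }
  specialize (K Hd1).
  set (e := f (p + RtoC h * (w - z)) - f p - l * (RtoC h * (w - z))) in *.
  assert (Q : (Re (u * f (p + RtoC h * (w - z)))%C - Re (u * f p)%C = Re (u * e)%C + h * Re (u * (l * (w - z)))%C)%R).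
  { rewrite <- Re_Rscal. unfold e.
    replace (Re (u * f (p + RtoC h * (w - z)))) with
      (Re (u * (f (p + RtoC h * (w - z)) - f p - l * (RtoC h * (w - z))) + (RtoC h * (u * (l * (w - z))) + u * f p))) by (f_equal; ring).
    rewrite !Re_plus. ring. }
  rewrite Q. replace ((Re (u * e)%C + h * Re (u * (l * (w - z)))%C) / h - Re (u * (l * (w - z)))%C)%R with (Re (u * e)%C / h)%R by (field; easy).
  unfold Rdiv. rewrite Rabs_mult, Rabs_inv.
  assert (hp : (0 < Rabs h)%R) by (apply Rabs_pos_lt; easy).
  apply Rmult_lt_reg_r with (Rabs h); [easy|]. rewrite Rmult_assoc, Rinv_l, Rmult_1_r by lra.
  eapply Rle_lt_trans; [apply re_le_Cmod|]. rewrite Cmod_mult.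
  apply Rle_lt_trans with ((Cmod u + 1) * (eps / 2 / ((Cmod u + 1) * (Cmod (w - z) + 1)) * (Rabs h * (Cmod (w - z) + 1))))%R.
  - apply Rmult_le_compat; [easy|apply Cmod_ge_0|lra|]. eapply Rle_trans; [exact K|].
    apply Rmult_le_compat_l; [left; apply Rdiv_lt_0_compat; lra|]. apply Rmult_le_compat_l; lra.
  - replace ((Cmod u + 1) * (eps / 2 / ((Cmod u + 1) * (Cmod (w - z) + 1)) * (Rabs h * (Cmod (w - z) + 1))))%R with (eps / 2 * Rabs h)%R by (field; lra).
    apply Rmult_lt_compat_r; lra.
Qed.

Lemma bloch_lipschitz f b r z w : analytic f -> seminorm_le f b -> (r < 1)%R -> (Cmod z <= r)%R -> (Cmod w <= r)%R ->
  (Cmod (f w - f z) <= b / (1 - r ^ 2) * Cmod (w - z))%R.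
Proof.
  intros A B Hr Hz Hw. assert (b0 := seminorm_le_ge_0 _ _ A B).
  pose proof (Cmod_ge_0 z) as z0.
  assert (R1 : (0 < 1 - r ^ 2)%R) by (simpl; nra).
  assert (SEG : forall t, (0 <= t <= 1)%R -> (Cmod (z + RtoC t * (w - z)) <= r)%R).
  { intros t Ht. replace (z + RtoC t * (w - z)) with (RtoC (1 - t) * z + RtoC t * w) by (rewrite RtoC_minus; ring).
    eapply Rle_trans; [apply Cmod_triangle|]. rewrite !Cmod_mult, !Cmod_R, !Rabs_pos_eq by lra. nra. }
  (* With this u the increment of Re (u f) along the segment is |f w - f z|^2, and one factor
     cancels at the end. *)
  set (u := Cconj (f w - f z)).
  set (D := fun t => Re (u * (C_derive f (z + RtoC t * (w - z)) * (w - z)))).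
  assert (DER : forall t, (0 <= t <= 1)%R -> is_derive (fun s : R => Re (u * f (z + RtoC s * (w - z)))) t (D t)).
  { intros t Ht. apply cderiv_segment, analytic_C_derive; [easy|]. specialize (SEG t Ht). lra. }
  destruct (MVT_gen (fun s : R => Re (u * f (z + RtoC s * (w - z)))) 0 1 D) as (c & Hc & EQ).
  - intros t Ht. rewrite Rmin_left, Rmax_right in Ht by lra. apply DER; lra.
  - intros t Ht. rewrite Rmin_left, Rmax_right in Ht by lra.
    apply derivable_continuous_pt. exists (D t). apply is_derive_Reals, DER; lra.
  - rewrite Rmin_left, Rmax_right in Hc by lra. cbv beta in EQ.
    replace (z + RtoC 1 * (w - z)) with w in EQ by ring.
    replace (z + RtoC 0 * (w - z)) with z in EQ by ring.
    set (M := (b / (1 - r ^ 2) * Cmod (w - z))%R).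
    assert (M0 : (0 <= M)%R) by (apply Rmult_le_pos; [apply Rdiv_le_0_compat; lra|apply Cmod_ge_0]).
    assert (LHS : (Re (u * f w) - Re (u * f z) = Cmod (f w - f z) ^ 2)%R).
    { rewrite <- Re_RtoC, <- Cmult_conj_sqr. fold u.
      replace ((f w - f z) * u) with (u * f w + RtoC (-1) * (u * f z)) by ring.
      rewrite Re_plus, Re_Rscal. ring. }
    rewrite LHS in EQ.
    assert (DM : (Cmod (C_derive f (z + RtoC c * (w - z))) <= b / (1 - r ^ 2))%R).
    { set (q := z + RtoC c * (w - z)) in *. assert (Hq : (Cmod q <= r)%R) by (apply SEG; easy).
      assert (Hq1 : (Cmod q < 1)%R) by lra.
      specialize (B q _ Hq1 (analytic_C_derive f q A Hq1)).
      pose proof (Cmod_ge_0 q). pose proof (Cmod_ge_0 (C_derive f q)).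
      apply Rmult_le_reg_l with (1 - r ^ 2)%R; [easy|].
      replace ((1 - r ^ 2) * (b / (1 - r ^ 2)))%R with b by (field; lra).
      eapply Rle_trans; [|exact B]. apply Rmult_le_compat_r; [easy|]. simpl; nra. }
    assert (DB : (D c <= Cmod (f w - f z) * M)%R).
    { unfold D. eapply Rle_trans; [apply Rle_abs|]. eapply Rle_trans; [apply re_le_Cmod|].
      rewrite !Cmod_mult. unfold u. rewrite Cmod_conj. apply Rmult_le_compat_l; [apply Cmod_ge_0|].
      apply Rmult_le_compat_r; [apply Cmod_ge_0|easy]. }
    pose proof (Cmod_ge_0 (f w - f z)) as X0. set (X := Cmod (f w - f z)) in *.
    destruct (Rle_lt_dec X M) as [|HX]; [easy|]. exfalso. nra.
Qed.

(** Much weaker than the logarithmic growth of Bloch functions, but enough to bound point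
    evaluations and the shift. *)
Lemma bloch_growth f b z : analytic f -> seminorm_le f b -> (Cmod z < 1)%R ->
  ((1 - Cmod z ^ 2) * Cmod (f z - f 0) <= b * Cmod z)%R.
Proof.
  intros A B Hz. pose proof (Cmod_ge_0 z). pose proof (weight_pos z Hz).
  pose proof (bloch_lipschitz f b (Cmod z) 0 z A B Hz ltac:(rewrite Cmod_0; easy) ltac:(lra)) as K.
  replace (z - 0) with z in K by ring.
  apply Rle_trans with ((1 - Cmod z ^ 2) * (b / (1 - Cmod z ^ 2) * Cmod z))%R.
  - apply Rmult_le_compat_l; lra.
  - right; field; lra.
Qed.

Lemma norm_le_value f x z : norm_le f x -> (Cmod z < 1)%R -> ((1 - Cmod z ^ 2) * Cmod (f z) <= x)%R.
Proof.
  intros (A & b & B & K) Hz. pose proof (bloch_growth f b z A B Hz) as G.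
  pose proof (weight_pos z Hz). pose proof (seminorm_le_ge_0 _ _ A B). pose proof (Cmod_ge_0 (f 0)).
  replace (f z) with (f z - f 0 + f 0) by ring.
  apply Rle_trans with ((1 - Cmod z ^ 2) * (Cmod (f z - f 0) + Cmod (f 0)))%R.
  - apply Rmult_le_compat_l; [lra|apply Cmod_triangle].
  - nra.
Qed.

Lemma norm_le_shift f x : norm_le f x -> norm_le (fun z => z * f z)%C (2 * x).
Proof.
  intros H. assert (H' := H). destruct H' as (A & b & B & K). split; [apply analytic_id_mult; easy|].
  exists (2 * x)%R. split.
  - intros z l Hz Hl. destruct (A z Hz) as [m Hm].
    rewrite (cderiv_unique _ _ _ _ Hl (cderiv_id_mult _ _ _ Hm)).
    pose proof (norm_le_value f x z H Hz). specialize (B z m Hz Hm). pose proof (weight_pos z Hz).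
    pose proof (Cmod_ge_0 (f 0)). pose proof (Cmod_ge_0 m). pose proof (Cmod_ge_0 z).
    apply Rle_trans with ((1 - Cmod z ^ 2) * (Cmod (f z) + Cmod z * Cmod m))%R.
    + apply Rmult_le_compat_l; [lra|]. rewrite <- Cmod_mult. apply Cmod_triangle.
    + assert ((1 - Cmod z ^ 2) * (Cmod z * Cmod m) <= (1 - Cmod z ^ 2) * Cmod m)%R; [|lra].
      apply Rmult_le_compat_l; [lra|]. nra.
  - replace (0 * f 0) with (RtoC 0) by ring. rewrite Cmod_0. lra.
Qed.

Lemma norm_le_poly_mult d p : poly d p -> exists K, (0 <= K)%R /\ forall f x, norm_le f x -> norm_le (fun z => p z * f z)%C (K * x).
Proof.
  induction 1.
  - exists (Cmod c). split; [apply Cmod_ge_0|]. intros f x H0. eapply norm_le_ext; [|apply norm_le_scal; exact H0].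
    intros z; cbv beta; rewrite H; easy.
  - destruct IHpoly as (K & HK & IH). exists (Cmod c + 2 * K)%R.
    split; [pose proof (Cmod_ge_0 c); lra|]. intros f x Hf.
    apply norm_le_ext with (fun z => c * f z + z * (Q z * f z))%C; [intros z; rewrite H0; ring|].
    replace ((Cmod c + 2 * K) * x)%R with (Cmod c * x + 2 * (K * x))%R by ring.
    apply norm_le_plus; [apply norm_le_scal; easy|]. apply norm_le_shift, IH; easy.
Qed.

Definition clim (a : nat -> C) (l : C) : Prop :=
  forall eps : R, (0 < eps)%R -> exists n0, forall n, (n0 <= n)%nat -> (Cmod (a n - l) <= eps)%R.

Lemma C_complete (a : nat -> C) :
  (forall eps : R, (0 < eps)%R -> exists n0, forall m n, (n0 <= m)%nat -> (n0 <= n)%nat -> (Cmod (a m - a n) <= eps)%R) ->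
  exists l, clim a l.
Proof.
  intros H.
  assert (CR : forall g : C -> R, (forall x y : C, (Rabs (g x - g y) <= Cmod (x - y))%R) -> exists l, Un_cv (fun n => g (a n)) l).
  { intros g Hg. destruct (Rcomplete.R_complete (fun n => g (a n))) as [l Hl].
    - intros eps Heps. destruct (H (eps / 2)%R ltac:(lra)) as [n0 Hn0]. exists n0.
      intros m n Hm Hn. unfold Rdist. eapply Rle_lt_trans; [apply Hg|].
      eapply Rle_lt_trans; [apply Hn0; easy|lra].
    - exists l; easy. }
  destruct (CR Re) as [x Hx].
  { intros p q. replace (Re p - Re q)%R with (Re (p - q)) by (unfold Re; simpl; ring). apply re_le_Cmod. }
  destruct (CR Im) as [y Hy].
  { intros p q. replace (Im p - Im q)%R with (Im (p - q)) by (unfold Im; simpl; ring).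
    eapply Rle_trans; [|apply Rmax_Cmod]. apply Rmax_r. }
  exists (x, y). intros eps Heps. destruct (Hx (eps / 2)%R ltac:(lra)) as [n1 H1].
  destruct (Hy (eps / 2)%R ltac:(lra)) as [n2 H2]. exists (n1 + n2)%nat. intros n Hn.
  specialize (H1 n ltac:(lia)). specialize (H2 n ltac:(lia)). unfold Rdist in *.
  replace (a n - (x, y)) with (RtoC (Re (a n) - x) + Ci * RtoC (Im (a n) - y)).
  - eapply Rle_trans; [apply Cmod_triangle|]. rewrite Cmod_mult, !Cmod_R, Cmod_Ci. lra.
  - apply injective_projections; unfold Re, Im; simpl; ring.
Qed.

Lemma clim_bound a l c K n0 : clim a l -> (forall n, (n0 <= n)%nat -> (Cmod (a n - c) <= K)%R) -> (Cmod (l - c) <= K)%R.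
Proof.
  intros H B. apply Rnot_lt_le. intros L.
  destruct (H ((Cmod (l - c) - K) / 2)%R ltac:(lra)) as [n1 H1].
  specialize (H1 (n0 + n1)%nat ltac:(lia)). specialize (B (n0 + n1)%nat ltac:(lia)).
  assert (T : (Cmod (l - c) <= Cmod (a (n0 + n1)%nat - l) + Cmod (a (n0 + n1)%nat - c))%R).
  { replace (l - c) with (- (a (n0 + n1)%nat - l) + (a (n0 + n1)%nat - c)) by ring.
    eapply Rle_trans; [apply Cmod_triangle|]. rewrite Cmod_opp. lra. }
  lra.
Qed.

Lemma clim_minus a b l m : clim a l -> clim b m -> clim (fun n => a n - b n) (l - m).
Proof.
  intros H K eps Heps. destruct (H (eps / 2)%R ltac:(lra)) as [n1 H1], (K (eps / 2)%R ltac:(lra)) as [n2 H2].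
  exists (n1 + n2)%nat. intros n Hn. specialize (H1 n ltac:(lia)). specialize (H2 n ltac:(lia)).
  replace (a n - b n - (l - m)) with ((a n - l) + - (b n - m)) by ring.
  eapply Rle_trans; [apply Cmod_triangle|]. rewrite Cmod_opp. lra.
Qed.

(** Functions and derivatives converge pointwise because both evaluations are bounded. That the
    second limit is the derivative of the first follows from the Lipschitz bound on a smaller disk,
    with no appeal to Cauchy's formula. *)
Lemma bloch_complete (u : nat -> C -> C) :
  (forall n, exists x, norm_le (u n) x) ->
  (forall eps, (0 < eps)%R -> exists n0, forall m n, (n0 <= m)%nat -> (n0 <= n)%nat -> norm_le (fun z => u m z - u n z)%C eps) ->
  exists f, (exists x, norm_le f x) /\
    forall eps, (0 < eps)%R -> exists n0, forall n, (n0 <= n)%nat -> norm_le (fun z => f z - u n z)%C eps.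
Proof.
  intros HU HC.
  assert (AU : forall n, analytic (u n)) by (intros n; destruct (HU n) as [x [A _]]; easy).
  assert (DU : forall n z, (Cmod z < 1)%R -> cderiv (u n) z (C_derive (u n) z)) by (intros; apply analytic_C_derive; auto).
  assert (DD : forall m n z, (Cmod z < 1)%R -> cderiv (fun w => u m w - u n w)%C z (C_derive (u m) z - C_derive (u n) z)).
  { intros m n z Hz. apply cderiv_ext with (fun w => u m w + (-(1)) * u n w)%C; [intros; ring|].
    replace (C_derive (u m) z - C_derive (u n) z) with (C_derive (u m) z + (-(1)) * C_derive (u n) z) by ring.
    apply cderiv_plus, cderiv_scal; auto. }
  destruct (choice_fun C C (fun z l => (Cmod z < 1)%R -> clim (fun n => u n z) l)) as [f Hf].
  { intros z. destruct (Rlt_le_dec (Cmod z) 1) as [Hz|Hz]; [|exists 0; intros; lra].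
    pose proof (weight_pos z Hz) as W.
    destruct (C_complete (fun n => u n z)) as [l Hl]; [|exists l; easy].
    intros eps Heps. destruct (HC ((1 - Cmod z ^ 2) * eps)%R) as [n0 Hn0]; [apply Rmult_lt_0_compat; lra|].
    exists n0. intros m n Hm Hn. pose proof (norm_le_value _ _ z (Hn0 m n Hm Hn) Hz) as V.
    apply Rmult_le_reg_l with (1 - Cmod z ^ 2)%R; lra. }
  assert (BD : forall eps, (0 < eps)%R -> exists n0, forall m n z, (n0 <= m)%nat -> (n0 <= n)%nat -> (Cmod z < 1)%R ->
      ((1 - Cmod z ^ 2) * Cmod (C_derive (u m) z - C_derive (u n) z) <= eps)%R).
  { intros eps Heps. destruct (HC eps Heps) as [n0 Hn0]. exists n0. intros m n z Hm Hn Hz.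
    destruct (Hn0 m n Hm Hn) as (A & b & B & K). specialize (B z _ Hz (DD m n z Hz)).
    pose proof (Cmod_ge_0 (u m 0 - u n 0)). lra. }
  destruct (choice_fun C C (fun z l => (Cmod z < 1)%R -> clim (fun n => C_derive (u n) z) l)) as [G HG].
  { intros z. destruct (Rlt_le_dec (Cmod z) 1) as [Hz|Hz]; [|exists 0; intros; lra].
    pose proof (weight_pos z Hz) as W.
    destruct (C_complete (fun n => C_derive (u n) z)) as [l Hl]; [|exists l; easy].
    intros eps Heps. destruct (BD ((1 - Cmod z ^ 2) * eps)%R) as [n0 Hn0]; [apply Rmult_lt_0_compat; lra|].
    exists n0. intros m n Hm Hn. specialize (Hn0 m n z Hm Hn Hz).
    apply Rmult_le_reg_l with (1 - Cmod z ^ 2)%R; lra. }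
  assert (GB : forall eps, (0 < eps)%R -> exists n0, forall n z, (n0 <= n)%nat -> (Cmod z < 1)%R ->
      ((1 - Cmod z ^ 2) * Cmod (G z - C_derive (u n) z) <= eps)%R).
  { intros eps Heps. destruct (BD eps Heps) as [n0 Hn0]. exists n0. intros n z Hn Hz.
    pose proof (weight_pos z Hz) as W.
    apply Rmult_le_reg_l with (/ (1 - Cmod z ^ 2))%R; [apply Rinv_0_lt_compat; lra|].
    rewrite <- Rmult_assoc, Rinv_l, Rmult_1_l by lra.
    apply (clim_bound _ _ _ _ n0 (HG z Hz)). intros m Hm. specialize (Hn0 m n z Hm Hn Hz).
    apply Rmult_le_reg_l with (1 - Cmod z ^ 2)%R; [lra|]. rewrite <- Rmult_assoc, Rinv_r; lra. }
  assert (DF : forall z, (Cmod z < 1)%R -> cderiv f z (G z)).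
  { intros z Hz eps Heps. set (r := ((1 + Cmod z) / 2)%R). pose proof (Cmod_ge_0 z).
    assert (Hr : (Cmod z < r < 1)%R) by (unfold r; lra).
    assert (R1 : (0 < 1 - r ^ 2)%R) by (simpl; nra).
    pose proof (weight_pos z Hz) as W.
    destruct (HC (eps / 3 * (1 - r ^ 2))%R) as [n1 H1]; [apply Rmult_lt_0_compat; lra|].
    destruct (GB (eps / 3 * (1 - Cmod z ^ 2))%R) as [n2 H2]; [apply Rmult_lt_0_compat; lra|].
    set (N := (n1 + n2)%nat).
    destruct (DU N z Hz (eps / 3)%R ltac:(lra)) as (d & Hd & KD).
    exists (Rmin d (r - Cmod z)). split; [apply Rmin_glb_lt; lra|]. intros w Hw.
    assert (Hwd : (Cmod (w - z) < d)%R) by (eapply Rlt_le_trans; [exact Hw|apply Rmin_l]).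
    assert (Hwr : (Cmod (w - z) < r - Cmod z)%R) by (eapply Rlt_le_trans; [exact Hw|apply Rmin_r]).
    assert (Hwr' : (Cmod w <= r)%R).
    { replace w with (w - z + z) by ring. eapply Rle_trans; [apply Cmod_triangle|]. lra. }
    specialize (KD w Hwd). specialize (H2 N z ltac:(unfold N; lia) Hz).
    assert (X2 : (Cmod (G z - C_derive (u N) z) <= eps / 3)%R).
    { apply Rmult_le_reg_l with (1 - Cmod z ^ 2)%R; lra. }
    (* The Lipschitz bound for u_m - u_N is uniform in m, so it survives the passage to the limit in
       m. *)
    assert (X1 : (Cmod ((f w - f z) - (u N w - u N z)) <= eps / 3 * Cmod (w - z))%R).
    { apply (clim_bound (fun n => u n w - u n z)%C _ _ _ N); [apply clim_minus; apply Hf; lra|].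
      intros m Hm. destruct (H1 m N ltac:(unfold N in *; lia) ltac:(unfold N; lia)) as (A & b & B & K).
      replace (u m w - u m z - (u N w - u N z)) with ((u m w - u N w) - (u m z - u N z)) by ring.
      eapply Rle_trans; [apply (bloch_lipschitz (fun z => u m z - u N z)%C b r z w A B); lra|].
      apply Rmult_le_compat_r; [apply Cmod_ge_0|].
      pose proof (Cmod_ge_0 (u m 0 - u N 0)).
      apply Rmult_le_reg_r with (1 - r ^ 2)%R; [easy|].
      replace (b / (1 - r ^ 2) * (1 - r ^ 2))%R with b by (field; lra). lra. }
    replace (f w - f z - G z * (w - z)) with
      (((f w - f z) - (u N w - u N z)) + ((u N w - u N z - C_derive (u N) z * (w - z)) + - ((G z - C_derive (u N) z) * (w - z)))) by ring.
    eapply Rle_trans; [apply Cmod_triangle|].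
    eapply Rle_trans; [apply Rplus_le_compat_l, Cmod_triangle|]. rewrite Cmod_opp, Cmod_mult.
    assert ((Cmod (G z - C_derive (u N) z) * Cmod (w - z) <= eps / 3 * Cmod (w - z))%R) by (apply Rmult_le_compat_r; [apply Cmod_ge_0|easy]).
    lra. }
  assert (AF : analytic f) by (intros z Hz; exists (G z); auto).
  assert (CV : forall eps, (0 < eps)%R -> exists n0, forall n, (n0 <= n)%nat -> norm_le (fun z => f z - u n z)%C eps).
  { intros eps Heps. destruct (GB (eps / 2)%R ltac:(lra)) as [n1 H1].
    assert (Z1 : (Cmod 0 < 1)%R) by (rewrite Cmod_0; lra).
    destruct (Hf 0 Z1 (eps / 2)%R ltac:(lra)) as [n2 H2].
    exists (n1 + n2)%nat. intros n Hn. split.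
    - apply analytic_ext with (fun z => f z + (-(1)) * u n z)%C; [intros; ring|].
      apply analytic_plus, analytic_scal; auto.
    - exists (eps / 2)%R. split.
      + intros z l Hz Hl. 
        assert (DL : cderiv (fun w => f w - u n w)%C z (G z - C_derive (u n) z)).
        { apply cderiv_ext with (fun w => f w + (-(1)) * u n w)%C; [intros; ring|].
          replace (G z - C_derive (u n) z) with (G z + (-(1)) * C_derive (u n) z) by ring.
          apply cderiv_plus, cderiv_scal; auto. }
        rewrite (cderiv_unique _ _ _ _ Hl DL). apply H1; [lia|easy].
      + specialize (H2 n ltac:(lia)).
        replace (f 0 - u n 0) with (- (u n 0 - f 0)) by ring. rewrite Cmod_opp. lra. }
  exists f. split; [|easy].
  destruct (CV 1%R ltac:(lra)) as [n Hn]. specialize (Hn n ltac:(lia)). destruct (HU n) as [x Hx].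
  exists (1 + x)%R. eapply norm_le_ext; [|apply (norm_le_plus _ _ _ _ Hn Hx)]. intros z; cbv beta; ring.
Qed.

Lemma geom_rsum n : (rsum n (fun k => (2 / 3) ^ k) <= 3)%R.
Proof.
  assert (H : (rsum n (fun k => (2 / 3) ^ k) = 3 * (1 - (2 / 3) ^ n))%R).
  { induction n as [|n IH]; simpl; [ring|]. rewrite IH. field. }
  rewrite H. assert (0 <= (2 / 3) ^ n)%R by (apply pow_le; lra). lra.
Qed.

(** The shift is bounded below. For |z| <= 1/2, where dividing by z is costly, the coefficients of z
    h are read off the circle of radius 3/4; for |z| > 1/2 one uses z h' = (z h)' - h. The value at
    0 takes 4 b and the seminorm 13 b. *)
Lemma poly_division_bound d h b : poly d h -> seminorm_le (fun z => z * h z)%C b -> norm_le h (17 * b).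
Proof.
  intros Ph Hb. destruct (poly_as_psum _ _ (S d) Ph) as [a Ha]; [lia|].
  set (N := S d) in *. set (a' := fun k => match k with O => RtoC 0 | S k => a k end).
  assert (HZ : forall z, z * h z = psum (S N) a' z).
  { intros z. unfold psum. rewrite csum_shift, Ha. unfold psum. rewrite <- csum_scal. simpl Cpow. unfold a' at 1.
    rewrite Cmult_0_l, Cplus_0_l. apply csum_ext; intros; unfold a'; ring. }
  assert (Hb' := seminorm_le_ext _ _ _ HZ Hb).
  pose proof (bloch_coefs_nrm _ _ _ (3/4) Hb' ltac:(lra)) as NB.
  assert (b0 : (0 <= b)%R) by (eapply seminorm_le_nonneg; [apply poly_psum|exact Hb']).
  assert (CO : forall k, (k < N)%nat -> (INR (S k) * Cmod (a k) <= 16/7 * b * (4/3) ^ S k)%R).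
  { intros k Hk.
    pose proof (coef_le_nrm (S N) (fun k => RtoC (INR k * (3 / 4) ^ k) * a' k)%C (S k) ltac:(lia)) as L.
    cbv beta in L.
    assert (P34 : (0 < (3/4) ^ S k)%R) by (apply pow_lt; lra).
    rewrite Cmod_mult, Cmod_R, Rabs_pos_eq in L by (apply Rmult_le_pos; [apply pos_INR|lra]).
    simpl a' in L.
    apply Rmult_le_reg_r with ((3/4) ^ S k)%R; [easy|].
    rewrite (Rmult_assoc (16 / 7 * b)), <- Rpow_mult_distr.
    replace (4 / 3 * (3 / 4))%R with 1%R by field. rewrite pow1, Rmult_1_r.
    replace (16 / 7 * b)%R with (b / (1 - (3 / 4) ^ 2))%R by field.
    eapply Rle_trans; [|exact NB]. eapply Rle_trans; [|exact L]. right; ring. }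
  assert (A0 : (Cmod (h 0) <= 4 * b)%R).
  { rewrite Ha. unfold psum, N. rewrite csum_shift, csum_0.
    - specialize (CO O ltac:(unfold N; lia)). simpl in CO. replace (a 0%nat * 0 ^ 0 + 0) with (a 0%nat) by (simpl; ring). lra.
    - intros; simpl; ring. }
  split; [eapply analytic_poly; eassumption|]. exists (13 * b)%R. split; [|lra].
  intros z l Hz Hl. pose proof (weight_pos z Hz) as W. pose proof (Cmod_ge_0 z) as z0. pose proof (Cmod_ge_0 l) as l0.
  destruct (Rle_lt_dec (Cmod z) (1/2)) as [Hz2|Hz2].
  - assert (Hl' := cderiv_ext _ _ _ _ Ha Hl). rewrite (cderiv_unique _ _ _ _ Hl' (cderiv_psum N a z)) in *.
    set (l' := csum N _) in *.
    assert (LB : (Cmod l' <= 13 * b)%R).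
    { unfold l'. eapply Rle_trans; [apply Cmod_csum|].
      (* The factor 16/7 is 1 / (1 - (3/4)^2), the ratio 2/3 is 4/3 times 1/2, and the total 16/7 *
         16/9 * 3 is below 13. *)
      apply Rle_trans with (rsum N (fun k => 16/7 * b * (16/9) * match k with O => 0 | S k => (2/3) ^ k end))%R.
      - apply rsum_le. intros [|k] Hk.
        + rewrite !Cmod_mult. simpl INR. rewrite Cmod_0. lra.
        + specialize (CO (S k) Hk). rewrite !Cmod_mult, Cmod_R, Rabs_pos_eq, Cmod_pow by apply pos_INR.
          simpl pred.
          assert (Z1 : (0 <= Cmod z ^ k <= (1/2) ^ k)%R) by (split; [apply pow_le; easy|apply pow_incr; lra]).
          assert (A1 : (INR (S k) * Cmod (a (S k)) <= 16/7 * b * (4/3) ^ S (S k))%R).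
          { eapply Rle_trans; [|exact CO]. apply Rmult_le_compat_r; [apply Cmod_ge_0|]. rewrite (S_INR (S k)); lra. }
          apply Rle_trans with (16/7 * b * (4/3) ^ S (S k) * (1/2) ^ k)%R.
          * apply Rmult_le_compat; [apply Rmult_le_pos; [apply pos_INR|apply Cmod_ge_0]|apply Z1|easy|apply Z1].
          * right. simpl. replace (2/3)%R with (4/3 * (1/2))%R by field. rewrite Rpow_mult_distr. field.
      - rewrite rsum_scal.
        assert (GS : (rsum N (fun k => match k with O => 0 | S k => (2/3) ^ k end) <= 3)%R).
        { eapply Rle_trans; [|apply (geom_rsum N)]. clear.
          assert (G : forall n, (rsum (S n) (fun k => match k with O => 0 | S k => (2/3) ^ k end) = rsum n (fun k => (2/3) ^ k))%R).
          { induction n as [|n IH]; [simpl; ring|]. change (rsum (S (S n)) ?F) with (rsum (S n) F + F (S n))%R. rewrite IH. simpl; ring. }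
          destruct N as [|N]; [simpl; lra|]. rewrite G. apply rsum_mono; [|lia]. intros; apply pow_le; lra. }
        apply Rle_trans with (16 / 7 * b * (16 / 9) * 3)%R; [apply Rmult_le_compat_l; [lra|easy]|lra]. }
    pose proof (Cmod_ge_0 l'). nra.
  - assert (AZ : analytic (fun z => z * h z)%C) by (apply analytic_id_mult; eapply analytic_poly; eassumption).
    pose proof (bloch_growth _ _ z AZ Hb Hz) as GZ. cbv beta in GZ.
    replace (z * h z - 0 * h 0) with (z * h z) in GZ by ring. rewrite Cmod_mult in GZ.
    specialize (Hb z _ Hz (cderiv_id_mult _ _ _ Hl)).
    assert (HH : ((1 - Cmod z ^ 2) * Cmod (h z) <= b)%R).
    { apply Rmult_le_reg_r with (Cmod z); [lra|]. lra. }
    assert (ZL : ((1 - Cmod z ^ 2) * (Cmod z * Cmod l) <= 2 * b)%R).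
    { rewrite <- Cmod_mult. replace (z * l) with ((h z + z * l) + - h z) by ring.
      apply Rle_trans with ((1 - Cmod z ^ 2) * (Cmod (h z + z * l) + Cmod (h z)))%R; [|lra].
      apply Rmult_le_compat_l; [lra|]. eapply Rle_trans; [apply Cmod_triangle|]. rewrite Cmod_opp; lra. }
    assert (0 <= (1 - Cmod z ^ 2) * Cmod l)%R by (apply Rmult_le_pos; lra). nra.
Qed.

(** Apply the bound for polynomials to an approximant at distance b/35: b/35 + 17 (b + 2 b/35) is
    exactly 18 b. *)
Lemma division_bound k b : (0 < b)%R ->
  (forall eps, (0 < eps)%R -> exists d P, poly d P /\ norm_le (fun z => k z - P z)%C eps) ->
  seminorm_le (fun z => z * k z)%C b -> norm_le k (18 * b).
Proof.
  intros Hb HP H. destruct (HP (b / 35)%R ltac:(lra)) as (d & P & PP & BP).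
  assert (Ak : analytic k).
  { destruct BP as [A _]. apply analytic_ext with (fun z => (k z - P z) + P z)%C; [intros; ring|].
    apply analytic_plus; [easy|eapply analytic_poly; eassumption]. }
  assert (SB := norm_le_shift _ _ BP). destruct SB as (AS & bs & BS & KS).
  pose proof (Cmod_ge_0 (0 * (k 0 - P 0))).
  assert (BZ : seminorm_le (fun z => z * P z)%C (b + 2 * (b / 35))).
  { apply seminorm_le_mono with (b + Cmod (-(1)) * bs)%R; [|rewrite Cmod_m1; lra].
    apply seminorm_le_ext with (fun z => z * k z + (-(1)) * (z * (k z - P z)))%C; [intros; ring|].
    apply seminorm_le_plus; [apply analytic_id_mult; easy|apply analytic_scal; easy|easy|apply seminorm_le_scal; easy]. }
  pose proof (poly_division_bound _ _ _ PP BZ) as DB.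
  apply norm_le_mono with (b / 35 + 17 * (b + 2 * (b / 35)))%R; [|lra].
  eapply norm_le_ext; [|apply (norm_le_plus _ _ _ _ BP DB)]. intros z; cbv beta; ring.
Qed.

(** * The generators *)

(* Takes every value infinitely often: [schedule (2 ^ k + j) = j] for [j < 2 ^ k]. *)
Definition schedule (n : nat) : nat := (n - 2 ^ Nat.log2 n)%nat.

Lemma schedule_surj j n : exists m, (n <= m)%nat /\ schedule m = j.
Proof.
  exists (2 ^ (n + j) + j)%nat. pose proof (Nat.pow_gt_lin_r 2 (n + j) ltac:(lia)) as H.
  split; [lia|]. unfold schedule.
  rewrite (Nat.log2_unique (2 ^ (n + j) + j) (n + j)); [lia|lia|]. simpl. lia.
Qed.

Definition stage_pair : Type := {s : (nat -> C -> C) * (nat -> R) | stage (fst s) (snd s)}.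

(** A step on f_j changes it by at most 1/w_j and doubles w_j, so the change is the drop of 2/w_j.
    Written thus the increments telescope, and no count of the steps is needed. *)
Lemma generators_sequence : exists (f : nat -> nat -> C -> C) (w : nat -> nat -> R),
  (forall n, stage (f n) (w n)) /\
  (forall n j, norm_le (fun z => f (S n) j z - f n j z)%C (2 * / w n j - 2 * / w (S n) j)) /\
  (forall j B, exists n0, forall n, (n0 <= n)%nat -> (B <= w n j)%R).
Proof.
  destruct (choice_fun (nat * stage_pair) stage_pair (fun x y => exists phi,
     fst (proj1_sig y) = upd (fst (proj1_sig (snd x))) (schedule (fst x)) (fun z => fst (proj1_sig (snd x)) (schedule (fst x)) z + phi z)%C /\
     snd (proj1_sig y) = upd (snd (proj1_sig (snd x))) (schedule (fst x)) (2 * snd (proj1_sig (snd x)) (schedule (fst x)))%R /\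
     phi 0 = 0 /\ seminorm_le phi (/ snd (proj1_sig (snd x)) (schedule (fst x))) /\ exists d, poly d phi)) as [next Hnext].
  { intros [n [[f w] Hs]]. destruct (stage_step f w (schedule n) Hs) as (phi & S1 & S2 & S3 & S4).
    exists (exist _ (upd f (schedule n) (fun z => f (schedule n) z + phi z)%C, upd w (schedule n) (2 * w (schedule n))%R) S1).
    exists phi. easy. }
  set (st := fix st n := match n with
    | O => exist (fun s => stage (fst s) (snd s)) (fun _ _ => RtoC 0, fun _ => 1%R) stage_init
    | S n => next (n, st n) end).
  set (f := fun n => fst (proj1_sig (st n))). set (w := fun n => snd (proj1_sig (st n))).
  assert (ST : forall n, stage (f n) (w n)) by (intros n; exact (proj2_sig (st n))).
  assert (NX : forall n, exists phi,
     f (S n) = upd (f n) (schedule n) (fun z => f n (schedule n) z + phi z)%C /\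
     w (S n) = upd (w n) (schedule n) (2 * w n (schedule n))%R /\
     phi 0 = 0 /\ seminorm_le phi (/ w n (schedule n)) /\ exists d, poly d phi).
  { intros n. exact (Hnext (n, st n)). }
  assert (W1 : forall n j, (1 <= w n j)%R).
  { intros n j. destruct (ST n) as (d & J & _ & _ & H & _). apply H. }
  exists f, w. split; [easy|]. split.
  - intros n j. destruct (NX n) as (phi & F1 & F2 & P0 & PB & d & PP). rewrite F1, F2. unfold upd.
    specialize (W1 n j). destruct (Nat.eq_dec j (schedule n)) as [->|].
    + set (j := schedule n) in *. replace (2 * / w n j - 2 * / (2 * w n j))%R with (/ w n j)%R by (field; lra).
      apply norm_le_ext with phi; [intros; cbv beta; ring|]. split; [eapply analytic_poly; eassumption|].
      exists (/ w n j)%R. split; [easy|]. rewrite P0, Cmod_0. lra.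
    + replace (2 * / w n j - 2 * / w n j)%R with 0%R by ring.
      eapply norm_le_ext; [|apply norm_le_zero]. intros z; cbv beta; ring.
  - intros j.
    assert (MON : forall n m, (n <= m)%nat -> (w n j <= w m j)%R).
    { intros n m H; induction H as [|m H IH]; [lra|]. destruct (NX m) as (phi & _ & F2 & _). rewrite F2.
      unfold upd. specialize (W1 m j). destruct (Nat.eq_dec j (schedule m)) as [->|]; lra. }
    assert (POW : forall k, exists n, (INR k <= w n j)%R).
    { induction k as [|k [n Hn]].
      - exists O. specialize (W1 O j). simpl; lra.
      - destruct (schedule_surj j n) as (m & Hm & Hj). exists (S m).
        destruct (NX m) as (phi & _ & F2 & _). rewrite F2, Hj. unfold upd.
        destruct (Nat.eq_dec j j); [|easy]. specialize (MON n m Hm). specialize (W1 m j). rewrite S_INR. lra. }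
    intros B. destruct (nfloor_ex (Rmax B 0)) as (k & _ & Hk); [apply Rmax_r|].
    destruct (POW (S k)) as [n Hn]. exists n. intros m Hm. specialize (MON n m Hm).
    rewrite S_INR in Hn. pose proof (Rmax_l B 0). lra.
Qed.

Definition polynomial (p : C -> C) : Prop := exists d, poly d p.

Lemma csum_bn m (h : nat -> C -> C) (x : nat -> R) : (forall j, (j < m)%nat -> norm_le (h j) (x j)) ->
  norm_le (fun z => csum m (fun j => h j z))%C (rsum m x).
Proof.
  induction m as [|m IH]; intros H; simpl; [apply norm_le_zero|]. apply norm_le_plus; auto.
Qed.

(** For fixed p both errors vanish in the limit: multiplication by p_j is bounded, so the p_j (f_j -
    f_{n,j}) tend to 0, and the norms of p_j divided by w_j tend to 0. The constant 432 is the same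
    at every stage. *)
Lemma generators : exists f : nat -> C -> C,
  (forall j eps, (0 < eps)%R -> exists P, polynomial P /\ norm_le (fun z => f j z - P z)%C eps) /\
  forall (p : nat -> C -> C) m i x, (i < m)%nat -> (forall j, polynomial (p j)) ->
    norm_le (fun z => csum m (fun j => p j z * f j z))%C x -> (Cmod (p i 0%R) <= 432 * x)%R.
Proof.
  destruct generators_sequence as (f & w & ST & INC & WINF).
  assert (W1 : forall n j, (1 <= w n j)%R).
  { intros n j. destruct (ST n) as (d & J & _ & _ & H & _). apply H. }
  assert (PF : forall n j, polynomial (f n j)).
  { intros n j. destruct (ST n) as (d & J & H & _). exists d; apply H. }
  assert (INC' : forall j n m, (n <= m)%nat -> norm_le (fun z => f m j z - f n j z)%C (2 * / w n j - 2 * / w m j)).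
  { intros j n m H; induction H as [|m H IH].
    - replace (2 * / w n j - 2 * / w n j)%R with 0%R by ring. eapply norm_le_ext; [|apply norm_le_zero]. intros; cbv beta; ring.
    - replace (2 * / w n j - 2 * / w (S m) j)%R with ((2 * / w n j - 2 * / w m j) + (2 * / w m j - 2 * / w (S m) j))%R by ring.
      eapply norm_le_ext; [|apply (norm_le_plus _ _ _ _ IH (INC m j))]. intros; cbv beta; ring. }
  assert (WINV : forall j eps, (0 < eps)%R -> exists n0, forall n, (n0 <= n)%nat -> (/ w n j <= eps)%R).
  { intros j eps Heps. destruct (WINF j (/ eps)%R) as [n0 H]. exists n0. intros n Hn. specialize (H n Hn).
    rewrite <- (Rinv_inv eps). apply Rinv_le_contravar; [apply Rinv_0_lt_compat; easy|easy]. }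
  destruct (choice_fun nat (C -> C) (fun j g => forall eps, (0 < eps)%R -> exists n0, forall n, (n0 <= n)%nat -> norm_le (fun z => g z - f n j z)%C eps)) as [g Hg].
  { intros j. destruct (bloch_complete (fun n => f n j)) as (g & _ & Hg).
    - intros n. destruct (PF n j) as [d Hd]. apply (norm_le_poly d); easy.
    - intros eps Heps. destruct (WINV j (eps / 4)%R ltac:(lra)) as [n0 Hn0]. exists n0. intros m n Hm Hn.
      pose proof (INC' j n0 m Hm) as A. pose proof (INC' j n0 n Hn) as B.
      specialize (Hn0 n0 (le_n _)).
      assert (IP : forall k, (0 < / w k j)%R) by (intros k; apply Rinv_0_lt_compat; specialize (W1 k j); lra).
      pose proof (IP m). pose proof (IP n).
      apply norm_le_mono with ((2 * / w n0 j - 2 * / w m j) + (2 * / w n0 j - 2 * / w n j))%R; [|lra].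
      eapply norm_le_ext; [|apply (norm_le_minus _ _ _ _ A B)]. intros; cbv beta; ring.
    - exists g; easy. }
  exists g. split.
  - intros j eps Heps. destruct (Hg j eps Heps) as [n Hn]. exists (f n j). split; [apply PF|apply Hn; lia].
  - intros p m i x Hi Pp Hx.
    assert (AP : forall eps, (0 < eps)%R -> exists n0, forall n, (n0 <= n)%nat ->
        norm_le (fun z => csum m (fun j => p j z * (g j z - f n j z)))%C eps).
    { clear Hx Hi. induction m as [|m IH]; intros eps Heps.
      - exists O. intros n _. eapply norm_le_mono; [apply norm_le_zero|lra].
      - destruct (IH (eps / 2)%R ltac:(lra)) as [n1 H1].
        destruct (Pp m) as [d Hd]. destruct (norm_le_poly_mult _ _ Hd) as (K & K0 & HK).
        destruct (Hg m (eps / 2 / (K + 1))%R ltac:(apply Rdiv_lt_0_compat; lra)) as [n2 H2].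
        exists (n1 + n2)%nat. intros n Hn. simpl csum.
        apply norm_le_mono with (eps / 2 + K * (eps / 2 / (K + 1)))%R.
        + apply norm_le_plus; [apply H1; lia|]. apply HK, H2. lia.
        + assert (K * (eps / 2 / (K + 1)) <= (K + 1) * (eps / 2 / (K + 1)))%R.
          { apply Rmult_le_compat_r; [left; apply Rdiv_lt_0_compat; lra|lra]. }
          replace ((K + 1) * (eps / 2 / (K + 1)))%R with (eps / 2)%R in * by (field; lra). lra. }
    assert (RS : forall eps, (0 < eps)%R -> exists n0, forall n, (n0 <= n)%nat ->
        (rsum m (fun j => l2norm (p j) * / w n j) <= eps)%R).
    { clear Hx Hi AP. induction m as [|m IH]; intros eps Heps.
      - exists O. intros; simpl; lra.
      - destruct (IH (eps / 2)%R ltac:(lra)) as [n1 H1]. pose proof (l2norm_nonneg (p m)) as N0.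
        destruct (WINV m (eps / 2 / (l2norm (p m) + 1))%R ltac:(apply Rdiv_lt_0_compat; lra)) as [n2 H2].
        exists (n1 + n2)%nat. intros n Hn. simpl rsum. specialize (H1 n ltac:(lia)). specialize (H2 n ltac:(lia)).
        assert (l2norm (p m) * / w n m <= (l2norm (p m) + 1) * (eps / 2 / (l2norm (p m) + 1)))%R.
        { apply Rmult_le_compat; [easy|left; apply Rinv_0_lt_compat; specialize (W1 n m); lra|lra|easy]. }
        replace ((l2norm (p m) + 1) * (eps / 2 / (l2norm (p m) + 1)))%R with (eps / 2)%R in * by (field; lra). lra. }
    apply Rle_plus_epsilon. intros eps Heps.
    destruct (AP (eps / 864)%R ltac:(lra)) as [n1 H1]. destruct (RS (eps / 2)%R ltac:(lra)) as [n2 H2].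
    set (n := (n1 + n2)%nat). specialize (H1 n ltac:(unfold n; lia)). specialize (H2 n ltac:(unfold n; lia)).
    pose proof (norm_le_minus _ _ _ _ Hx H1) as (A & b & B & K). cbv beta in B, K.
    assert (EQ : forall z, csum m (fun j => p j z * g j z) - csum m (fun j => p j z * (g j z - f n j z)) = csum m (fun j => p j z * f n j z)).
    { intros z. replace (csum m (fun j => p j z * (g j z - f n j z))) with (csum m (fun j => p j z * g j z) + (-(1)) * csum m (fun j => p j z * f n j z)); [ring|].
      rewrite <- csum_scal, <- csum_plus. apply csum_ext; intros; cbv beta; ring. }
    apply (seminorm_le_ext _ _ _ EQ) in B. rewrite EQ in K.
    pose proof (stage_functional (f n) (w n) p m i b (ST n) Hi Pp B) as SF.
    pose proof (Cmod_ge_0 (csum m (fun j => p j 0 * f n j 0))). lra.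
Qed.

(** * Spans of finitely or infinitely many generators *)

Definition below (N : option nat) (j : nat) : Prop :=
  match N with Some n => (j < n)%nat | None => True end.

(** Coefficients are defined for all j and vanish outside the allowed range, so two combinations can
    be padded to a common length and added termwise. *)
Definition module_span (f : nat -> C -> C) (N : option nat) (h : C -> C) : Prop :=
  exists (m : nat) (p : nat -> C -> C), (forall j, polynomial (p j)) /\
    (forall j, ~ below N j \/ (m <= j)%nat -> forall z, p j z = 0) /\
    forall z, h z = csum m (fun j => p j z * f j z).

Lemma csum_pad m M (F : nat -> C) : (m <= M)%nat -> (forall j, (m <= j)%nat -> F j = 0) -> csum M F = csum m F.
Proof.
  intros H K; induction H as [|M H IH]; [easy|]. simpl. rewrite IH, K by easy. ring.
Qed.

Lemma polynomial_plus p q : polynomial p -> polynomial q -> polynomial (fun z => p z + q z)%C.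
Proof.
  intros [d H] [e K]. exists (d + e)%nat. apply poly_plus; eapply poly_mono; try eassumption; lia.
Qed.

Lemma polynomial_scal c p : polynomial p -> polynomial (fun z => c * p z)%C.
Proof. intros [d H]. exists d. apply poly_scal; easy. Qed.

Lemma polynomial_id_mult p : polynomial p -> polynomial (fun z => z * p z)%C.
Proof. intros [d H]. exists (S d). apply poly_id_mult; easy. Qed.

Lemma polynomial_const c : polynomial (fun _ => c).
Proof. exists O. apply poly_cst. Qed.

Section Span.

Variable f : nat -> C -> C.
Hypothesis f_approx : forall j eps, (0 < eps)%R -> exists P, polynomial P /\ norm_le (fun z => f j z - P z)%C eps.
Hypothesis f_dual : forall (p : nat -> C -> C) m i x, (i < m)%nat -> (forall j, polynomial (p j)) ->
    norm_le (fun z => csum m (fun j => p j z * f j z))%C x -> (Cmod (p i 0%R) <= 432 * x)%R.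

Variable N : option nat.

Notation span := (module_span f N).

Lemma span_zero : span (fun _ => RtoC 0).
Proof. exists O, (fun _ _ => RtoC 0). split; [intros; apply polynomial_const|easy]. Qed.

Lemma span_ext g h : (forall z, g z = h z) -> span g -> span h.
Proof. intros H (m & p & A & B & K). exists m, p. repeat split; auto. intros z. rewrite <- H; auto. Qed.

Lemma span_plus g h : span g -> span h -> span (fun z => g z + h z)%C.
Proof.
  intros (m & p & A & B & K) (n & q & A' & B' & K').
  exists (m + n)%nat, (fun j z => p j z + q j z). split; [|split].
  - intros; apply polynomial_plus; easy.
  - intros j Hj z. rewrite B, B'; [ring| |]; destruct Hj as [|Hj]; auto; right; lia.
  - intros z. rewrite K, K'.
    rewrite <- (csum_pad m (m + n) (fun j => p j z * f j z)); [|lia|intros; rewrite B by auto; ring].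
    rewrite <- (csum_pad n (m + n) (fun j => q j z * f j z)); [|lia|intros; rewrite B' by auto; ring].
    rewrite <- csum_plus. apply csum_ext; intros; cbv beta; ring.
Qed.

Lemma span_scal c h : span h -> span (fun z => c * h z)%C.
Proof.
  intros (m & p & A & B & K). exists m, (fun j z => c * p j z). split; [|split].
  - intros; apply polynomial_scal; easy.
  - intros j Hj z. rewrite B by easy. ring.
  - intros z. rewrite K, <- csum_scal. apply csum_ext; intros; cbv beta; ring.
Qed.

Lemma span_minus g h : span g -> span h -> span (fun z => g z - h z)%C.
Proof.
  intros H K. eapply span_ext; [|apply (span_plus _ _ H (span_scal (-(1)) _ K))].
  intros z; cbv beta; ring.
Qed.

Lemma span_shift h : span h -> span (fun z => z * h z)%C.
Proof.
  intros (m & p & A & B & K). exists m, (fun j z => z * p j z). split; [|split].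
  - intros; apply polynomial_id_mult; easy.
  - intros j Hj z. rewrite B by easy. ring.
  - intros z. rewrite K, <- csum_scal. apply csum_ext; intros; cbv beta; ring.
Qed.

Lemma span_generator j : below N j -> span (f j).
Proof.
  intros Hj. exists (S j), (fun i _ => if Nat.eq_dec i j then RtoC 1 else RtoC 0). split; [|split].
  - intros; apply polynomial_const.
  - intros i Hi z. destruct (Nat.eq_dec i j) as [->|]; [|easy]. destruct Hi; [easy|lia].
  - intros z. simpl. destruct (Nat.eq_dec j j); [|easy]. rewrite csum_0; [ring|].
    intros k Hk. destruct (Nat.eq_dec k j); [lia|ring].
Qed.

(** This places the span in the little Bloch space and supplies the approximation hypothesis of
    [division_bound]. *)
Lemma span_approx h eps : span h -> (0 < eps)%R -> exists P, polynomial P /\ norm_le (fun z => h z - P z)%C eps.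
Proof.
  intros (m & p & A & B & K). revert eps.
  assert (G : forall n eps, (0 < eps)%R -> exists P, polynomial P /\ norm_le (fun z => csum n (fun j => p j z * f j z) - P z)%C eps).
  { induction n as [|n IH]; intros eps Heps.
    - exists (fun _ => RtoC 0). split; [apply polynomial_const|]. apply norm_le_mono with 0%R; [|lra].
      eapply norm_le_ext; [|apply norm_le_zero]. intros; simpl; ring.
    - destruct (IH (eps / 2)%R ltac:(lra)) as (P & HP & KP). destruct (A n) as [d Hd].
      destruct (norm_le_poly_mult _ _ Hd) as (L & L0 & HL).
      destruct (f_approx n (eps / 2 / (L + 1))%R ltac:(apply Rdiv_lt_0_compat; lra)) as (Q & [e HQ] & KQ).
      exists (fun z => P z + p n z * Q z)%C. split.
      + apply polynomial_plus; [easy|]. exists (d + e)%nat. apply poly_mult; easy.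
      + apply norm_le_mono with (eps / 2 + L * (eps / 2 / (L + 1)))%R.
        * eapply norm_le_ext; [|apply (norm_le_plus _ _ _ _ KP (HL _ _ KQ))]. intros z; simpl; ring.
        * assert (L * (eps / 2 / (L + 1)) <= (L + 1) * (eps / 2 / (L + 1)))%R.
          { apply Rmult_le_compat_r; [left; apply Rdiv_lt_0_compat; lra|lra]. }
          replace ((L + 1) * (eps / 2 / (L + 1)))%R with (eps / 2)%R in * by (field; lra). lra. }
  intros eps Heps. destruct (G m eps Heps) as (P & HP & KP). exists P. split; [easy|].
  eapply norm_le_ext; [|exact KP]. intros z; cbv beta; rewrite K; easy.
Qed.

Lemma span_bn h : span h -> exists x, norm_le h x.
Proof.
  intros H. destruct (span_approx h 1 H ltac:(lra)) as (P & [d HP] & K).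
  destruct (norm_le_poly _ _ HP) as [x Hx]. exists (1 + x)%R.
  eapply norm_le_ext; [|apply (norm_le_plus _ _ _ _ K Hx)]. intros z; cbv beta; ring.
Qed.

Lemma span_analytic h : span h -> analytic h.
Proof. intros H. destruct (span_bn h H) as [x [A _]]. easy. Qed.

Definition span_closure : (C -> C) -> Prop := bloch_closure span.

Lemma span_closure_iff h : span_closure h <-> (exists x, norm_le h x) /\
  forall eps, (0 < eps)%R -> exists g, span g /\ norm_le (fun z => h z - g z)%C eps.
Proof. apply closure_iff, span_analytic. Qed.

Lemma span_closure_bn h : span_closure h -> exists x, norm_le h x.
Proof. intros H; apply span_closure_iff in H; apply H. Qed.

Lemma span_closure_analytic h : span_closure h -> analytic h.
Proof. intros H; apply span_closure_bn in H. destruct H as [x [A _]]; easy. Qed.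

Lemma span_in_closure h : span h -> span_closure h.
Proof.
  intros H. apply span_closure_iff. split; [apply span_bn; easy|]. intros eps Heps.
  exists h. split; [easy|]. apply norm_le_mono with 0%R; [|lra]. eapply norm_le_ext; [|apply norm_le_zero]. intros; cbv beta; ring.
Qed.

Lemma span_closure_plus g h : span_closure g -> span_closure h -> span_closure (fun z => g z + h z)%C.
Proof.
  intros Hg Hh. apply span_closure_iff in Hg, Hh. destruct Hg as [[x Hx] Kg], Hh as [[y Hy] Kh].
  apply span_closure_iff. split; [eexists; apply norm_le_plus; eassumption|]. intros eps Heps.
  destruct (Kg (eps / 2)%R ltac:(lra)) as (g' & Sg & Bg), (Kh (eps / 2)%R ltac:(lra)) as (h' & Sh & Bh).
  exists (fun z => g' z + h' z)%C. split; [apply span_plus; easy|].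
  replace eps with (eps / 2 + eps / 2)%R by field.
  eapply norm_le_ext; [|apply (norm_le_plus _ _ _ _ Bg Bh)]. intros z; cbv beta; ring.
Qed.

Lemma span_closure_scal c h : span_closure h -> span_closure (fun z => c * h z)%C.
Proof.
  intros Hh. apply span_closure_iff in Hh. destruct Hh as [[x Hx] Kh].
  apply span_closure_iff. split; [eexists; apply norm_le_scal; eassumption|]. intros eps Heps.
  pose proof (Cmod_ge_0 c) as C0.
  destruct (Kh (eps / (Cmod c + 1))%R ltac:(apply Rdiv_lt_0_compat; lra)) as (h' & Sh & Bh).
  exists (fun z => c * h' z)%C. split; [apply span_scal; easy|].
  apply norm_le_mono with (Cmod c * (eps / (Cmod c + 1)))%R.
  - eapply norm_le_ext; [|apply (norm_le_scal c _ _ Bh)]. intros z; cbv beta; ring.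
  - assert (Cmod c * (eps / (Cmod c + 1)) <= (Cmod c + 1) * (eps / (Cmod c + 1)))%R.
    { apply Rmult_le_compat_r; [left; apply Rdiv_lt_0_compat; lra|lra]. }
    replace ((Cmod c + 1) * (eps / (Cmod c + 1)))%R with eps in * by (field; lra). lra.
Qed.

Lemma span_closure_shift h : span_closure h -> span_closure (fun z => z * h z)%C.
Proof.
  intros Hh. apply span_closure_iff in Hh. destruct Hh as [[x Hx] Kh].
  apply span_closure_iff. split; [eexists; apply norm_le_shift; eassumption|]. intros eps Heps.
  destruct (Kh (eps / 2)%R ltac:(lra)) as (h' & Sh & Bh).
  exists (fun z => z * h' z)%C. split; [apply span_shift; easy|].
  replace eps with (2 * (eps / 2))%R by field.
  eapply norm_le_ext; [|apply (norm_le_shift _ _ Bh)]. intros z; cbv beta; ring.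
Qed.

Lemma poly_analytic_polynomial P : polynomial P -> analytic_polynomial P.
Proof.
  intros [d H]. destruct (poly_coefs _ _ H) as [a Ha]. exists d, a. intros z. rewrite Ha. clear.
  induction d as [|d IH].
  - rewrite sum_O. simpl; ring.
  - rewrite sum_Sn. rewrite <- IH. reflexivity.
Qed.

Lemma analytic_polynomial_analytic P : analytic_polynomial P -> analytic P.
Proof.
  intros (n & a & H). apply analytic_ext with (psum (S n) a).
  - intros z. rewrite H. unfold psum. clear. induction n as [|n IH].
    + rewrite sum_O. simpl; ring.
    + rewrite sum_Sn, <- IH. reflexivity.
  - eapply analytic_poly, poly_psum.
Qed.

Lemma span_closure_little_bloch h : span_closure h -> little_bloch h.
Proof.
  intros H. apply span_closure_iff in H. destruct H as [Hx K].
  apply closure_iff; [apply analytic_polynomial_analytic|]. split; [easy|]. intros eps Heps.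
  destruct (K (eps / 2)%R ltac:(lra)) as (g & Sg & Bg).
  destruct (span_approx g (eps / 2) Sg ltac:(lra)) as (P & HP & KP).
  exists P. split; [apply poly_analytic_polynomial; easy|].
  replace eps with (eps / 2 + eps / 2)%R by field.
  eapply norm_le_ext; [|apply (norm_le_plus _ _ _ _ Bg KP)]. intros z; cbv beta; ring.
Qed.

Lemma span_closure_closed : bloch_closed span_closure.
Proof.
  intros h H. apply closure_iff in H; [|apply span_closure_analytic]. destruct H as [Hx K].
  apply span_closure_iff. split; [easy|]. intros eps Heps.
  destruct (K (eps / 2)%R ltac:(lra)) as (g & Sg & Bg). apply span_closure_iff in Sg. destruct Sg as [_ Sg].
  destruct (Sg (eps / 2)%R ltac:(lra)) as (k & Sk & Bk). exists k. split; [easy|].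
  replace eps with (eps / 2 + eps / 2)%R by field.
  eapply norm_le_ext; [|apply (norm_le_plus _ _ _ _ Bg Bk)]. intros z; cbv beta; ring.
Qed.

Lemma span_closure_invariant : closed_shift_invariant_subspace span_closure.
Proof.
  split; [exact span_closure_little_bloch|]. split; [|split; [exact span_closure_closed|exact span_closure_shift]].
  split; [apply span_in_closure, span_zero|]. split; [exact span_closure_plus|intros; apply span_closure_scal; easy].
Qed.

(** If the combination is z g, approximate g by k in the span. Then z (g - k) is small and equals a
    combination of the f_j whose i-th coefficient has value c_i at 0, so [f_dual] forces |c_i| below
    any eps. *)
Lemma generators_independent m (c : nat -> C) : (forall j, (j < m)%nat -> below N j) ->
  shift_image span_closure (fun z => csum m (fun j => c j * f j z))%C -> forall i, (i < m)%nat -> c i = 0.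
Proof.
  intros Hm (g & Hg & EQ) i Hi. apply Cmod_eq_0. apply Rle_antisym; [|apply Cmod_ge_0].
  apply Rle_plus_epsilon. intros eps Heps. rewrite Rplus_0_l.
  apply span_closure_iff in Hg. destruct Hg as [_ Kg].
  destruct (Kg (eps / 864)%R ltac:(lra)) as (k & (n & p & A & B & K) & Bk).
  apply norm_le_shift in Bk.
  set (q := fun j z => (if lt_dec j m then c j else 0) + (-(1)) * (z * p j z)).
  assert (QF : norm_le (fun z => csum (m + n) (fun j => q j z * f j z))%C (2 * (eps / 864))).
  { destruct Bk as (Ak & b & Bb & Kb). 
    assert (EQ2 : forall z, (Cmod z < 1)%R -> z * (g z - k z) = csum (m + n) (fun j => q j z * f j z)).
    { intros z Hz. replace (z * (g z - k z)) with (z * g z + (-(1)) * (z * k z)) by ring.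
      change (z * g z) with (shift g z). rewrite <- (EQ z Hz), K.
      rewrite <- (csum_pad n (m + n) (fun j => p j z * f j z)); [|lia|intros; rewrite B by auto; ring].
      replace (csum m (fun j => c j * f j z)) with (csum m (fun j => (if lt_dec j m then c j else 0) * f j z)).
      - rewrite <- (csum_pad m (m + n) (fun j => (if lt_dec j m then c j else 0) * f j z)); [|lia|].
        + rewrite <- !csum_scal, <- csum_plus. apply csum_ext; intros; unfold q; ring.
        + intros j Hj. destruct (lt_dec j m); [lia|ring].
      - apply csum_ext; intros j Hj. destruct (lt_dec j m); [easy|lia]. }
    (* The two functions agree only on the disk, so derivatives are compared on a neighbourhood
       contained in it. *)
    assert (LOC : forall z l, (Cmod z < 1)%R -> cderiv (fun z => z * (g z - k z))%C z l <-> cderiv (fun z => csum (m + n) (fun j => q j z * f j z))%C z l).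
    { intros z l Hz.
      assert (IN : forall w, (Cmod (w - z) < 1 - Cmod z)%R -> (Cmod w < 1)%R).
      { intros w Hw. replace w with (w - z + z) by ring. eapply Rle_lt_trans; [apply Cmod_triangle|lra]. }
      split; intros D e He; destruct (D e He) as (d & Hd & KD); exists (Rmin d (1 - Cmod z)); (split; [apply Rmin_glb_lt; lra|]);
        intros w Hw; assert (Hw1 : (Cmod (w - z) < d)%R) by (eapply Rlt_le_trans; [exact Hw|apply Rmin_l]);
        assert (Hw2 : (Cmod w < 1)%R) by (apply IN; eapply Rlt_le_trans; [exact Hw|apply Rmin_r]);
        specialize (KD w Hw1); cbv beta in KD |- *.
      - rewrite <- !EQ2 by easy. exact KD.
      - rewrite !EQ2 by easy. exact KD. }
    split.
    - intros z Hz. destruct (Ak z Hz) as [l Hl]. exists l. apply LOC; easy.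
    - exists b. split.
      + intros z l Hz Hl. apply Bb; [easy|]. apply LOC; easy.
      + rewrite <- EQ2 by (rewrite Cmod_0; lra). exact Kb. }
  pose proof (f_dual q (m + n)%nat i (2 * (eps / 864))%R ltac:(lia)) as D. 
  assert (PQ : forall j, polynomial (q j)).
  { intros j. apply polynomial_plus; [apply polynomial_const|]. apply polynomial_scal, polynomial_id_mult, A. }
  specialize (D PQ QF). replace (q i 0) with (c i) in D; [lra|].
  unfold q. destruct (lt_dec i m); [ring|lia].
Qed.

Lemma polynomial_split p : polynomial p -> exists q, polynomial q /\ forall z, p z = p 0 + z * q z.
Proof.
  intros [d H]. inversion H; subst.
  - exists (fun _ => RtoC 0). split; [apply polynomial_const|]. intros z. rewrite !H0. ring.
  - exists Q. split; [eexists; eassumption|]. intros z. rewrite !H1. ring.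
Qed.

Lemma span_closure_sequence h : span_closure h -> exists u : nat -> C -> C, (forall n, span (u n)) /\
  forall eps, (0 < eps)%R -> exists n0, forall n, (n0 <= n)%nat -> norm_le (fun z => h z - u n z)%C eps.
Proof.
  intros H. apply span_closure_iff in H. destruct H as [_ H].
  destruct (choice_fun nat (C -> C) (fun n g => span g /\ norm_le (fun z => h z - g z)%C (/ INR (S n)))) as [u Hu].
  { intros n. apply H. apply Rinv_0_lt_compat, lt_0_INR; lia. }
  exists u. split; [intros n; apply Hu|]. intros eps Heps.
  destruct (nfloor_ex (/ eps)) as (n0 & _ & Hn0); [left; apply Rinv_0_lt_compat; easy|].
  exists n0. intros n Hn. eapply norm_le_mono; [apply Hu|].
  rewrite <- (Rinv_inv eps). apply Rinv_le_contravar; [apply Rinv_0_lt_compat; easy|].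
  rewrite S_INR. apply le_INR in Hn. lra.
Qed.

(** Approximate h by combinations with coefficients p_{k,j}. By [f_dual] the constant terms
    p_{k,j}(0) are Cauchy in k; removing them leaves z g_k, and the lower bound for the shift makes
    g_k Cauchy. Its limit G satisfies h - sum c_j f_j = z G. *)
Lemma generators_span n h : N = Some n -> span_closure h -> exists c : nat -> C,
  shift_image span_closure (fun z => h z - csum n (fun j => c j * f j z))%C.
Proof.
  intros EN Hh. destruct (span_closure_sequence h Hh) as (u & Su & Cu).
  assert (REP : forall k, exists p : nat -> C -> C, (forall j, polynomial (p j)) /\ forall z, u k z = csum n (fun j => p j z * f j z)).
  { intros k. destruct (Su k) as (m & p & A & B & K). exists p. split; [easy|]. intros z. rewrite K, EN in *.
    rewrite <- (csum_pad m (m + n) (fun j => p j z * f j z)); [|lia|intros; rewrite B by auto; ring].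
    apply csum_pad; [lia|]. intros j Hj. rewrite B; [ring|left; simpl; lia]. }
  apply choice_fun in REP. destruct REP as [p Hp].
  assert (DIFF : forall k l z, u k z - u l z = csum n (fun j => (p k j z - p l j z) * f j z)).
  { intros k l z. rewrite (proj2 (Hp k)), (proj2 (Hp l)).
    transitivity (csum n (fun j => p k j z * f j z) + (-(1)) * csum n (fun j => p l j z * f j z)); [ring|].
    rewrite <- csum_scal, <- csum_plus. apply csum_ext; intros; ring. }
  assert (CAU : forall eps, (0 < eps)%R -> exists n0, forall k l, (n0 <= k)%nat -> (n0 <= l)%nat -> norm_le (fun z => u k z - u l z)%C eps).
  { intros eps Heps. destruct (Cu (eps / 2)%R ltac:(lra)) as [n0 Hn0]. exists n0. intros k l Hk Hl.
    replace eps with (eps / 2 + eps / 2)%R by field.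
    eapply norm_le_ext; [|apply (norm_le_minus _ _ _ _ (Hn0 l Hl) (Hn0 k Hk))]. intros z; cbv beta; ring. }
  assert (PD : forall k l j, polynomial (fun z => p k j z - p l j z)%C).
  { intros k l j. destruct (polynomial_plus _ _ (proj1 (Hp k) j) (polynomial_scal (-(1)) _ (proj1 (Hp l) j))) as [d Hd].
    exists d. eapply poly_ext; [|exact Hd]. intros z; cbv beta; ring. }
  assert (CC : forall eps, (0 < eps)%R -> exists n0, forall k l j, (n0 <= k)%nat -> (n0 <= l)%nat -> (j < n)%nat ->
      (Cmod (p k j 0%R - p l j 0%R) <= eps)%R).
  { intros eps Heps. destruct (CAU (eps / 432)%R ltac:(lra)) as [n0 Hn0]. exists n0. intros k l j Hk Hl Hj.
    replace eps with (432 * (eps / 432))%R by field.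
    apply (f_dual (fun j z => p k j z - p l j z) n j _ Hj); [apply PD|].
    eapply norm_le_ext; [|apply (Hn0 k l Hk Hl)]. intros z; apply DIFF. }
  destruct (choice_fun nat C (fun j l => (j < n)%nat -> clim (fun k => p k j 0%R) l)) as [c Hc].
  { intros j. destruct (Nat.lt_ge_cases j n) as [Hj|Hj]; [|exists 0; intros; lia].
    destruct (C_complete (fun k => p k j 0%R)) as [l Hl]; [|exists l; easy].
    intros eps Heps. destruct (CC eps Heps) as [n0 Hn0]. exists n0. intros; apply Hn0; easy. }
  assert (CL : forall eps, (0 < eps)%R -> exists n0, forall k j, (n0 <= k)%nat -> (j < n)%nat -> (Cmod (c j - p k j 0%R) <= eps)%R).
  { intros eps Heps. destruct (CC eps Heps) as [n0 Hn0]. exists n0. intros k j Hk Hj.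
    apply (clim_bound _ _ _ _ n0 (Hc j Hj)). intros l Hl. apply Hn0; easy. }
  assert (FB : forall j, exists x, norm_le (f j) x).
  { intros j. destruct (f_approx j 1%R ltac:(lra)) as (P & [d HP] & K). destruct (norm_le_poly _ _ HP) as [x Hx].
    exists (1 + x)%R. eapply norm_le_ext; [|apply (norm_le_plus _ _ _ _ K Hx)]. intros z; cbv beta; ring. }
  apply choice_fun in FB. destruct FB as [X HX].
  assert (X0 : forall j, (0 <= X j)%R) by (intros j; eapply norm_le_nonneg; apply HX).
  set (Y := rsum n X). assert (Y0 : (0 <= Y)%R) by (apply (rsum_mono O n X); [easy|lia]).
  assert (SMALL : forall (d : nat -> C) e, (forall j, (j < n)%nat -> (Cmod (d j) <= e)%R) -> norm_le (fun z => csum n (fun j => d j * f j z))%C (e * Y)).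
  { intros d e Hd. unfold Y. rewrite <- rsum_scal. apply (csum_bn n (fun j z => d j * f j z) (fun j => e * X j)%R).
    intros j Hj. eapply norm_le_mono; [apply norm_le_scal, HX|]. apply Rmult_le_compat_r; [easy|auto]. }
  destruct (choice_fun (nat * nat) (C -> C) (fun kj q => polynomial q /\ forall z, p (fst kj) (snd kj) z = p (fst kj) (snd kj) 0%R + z * q z)) as [q Hq].
  { intros [k j]. apply polynomial_split, Hp. }
  set (g := fun k z => csum n (fun j => q (k, j) z * f j z)).
  assert (Sg : forall k, span (g k)).
  { intros k. exists n, (fun j z => if lt_dec j n then q (k, j) z else 0). split; [|split].
    - intros j. destruct (lt_dec j n); [apply Hq|apply polynomial_const].
    - intros j Hj z. destruct (lt_dec j n); [|easy]. rewrite EN in Hj. simpl in Hj. lia.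
    - intros z. apply csum_ext; intros j Hj. destruct (lt_dec j n); [easy|lia]. }
  assert (ZG : forall k z, z * g k z = u k z - csum n (fun j => p k j 0%R * f j z)).
  { intros k z. rewrite (proj2 (Hp k)). unfold g. rewrite <- csum_scal.
    transitivity (csum n (fun j => p k j z * f j z) + (-(1)) * csum n (fun j => p k j 0%R * f j z)); [|ring].
    rewrite <- csum_scal, <- csum_plus. apply csum_ext; intros j _.
    destruct (Hq (k, j)) as [_ K]. simpl in K. rewrite (K z). ring. }
  destruct (bloch_complete g) as (G & [xG HG] & CG).
  { intros k. apply span_bn, Sg. }
  { intros eps Heps.
    destruct (CAU (eps / 36)%R ltac:(lra)) as [n1 H1].
    destruct (CC (eps / 36 / (Y + 1))%R ltac:(apply Rdiv_lt_0_compat; lra)) as [n2 H2].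
    exists (n1 + n2)%nat. intros k l Hk Hl.
    assert (B : norm_le (fun z => z * (g k z - g l z))%C (eps / 36 + eps / 36 / (Y + 1) * Y)).
    { eapply norm_le_ext; [|apply (norm_le_minus _ _ _ _ (H1 k l ltac:(lia) ltac:(lia)) (SMALL (fun j => p k j 0%R - p l j 0%R) (eps / 36 / (Y + 1))%R (fun j Hj => H2 k l j ltac:(lia) ltac:(lia) Hj)))].
      intros z; cbv beta. replace (z * (g k z - g l z)) with (z * g k z - z * g l z) by ring. rewrite !ZG.
      replace (csum n (fun j => (p k j 0%R - p l j 0%R) * f j z)) with
        (csum n (fun j => p k j 0%R * f j z) + (-(1)) * csum n (fun j => p l j 0%R * f j z)); [ring|].
      rewrite <- csum_scal, <- csum_plus. apply csum_ext; intros; ring. }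
    (* Approximants and constant terms contribute eps/36 each; the factor 18 of [division_bound]
       turns their sum into eps. *)
    apply norm_le_mono with (18 * (eps / 18))%R; [|lra]. apply division_bound; [lra| |].
    - intros e He. destruct (span_approx (fun z => g k z - g l z)%C e) as (P & [d HP] & KP); [apply span_minus; apply Sg|easy|].
      exists d, P; easy.
    - destruct B as (_ & b & B & K). apply seminorm_le_mono with b; [easy|].
      assert (eps / 36 / (Y + 1) * Y <= eps / 36 / (Y + 1) * (Y + 1))%R.
      { apply Rmult_le_compat_l; [left; apply Rdiv_lt_0_compat; lra|lra]. }
      replace (eps / 36 / (Y + 1) * (Y + 1))%R with (eps / 36)%R in * by (field; lra).
      pose proof (Cmod_ge_0 (0 * (g k 0 - g l 0))). lra. }
  exists c, G. split.
  - apply span_closure_iff. split; [exists xG; easy|]. intros eps Heps. destruct (CG eps Heps) as [k Hk].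
    exists (g k). split; [apply Sg|apply Hk; lia].
  - intros z Hz. unfold unit_disk in Hz. unfold shift. pose proof (weight_pos z Hz) as W.
    enough (Z : h z - csum n (fun j => c j * f j z) - z * G z = 0).
    { transitivity (h z - csum n (fun j => c j * f j z) - z * G z + z * G z); [ring|rewrite Z; ring]. }
    apply Cmod_eq_0. apply Rle_antisym; [|apply Cmod_ge_0].
    apply Rle_plus_epsilon. intros eps Heps. rewrite Rplus_0_l.
    apply Rmult_le_reg_l with (1 - Cmod z ^ 2)%R; [lra|].
    (* Evaluation at z is bounded, so it suffices to make a norm smaller than e; the three errors
       are e/4, e/4 and 2 e/8. *)
    set (e := ((1 - Cmod z ^ 2) * eps)%R). assert (He : (0 < e)%R) by (apply Rmult_lt_0_compat; lra).
    destruct (Cu (e / 4)%R ltac:(lra)) as [n1 H1]. destruct (CG (e / 8)%R ltac:(lra)) as [n2 H2].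
    destruct (CL (e / 4 / (Y + 1))%R ltac:(apply Rdiv_lt_0_compat; lra)) as [n3 H3].
    set (k := (n1 + n2 + n3)%nat).
    pose proof (H1 k ltac:(unfold k; lia)) as B1.
    pose proof (norm_le_shift _ _ (H2 k ltac:(unfold k; lia))) as B2.
    pose proof (SMALL (fun j => c j - p k j 0%R) _ (fun j Hj => H3 k j ltac:(unfold k; lia) Hj)) as B3.
    pose proof (norm_le_minus _ _ _ _ (norm_le_minus _ _ _ _ B1 B3) B2) as B4.
    pose proof (norm_le_value _ _ z B4 Hz) as V. cbv beta in V.
    assert (EQ : h z - csum n (fun j => c j * f j z) - z * G z =
       h z - u k z - csum n (fun j => (c j - p k j 0%R) * f j z) - z * (G z - g k z)).
    { replace (csum n (fun j => (c j - p k j 0%R) * f j z)) with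
        (csum n (fun j => c j * f j z) + (-(1)) * csum n (fun j => p k j 0%R * f j z)).
      - replace (z * (G z - g k z)) with (z * G z - z * g k z) by ring. rewrite ZG. ring.
      - rewrite <- csum_scal, <- csum_plus. apply csum_ext; intros; ring. }
    rewrite EQ. eapply Rle_trans; [exact V|].
    assert (e / 4 / (Y + 1) * Y <= e / 4 / (Y + 1) * (Y + 1))%R.
    { apply Rmult_le_compat_l; [left; apply Rdiv_lt_0_compat; lra|lra]. }
    replace (e / 4 / (Y + 1) * (Y + 1))%R with (e / 4)%R in * by (field; lra). lra.
Qed.

End Span.

(** * Linear dependence *)

Lemma csum_remove n r (F : nat -> C) : (r <= n)%nat ->
  csum (S n) F = F r + csum n (fun j => F (if lt_dec j r then j else S j)).
Proof.
  induction n as [|n IH]; intros Hr.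
  - replace r with O by lia. simpl; ring.
  - change (csum (S (S n)) F) with (csum (S n) F + F (S n)).
    destruct (Nat.eq_dec r (S n)) as [->|Hne].
    + rewrite Cplus_comm. f_equal. apply csum_ext; intros j Hj. destruct (lt_dec j (S n)); [easy|lia].
    + rewrite IH by lia. change (csum (S n) ?G) with (csum n G + G n). cbv beta.
      destruct (lt_dec n r); [lia|]. ring.
Qed.

(** Gaussian elimination on the last coordinate. A pivot row r clears it from the other rows, and
    its own coefficient is then forced by cancellation in that column; without a pivot this
    coordinate imposes nothing. *)
Lemma linear_dependence n : forall A : nat -> nat -> C, exists d : nat -> C,
  (exists j, (j <= n)%nat /\ d j <> 0) /\ forall i, (i < n)%nat -> csum (S n) (fun j => d j * A j i) = 0.
Proof.
  assert (N1 : RtoC 1 <> RtoC 0) by (intros H; apply (f_equal fst) in H; simpl in H; lra).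
  induction n as [|n IH]; intros A.
  - exists (fun _ => RtoC 1). split; [exists O; easy|]. intros; lia.
  - destruct (classic (exists r, (r <= S n)%nat /\ A r n <> 0)) as [(r & Hr & Ar)|NP].
    (* [s] enumerates the rows other than the pivot. *)
    + set (s := fun j => if lt_dec j r then j else S j).
      destruct (IH (fun j i => A (s j) i - A (s j) n / A r n * A r i)) as (d & (j0 & Hj0 & D0) & HD).
      set (e := fun k => if lt_dec k r then d k else if Nat.eq_dec k r
         then - csum (S n) (fun j => d j * (A (s j) n / A r n)) else d (pred k)).
      assert (ES : forall j, e (s j) = d j).
      { intros j. unfold e, s. destruct (lt_dec j r).
        - destruct (lt_dec j r); [easy|lia].
        - destruct (lt_dec (S j) r); [lia|]. destruct (Nat.eq_dec (S j) r); [lia|easy]. }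
      assert (ER : e r = - csum (S n) (fun j => d j * (A (s j) n / A r n))).
      { unfold e. destruct (lt_dec r r); [lia|]. destruct (Nat.eq_dec r r); [easy|lia]. }
      assert (SUM : forall i, csum (S (S n)) (fun j => e j * A j i) =
         csum (S n) (fun j => d j * (A (s j) i - A (s j) n / A r n * A r i))).
      { intros i. rewrite (csum_remove _ r) by easy. rewrite ER. fold s.
        rewrite (csum_ext (S n) (fun j => e (if lt_dec j r then j else S j) * A (if lt_dec j r then j else S j) i)
          (fun j => d j * A (s j) i)) by (intros j _; fold (s j); rewrite ES; easy).
        transitivity (csum (S n) (fun j => d j * A (s j) i) + (- A r i) * csum (S n) (fun j => d j * (A (s j) n / A r n))); [ring|].
        rewrite <- csum_scal, <- csum_plus. apply csum_ext; intros; ring. }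
      exists e. split.
      * exists (s j0). rewrite ES. split; [unfold s; destruct (lt_dec j0 r); lia|easy].
      * intros i Hi. rewrite SUM. destruct (Nat.eq_dec i n) as [->|].
        -- apply csum_0. intros j _. field. easy.
        -- apply HD. lia.
    + destruct (IH A) as (d & (j0 & Hj0 & D0) & HD).
      exists (fun j => if lt_dec j (S n) then d j else 0). split.
      * exists j0. destruct (lt_dec j0 (S n)); [split; [lia|easy]|lia].
      * intros i Hi. change (csum (S (S n)) ?F) with (csum (S n) F + F (S n)). cbv beta.
        destruct (lt_dec (S n) (S n)); [lia|].
        rewrite (csum_ext (S n) _ (fun j => d j * A j i)) by (intros j Hj; destruct (lt_dec j (S n)); [easy|lia]).
        destruct (Nat.eq_dec i n) as [->|].
        -- rewrite csum_0; [ring|]. intros j Hj.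
           replace (A j n) with (RtoC 0); [ring|]. apply NNPP. intros H. apply NP. exists j. split; [lia|congruence].
        -- rewrite HD by lia. ring.
Qed.

Lemma lin_comb_csum n c b z : lin_comb n c b z = csum n (fun k => c (S k) * b (S k) z).
Proof.
  unfold lin_comb. induction n as [|n IH].
  - rewrite sum_n_m_zero by lia. reflexivity.
  - rewrite sum_n_Sm by lia. rewrite IH. reflexivity.
Qed.

Lemma shift_image_csum (F : (C -> C) -> Prop) m (h : nat -> C -> C) : linear_subspace F ->
  (forall j, (j < m)%nat -> shift_image F (h j)) -> forall d : nat -> C, shift_image F (fun z => csum m (fun j => d j * h j z))%C.
Proof.
  intros (Z & P & Sc) H d. induction m as [|m IH].
  - exists (fun _ => RtoC 0). split; [easy|]. intros z _. unfold shift; simpl; ring.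
  - destruct IH as (g & Hg & Kg); [auto|]. destruct (H m) as (k & Hk & Kk); [auto|].
    exists (fplus g (fscal (d m) k)). split; [auto|]. intros z Hz. simpl csum.
    rewrite Kg, Kk by easy. unfold shift, fplus, fscal. ring.
Qed.

(** * The invariant subspace of prescribed index *)

Theorem theorem1p5 :
  forall N : option nat, N <> Some 0%nat ->
    exists E : (C -> C) -> Prop,
      closed_shift_invariant_subspace E /\ has_index E N.
Proof.
  intros N _. destruct generators as (f & FA & FD).
  assert (INV := span_closure_invariant f FA N).
  exists (span_closure f N). split; [exact INV|].
  unfold has_index. destruct N as [n|]; simpl.
  (* [quotient_basis] counts from 1, the generators from 0. *)
  - exists (fun i => f (pred i)). split; [|split].
    + intros i Hi. apply span_in_closure; [easy|]. apply span_generator. simpl. lia.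
    + intros h Hh. destruct (generators_span f FA FD (Some n) n h eq_refl Hh) as (c & g & Hg & K).
      exists (fun i => c (pred i)), g. split; [easy|]. intros z Hz. rewrite <- K by easy.
      unfold fminus. rewrite lin_comb_csum. easy.
    + intros c (g & Hg & K) [|i] Hi; [lia|].
      apply (generators_independent f FA FD (Some n) n (fun k => c (S k))); [easy| |lia].
      exists g. split; [easy|]. intros z Hz. rewrite <- K by easy. rewrite lin_comb_csum. easy.
  - intros n b (Hb & HS & _).
    (* A basis of n elements would express n + 1 generators modulo the shift image. A linear
       relation between their coordinate rows puts a nontrivial combination of generators into that
       image, against independence. *)
    assert (HC : forall j, exists c, shift_image (span_closure f None) (fminus (f j) (lin_comb n c b))).
    { intros j. apply HS. apply span_in_closure; [easy|]. apply span_generator. easy. }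
    apply choice_fun in HC. destruct HC as [c Hc].
    destruct (linear_dependence n (fun j i => c j (S i))) as (d & (j0 & Hj0 & D0) & HD).
    apply D0. apply (generators_independent f FA FD None (S n) d); [easy| |lia].
    destruct (shift_image_csum (span_closure f None) (S n) (fun j => fminus (f j) (lin_comb n (c j) b))
      (proj1 (proj2 INV)) (fun j _ => Hc j) d) as (g & Hg & K).
    exists g. split; [easy|]. intros z Hz. rewrite <- K by easy. symmetry.
    transitivity (csum (S n) (fun j => d j * f j z) + (-(1)) * csum (S n) (fun j => csum n (fun i => d j * c j (S i) * b (S i) z))).
    + rewrite <- csum_scal, <- csum_plus. apply csum_ext; intros j _. unfold fminus. rewrite lin_comb_csum.
      rewrite (csum_ext n (fun i => d j * c j (S i) * b (S i) z) (fun i => d j * (c j (S i) * b (S i) z))) by (intros; ring).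
      rewrite csum_scal. ring.
    + rewrite csum_swap, (csum_0 n); [ring|]. intros i Hi.
      rewrite (csum_ext (S n) _ (fun j => b (S i) z * (d j * c j (S i)))) by (intros; ring).
      rewrite csum_scal, HD by easy. ring.
Qed.
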